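(* Let $G$ be a totally disconnected locally compact Polish abelian group that has a computable t.d.l.c. presentation. Then its Pontryagin dual $\widehat{G}$ is computably metrizable as a Polish group, i.e. $\widehat{G}$ admits a computably metrized presentation.
   Context: A computable t.d.l.c. presentation of an abelian group $G$ is a sequence $(A_i,\phi_i)_{i\in\mathbb{N}}$ of countable discrete groups $A_i$ and surjective homomorphisms $\phi_i:A_i\to A_{i-1}$ ($i>0$) such that $G$ is topologically isomorphic to the inverse limit $\varprojlim(A_i,\phi_i)$ (the closed subgroup of $\prod_i A_i$ consisting of $g$ with $\phi_i(g(i))=g(i-1)$ for all $i>0$), the groups $A_i$ are uniformly computable as discrete groups (domain $\subseteq\mathbb{N}$, operations computable uniformly in $i$), the maps $\phi_i$ are uniformly computable, each $\ker\phi_i$ is finite, and from $i$ one can compute a strong index (canonical code of a finite set) for $\ker\phi_i$ as a subset of $A_i$. The Pontryagin dual $\widehat{G}$ is the group of continuous homomorphisms $G\to\mathbb{R}/\mathbb{Z}$ with pointwise addition and compact-open topology. A computably metrized presentation of a Polish group $H$ is a dense sequence $(x_i)$ and a compatible complete metric $d$ such that $d(x_i,x_j)$ is a computable real uniformly in $i,j$ and the group operations are effectively continuous with respect to the basic open balls (balls with centres $x_i$ and positive rational radii): for each operation $f$ there is a c.e. family $F$ of pairs $(U,V)$ of basic open sets with $f(U)\subseteq V$ for all $(U,V)\in F$, and for every $x$ and basic open $E\ni f(x)$ there is basic open $D\ni x$ with $(D,E)\in F$. *)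

(* Defs.v *)
From HB Require Import structures.
From mathcomp Require Import all_boot all_order all_algebra.
From mathcomp Require Import all_classical all_reals all_analysis.

Set Implicit Arguments.
Unset Strict Implicit.
Unset Printing Implicit Defensive.

Import Order.TTheory GRing.Theory Num.Theory.
Import numFieldNormedType.Exports.

Local Open Scope classical_set_scope.
Local Open Scope ring_scope.
Local Open Scope quotient_scope.

(* Total recursive functions: minimization is applied only to regular
   functions (those with a zero above every v), so that no partial function is
   needed.  The recursion variable and the minimized variable come first. *)
Inductive computable : forall n : nat, (n.-tuple nat -> nat) -> Prop :=
| computable_zero n : computable (fun _ : n.-tuple nat => 0%N)
| computable_succ : computable (fun v : 1.-tuple nat => (thead v).+1)
| computable_proj n (i : 'I_n) :
    computable (fun v : n.-tuple nat => tnth v i)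
| computable_comp m n (f : m.-tuple nat -> nat)
    (g : 'I_m -> n.-tuple nat -> nat) :
    computable f -> (forall i, computable (g i)) ->
    computable (fun v : n.-tuple nat => f [tuple g i v | i < m])
| computable_primrec n (f : n.-tuple nat -> nat) (g : n.+2.-tuple nat -> nat)
    (h : n.+1.-tuple nat -> nat) :
    computable f -> computable g ->
    (forall v : n.-tuple nat, h (cons_tuple 0%N v) = f v) ->
    (forall (k : nat) (v : n.-tuple nat), h (cons_tuple k.+1 v)
       = g (cons_tuple k (cons_tuple (h (cons_tuple k v)) v))) ->
    computable h
| computable_min n (f : n.+1.-tuple nat -> nat) (h : n.-tuple nat -> nat) :
    computable f ->
    (forall v : n.-tuple nat, f (cons_tuple (h v) v) = 0%N) ->
    (forall (v : n.-tuple nat) (k : nat), (k < h v)%N ->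
       f (cons_tuple k v) <> 0%N) ->
    computable h.

Definition computable1 (f : nat -> nat) : Prop :=
  computable (fun v : 1.-tuple nat => f (nth 0%N v 0)).

Definition computable2 (f : nat -> nat -> nat) : Prop :=
  computable (fun v : 2.-tuple nat => f (nth 0%N v 0) (nth 0%N v 1)).

Definition computable3 (f : nat -> nat -> nat -> nat) : Prop :=
  computable (fun v : 3.-tuple nat =>
    f (nth 0%N v 0) (nth 0%N v 1) (nth 0%N v 2)).

Definition comp_enumerable (n : nat) (F : set (n.-tuple nat)) : Prop :=
  exists2 f : n.+1.-tuple nat -> nat, computable f &
    forall v : n.-tuple nat, F v <-> exists k : nat, f (cons_tuple k v) = 0%N.

(* The canonical index of a finite set D is \sum_(x in D) 2 ^ x. *)
Definition canonical_set (e : nat) : set nat := [set x | odd (e %/ 2 ^ x)].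

Definition uniformly_computable_reals (R : realType) (n : nat)
    (r : n.-tuple nat -> R) : Prop :=
  exists a b c : n.+1.-tuple nat -> nat,
    [/\ computable a, computable b, computable c &
    forall (v : n.-tuple nat) (k : nat),
      let w := cons_tuple k v in
      `|r v - ((a w)%:R - (b w)%:R) / (c w).+1%:R| <= 2 ^- k].

Definition is_metric (R : realType) (T : Type) (d : T -> T -> R) : Prop :=
  [/\ forall x y, d x y = 0 <-> x = y,
      forall x y, d x y = d y x &
      forall x y z, d x z <= d x y + d y z].

Definition mball (R : realType) (T : Type) (d : T -> T -> R) (x : T) (e : R) :
  set T := [set y | d x y < e].

Definition compatible_metric (R : realType) (T : topologicalType)
    (d : T -> T -> R) : Prop :=
  forall (x : T) (A : set T),
    nbhs x A <-> exists2 e : R, 0 < e & mball d x e `<=` A.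

Definition complete_metric (R : realType) (T : Type) (d : T -> T -> R) : Prop :=
  forall u : nat -> T,
    (forall e : R, 0 < e -> exists N : nat, forall m n : nat,
       (N <= m)%N -> (N <= n)%N -> d (u m) (u n) < e) ->
    exists l : T, d (u n) l @[n --> \oo] --> (0 : R).

Definition polish (R : realType) (T : topologicalType) : Prop :=
  (exists x : nat -> T, dense (range x)) /\
  exists d : T -> T -> R,
    [/\ is_metric d, compatible_metric d & complete_metric d].

(* A_i has domain [isys_dom i]; the operations and the maps are total on nat
   but only their restrictions to the domains are meaningful, and
   [isys_map i] is phi_i : A_i -> A_(i-1) for i > 0 ([isys_map 0] is unused). *)
Record inverse_system := InverseSystem {
  isys_dom : nat -> pred nat ;
  isys_one : nat -> nat ;
  isys_mul : nat -> nat -> nat -> nat ;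
  isys_inv : nat -> nat -> nat ;
  isys_map : nat -> nat -> nat }.

Definition group_on (D : pred nat) (e : nat) (mul : nat -> nat -> nat)
    (inv : nat -> nat) : Prop :=
  [/\ D e,
      {in D &, forall x y, D (mul x y)} /\ {in D, forall x, D (inv x)},
      {in D & &, forall x y z, mul x (mul y z) = mul (mul x y) z},
      {in D, forall x, mul e x = x /\ mul x e = x} &
      {in D, forall x, mul (inv x) x = e /\ mul x (inv x) = e}].

Definition surjective_hom (D : pred nat) (mul : nat -> nat -> nat)
    (D' : pred nat) (mul' : nat -> nat -> nat) (phi : nat -> nat) : Prop :=
  [/\ {in D, forall x, D' (phi x)},
      {in D &, forall x y, phi (mul x y) = mul' (phi x) (phi y)} &
      {in D', forall y, exists2 x, D x & phi x = y}].

Definition isys_ker (S : inverse_system) (i : nat) : set nat :=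
  [set x | isys_dom S i x /\ isys_map S i x = isys_one S i.-1].

(* Elements of prod_i A_i are sequences of naturals; nat is discrete, hence
   {ptws nat -> nat} induces on prod_i A_i the product of the discrete
   topologies. *)
Definition inverse_limit (S : inverse_system) : set {ptws nat -> nat} :=
  [set g | (forall i, isys_dom S i (g i)) /\
           (forall i, isys_map S i.+1 (g i.+1) = g i)].

Definition iso_inverse_limit (G : topologicalZmodType) (S : inverse_system) :
    Prop :=
  exists (f : G -> {ptws nat -> nat}) (g : {ptws nat -> nat} -> G),
    [/\ (forall x, inverse_limit S (f x)),
        cancel f g /\ (forall u, inverse_limit S u -> f (g u) = u),
        (forall x y i, f (x + y) i = isys_mul S i (f x i) (f y i)),
        continuous f &
        {within inverse_limit S, continuous g}].

Record computable_tdlc_presentation (G : topologicalZmodType)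
    (S : inverse_system) : Prop := {
  tdlc_group : forall i,
    group_on (isys_dom S i) (isys_one S i) (isys_mul S i) (isys_inv S i) ;
  tdlc_map : forall i,
    surjective_hom (isys_dom S i.+1) (isys_mul S i.+1)
                   (isys_dom S i) (isys_mul S i) (isys_map S i.+1) ;
  tdlc_iso : iso_inverse_limit G S ;
  tdlc_comp_dom : computable2 (fun i x => nat_of_bool (isys_dom S i x)) ;
  tdlc_comp_one : computable1 (isys_one S) ;
  tdlc_comp_mul : computable3 (isys_mul S) ;
  tdlc_comp_inv : computable2 (isys_inv S) ;
  tdlc_comp_map : computable2 (isys_map S) ;
  tdlc_finite_ker : forall i, finite_set (isys_ker S i.+1) ;
  tdlc_comp_ker : exists2 k : nat -> nat, computable1 k &
    forall i, isys_ker S i.+1 = canonical_set (k i.+1) }.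

Definition has_computable_tdlc_presentation (G : topologicalZmodType) : Prop :=
  exists S : inverse_system, computable_tdlc_presentation G S.

Definition eqmodZ (R : realType) (x y : R) : bool := (x - y) \is a Num.int.

Section eqmodZ.
Variable R : realType.

Lemma eqmodZ_equiv : equiv_class_of (@eqmodZ R).
Proof.
split=> [x|x y|y x z xy yz]; rewrite /eqmodZ.
- by rewrite subrr rpred0.
- by rewrite -opprB rpredN.
- by rewrite -(subrK y x) -addrA rpredD.
Qed.

Canonical eqmodZ_equiv_rel := EquivRelPack eqmodZ_equiv.

End eqmodZ.

Definition RmodZ (R : realType) : Type :=
  quotient_topology {eq_quot (@eqmodZ_equiv_rel R)}.

Section RmodZ.
Variable R : realType.

HB.instance Definition _ := Choice.on (RmodZ R).
HB.instance Definition _ := Topological.on (RmodZ R).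
HB.instance Definition _ :=
  EqQuotient.copy (RmodZ R) {eq_quot (@eqmodZ_equiv_rel R)}.

Local Notation T := (RmodZ R).

Lemma RmodZ_eqP (x y : R) :
  reflect (\pi_T x = \pi_T y) ((x - y) \is a Num.int).
Proof. exact: (@eqquotP _ _ {eq_quot (@eqmodZ_equiv_rel R)}). Qed.

Definition RmodZ_add (a b : T) : T := \pi_T (repr a + repr b).
Definition RmodZ_opp (a : T) : T := \pi_T (- repr a).

Lemma RmodZ_addE (x y : R) : RmodZ_add (\pi_T x) (\pi_T y) = \pi_T (x + y).
Proof.
apply/RmodZ_eqP; rewrite opprD addrACA rpredD//.
  by apply/RmodZ_eqP; rewrite reprK.
by apply/RmodZ_eqP; rewrite reprK.
Qed.

Lemma RmodZ_oppE (x : R) : RmodZ_opp (\pi_T x) = \pi_T (- x).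
Proof.
by apply/RmodZ_eqP; rewrite -opprD rpredN; apply/RmodZ_eqP; rewrite reprK.
Qed.

Lemma RmodZ_addA : associative RmodZ_add.
Proof.
move=> a b c; rewrite -[a]reprK -[b]reprK -[c]reprK.
set x := repr a; set y := repr b; set z := repr c.
by rewrite (RmodZ_addE y) (RmodZ_addE x y) !RmodZ_addE addrA.
Qed.

Lemma RmodZ_addC : commutative RmodZ_add.
Proof. by move=> a b; rewrite /RmodZ_add addrC. Qed.

Lemma RmodZ_add0 : left_id (\pi_T 0) RmodZ_add.
Proof. by move=> a; rewrite -[a]reprK RmodZ_addE add0r. Qed.

Lemma RmodZ_addN : left_inverse (\pi_T 0) RmodZ_opp RmodZ_add.
Proof. by move=> a; rewrite -[a]reprK RmodZ_oppE RmodZ_addE addNr. Qed.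

HB.instance Definition _ :=
  GRing.isZmodule.Build T RmodZ_addA RmodZ_addC RmodZ_add0 RmodZ_addN.

Lemma RmodZ_piD (x y : R) : \pi_T (x + y) = \pi_T x + \pi_T y.
Proof. by rewrite -RmodZ_addE. Qed.

Lemma RmodZ_piN (x : R) : \pi_T (- x) = - \pi_T x.
Proof. by rewrite -RmodZ_oppE. Qed.

Lemma RmodZ_pi_open (U : set R) : open U -> open (\pi_T @` U : set T).
Proof.
move=> oU; rewrite /open /= /quotient_open.
rewrite (_ : _ @^-1` _ = \bigcup_(z : int) ((fun x : R => x + z%:~R) @^-1` U)).
  apply: bigcup_open => z _; apply: open_comp => // x _.
  by apply: cvgD; [exact: cvg_id|exact: cvg_cst].
apply/seteqP; split=> [x [y Uy /RmodZ_eqP /intrP [z yxz]]|x [z _ Uxz]].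
  by exists z => //=; rewrite -yxz addrC subrK.
exists (x + z%:~R) => //; apply/RmodZ_eqP.
by rewrite addrAC subrr add0r intr_int.
Qed.

Lemma RmodZ_add_continuous : continuous (fun a : T * T => a.1 + a.2).
Proof.
move=> [a b]; elim/quotW: a => x; elim/quotW: b => y A /=.
rewrite -RmodZ_piD => /(@pi_continuous _ {eq_quot (@eqmodZ_equiv_rel R)} (x + y)).
have /[apply] := @add_continuous R^o (x, y).
move=> [[U V] /= [xU yV] UVA].
exists (\pi_T @` U°, \pi_T @` V°) => /=.
  split; apply: open_nbhs_nbhs; split;
    by [apply/RmodZ_pi_open/open_interior|exists x|exists y].
move=> [_ _] [/= [u /interior_subset Uu <-] [v /interior_subset Vv <-]].
by rewrite -RmodZ_piD; exact: (UVA (u, v)).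
Qed.

Lemma RmodZ_opp_continuous : continuous (-%R : T -> T).
Proof.
apply/(@quotient_continuous _ {eq_quot (@eqmodZ_equiv_rel R)}).
rewrite (_ : _ \o _ = \pi_T \o (-%R : R -> R)); last first.
  by apply/funext => x /=; rewrite RmodZ_piN.
move=> x; apply: continuous_comp; first exact: (@opp_continuous R^o).
exact: (@pi_continuous _ {eq_quot (@eqmodZ_equiv_rel R)}).
Qed.

HB.instance Definition _ :=
  PreTopologicalNmodule_isTopologicalNmodule.Build T RmodZ_add_continuous.
HB.instance Definition _ :=
  TopologicalNmodule_isTopologicalZmodule.Build T RmodZ_opp_continuous.

End RmodZ.

Section pontryagin_dual.
Variables (R : realType) (G : topologicalZmodType).

Definition character : {pred G -> RmodZ R} :=
  fun chi => `[< continuous chi /\ {morph chi : x y / x + y} >].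

Lemma character_zmod_closed : zmod_closed character.
Proof.
split=> [|f g /asboolP[cf mf] /asboolP[cg mg]]; apply/asboolP; split.
- by move=> x; exact: (@cvg_cst (RmodZ R)).
- by move=> x y /=; rewrite addr0.
- move=> x; apply: (@continuous_comp _ _ _ (fun x => (f x, g x))
    (fun a : RmodZ R * RmodZ R => a.1 - a.2)); last exact: sub_continuous.
  have := cvg_pair (cf x) (cg x); exact.
- by move=> x y; rewrite !fctE mf mg opprD addrACA.
Qed.

HB.instance Definition _ :=
  GRing.isZmodClosed.Build (G -> RmodZ R) character character_zmod_closed.

Record pontryagin_dual : Type := PontryaginDual {
  char_val :> G -> RmodZ R ;
  char_valP : char_val \in character }.

HB.instance Definition _ := [isSub for char_val].
HB.instance Definition _ := [Choice of pontryagin_dual by <:].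
HB.instance Definition _ := [SubChoice_isSubZmodule of pontryagin_dual by <:].
HB.instance Definition _ := Topological.copy pontryagin_dual
  (@initial_topology pontryagin_dual {compact-open, G -> RmodZ R} char_val).

End pontryagin_dual.

(* H is only required to be an abelian group with a topology: continuity of its
   operations follows from their effective continuity. *)
Section computably_metrized.
Variables (R : realType) (H : PreTopologicalZmodule.type).
Variables (x : nat -> H) (d : H -> H -> R).

(* The name (i, p, q) stands for the ball of centre x_i and radius
   (p + 1) / (q + 1). *)
Definition basic_ball (u : 3.-tuple nat) : set H :=
  mball d (x (nth 0%N u 0)) ((nth 0%N u 1).+1%:R / (nth 0%N u 2).+1%:R).

Definition effectively_continuous1 (f : H -> H) : Prop :=
  exists F : set ((3 + 3).-tuple nat),
    [/\ comp_enumerable F,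
        forall u v : 3.-tuple nat, F (cat_tuple u v) ->
          f @` basic_ball u `<=` basic_ball v &
        forall (a : H) (v : 3.-tuple nat), basic_ball v (f a) ->
          exists2 u : 3.-tuple nat, basic_ball u a & F (cat_tuple u v)].

(* Basic open subsets of H * H are products of two basic balls. *)
Definition effectively_continuous2 (f : H -> H -> H) : Prop :=
  exists F : set ((3 + (3 + 3)).-tuple nat),
    [/\ comp_enumerable F,
        forall u u' v : 3.-tuple nat, F (cat_tuple u (cat_tuple u' v)) ->
          forall a b, basic_ball u a -> basic_ball u' b -> basic_ball v (f a b) &
        forall (a b : H) (v : 3.-tuple nat), basic_ball v (f a b) ->
          exists u u' : 3.-tuple nat,
            [/\ basic_ball u a, basic_ball u' b &
                F (cat_tuple u (cat_tuple u' v))]].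

Record computably_metrized_presentation : Prop := {
  cmp_dense : dense (range x) ;
  cmp_metric : is_metric d ;
  cmp_compatible : compatible_metric d ;
  cmp_complete : complete_metric d ;
  cmp_dist : uniformly_computable_reals (fun v : 2.-tuple nat =>
    d (x (nth 0%N v 0)) (x (nth 0%N v 1))) ;
  cmp_add : effectively_continuous2 (fun a b => a + b) ;
  cmp_opp : effectively_continuous1 (fun a => - a) }.

End computably_metrized.

Definition computably_metrizable (R : realType)
    (H : PreTopologicalZmodule.type) : Prop :=
  exists (x : nat -> H) (d : H -> H -> R), computably_metrized_presentation x d.

(* Main.v *)
(* Write G as the inverse limit of the A_i with projections p_i.  Every character
   of G factors through some A_i, because R/Z has no small subgroups.  On the dual
   take the invariant metric d(chi, psi) = |chi - psi|, where |chi| is the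
   supremum over x in G of 2^-(p_0 x) * dist(chi x, Z), the elements of A_0 being
   natural numbers.

   The dense sequence is obtained from a quantitative Kronecker theorem: there is
   a computable m(t) such that, for elements a_1, ..., a_t of any abelian group,
   real numbers theta_j satisfying up to 1/4 all relations between the a_j with
   coefficients at most m(t) are within 2^-t of the values chi(a_j) of a
   character chi.  It follows by averaging over characters the trigonometric
   polynomial prod_j (2 cos pi(theta_j - chi(a_j)))^(2m): the average is the part
   of its expansion supported on relations, so it is at least the constant term
   C(2m, m)^t.  Hence it is decidable whether a vector of rationals on a grid is
   close to a character of A_i; a vector that passes the test at stage t can be
   refined, by bounded search, to one that passes the test at stage t + 1, and in
   the limit one obtains a character with computable values.

   Finally, the finite kernels of A_i -> A_0 are computable, so the supremum
   defining the norm of a character of A_i is, up to 2^-K, a maximum over a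
   computable finite set; and for an invariant metric the effective continuity of
   the operations follows from the computability of the distances
   d(x_u + x_u', x_v). *)

Require Import Defs.
From HB Require Import structures.
From mathcomp Require Import all_boot all_order all_algebra.
From mathcomp Require Import all_classical all_reals all_analysis.
From mathcomp Require Import zify ring lra.

Set Implicit Arguments.
Unset Strict Implicit.
Unset Printing Implicit Defensive.

Import Order.TTheory GRing.Theory Num.Theory.
Import numFieldNormedType.Exports.

Local Open Scope classical_set_scope.
Local Open Scope ring_scope.
Local Open Scope quotient_scope.

(** * Computable functions *)

Section computable_tuples.
Local Open Scope nat_scope.

(** To extend a character from a subgroup to a new element one needs the least positive multiple of
    that element lying in the subgroup, and this multiple cannot be computed in general. Genuine
    characters, which come from Zorn's lemma, therefore only serve to prove that searches succeed;
    the algorithms handle nothing but grid points and a decidable test on finitely many relations.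
    The test is sound by the Kronecker theorem, and the rounding of every character passes it, so a
    point that passes has a successor at the next stage. The characters that witness successive
    stages may differ: the limit exists because successive points are near each other, and it is
    additive because each stage is close to some homomorphism.

    The averaging requires no measure: finite averages over the multiples of one rational-valued
    homomorphism remove the unwanted terms step by step.

    The weights make up for the lack of compactness: the elements x with p_0 x < K form a compact
    set, covered at each level by finitely many cosets, and outside it the weight is at most 2^-K.
    Hence the norm defines the compact-open topology and is computable from finite data. *)

Lemma computable_ext n (f g : n.-tuple nat -> nat) :
  computable f -> f =1 g -> computable g.
Proof. by move=> cf /funext <-. Qed.

Lemma computable_nth n i :
  (i < n)%N -> computable (fun v : n.-tuple nat => nth 0 v i).
Proof.
move=> lt_in; apply: computable_ext (computable_proj (Ordinal lt_in)) _ => v.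
by rewrite (tnth_nth 0).
Qed.

Lemma nth_mktuple_tnth m (T : Type) (x0 : T) (g : 'I_m -> T) i (lt : (i < m)%N) :
  nth x0 [tuple g i | i < m] i = g (Ordinal lt).
Proof. by rewrite -(tnth_mktuple g (Ordinal lt)) (tnth_nth x0). Qed.

Lemma computable_app1 (F : nat -> nat) n (a : n.-tuple nat -> nat) :
  computable1 F -> computable a -> computable (fun v => F (a v)).
Proof.
move=> cF ca.
apply: computable_ext (computable_comp cF (g := fun _ => a) _) _ => //.
by move=> v /=; rewrite (nth_mktuple_tnth _ _ (isT : 0 < 1)).
Qed.

Lemma computable_app2 (F : nat -> nat -> nat) n (a b : n.-tuple nat -> nat) :
  computable2 F -> computable a -> computable b ->
  computable (fun v => F (a v) (b v)).
Proof.
move=> cF ca cb; pose g (i : 'I_2) := if val i == 0 then a else b.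
apply: computable_ext (computable_comp cF (g := g) _) _ => [[[|[|//]] ? //]|v].
rewrite /= (nth_mktuple_tnth _ _ (isT : 0 < 2)).
by rewrite (nth_mktuple_tnth _ _ (isT : 1 < 2)).
Qed.

Lemma computable_app3 (F : nat -> nat -> nat -> nat) n
    (a b c : n.-tuple nat -> nat) :
  computable3 F -> computable a -> computable b -> computable c ->
  computable (fun v => F (a v) (b v) (c v)).
Proof.
move=> cF ca cb cc.
pose g (i : 'I_3) := if val i == 0 then a else if val i == 1 then b else c.
apply: computable_ext (computable_comp cF (g := g) _) _ => [[[|[|[|//]]] ? //]|v].
rewrite /= (nth_mktuple_tnth _ _ (isT : 0 < 3)).
rewrite (nth_mktuple_tnth _ _ (isT : 1 < 3)).
by rewrite (nth_mktuple_tnth _ _ (isT : 2 < 3)).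
Qed.

Lemma computable1_id : computable1 id.
Proof. exact: computable_nth. Qed.

Lemma computable1_succ : computable1 S.
Proof.
apply: computable_ext computable_succ _ => v.
by rewrite /thead (tnth_nth 0).
Qed.

Lemma computable_const n c : computable (fun _ : n.-tuple nat => c).
Proof.
elim: c => [|c IH]; first exact: computable_zero.
exact: (computable_app1 computable1_succ IH).
Qed.

Lemma computable_rec2 (f : nat -> nat) (g : nat -> nat -> nat -> nat)
    (h : nat -> nat -> nat) :
  computable1 f -> computable3 g ->
  (forall x, h 0 x = f x) -> (forall k x, h k.+1 x = g k (h k x) x) ->
  computable2 h.
Proof.
move=> cf cg h0 hS; apply: (computable_primrec (n := 1) cf cg) => [v|k v] /=.
  exact: h0.
exact: hS.
Qed.

Lemma computable2_swap F : computable2 F -> computable2 (fun x y => F y x).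
Proof. by move=> cF; apply: (computable_app2 cF); exact: computable_nth. Qed.

Lemma computable2_add : computable2 addn.
Proof.
apply: (computable_rec2 (f := id) (g := fun _ r _ => r.+1)) => //.
  exact: computable1_id.
exact: (computable_app1 computable1_succ (computable_nth _)).
Qed.

Lemma computable2_mul : computable2 muln.
Proof.
apply: (computable_rec2 (f := fun=> 0) (g := fun _ r x => x + r)) => //.
- exact: computable_const.
- by apply: (computable_app2 computable2_add); exact: computable_nth.
Qed.

Lemma computable1_pred : computable1 predn.
Proof.
have h : computable2 (fun x _ => x.-1).
  apply: (computable_rec2 (f := fun=> 0) (g := fun k _ _ => k)) => //.
    exact: computable_const.
  exact: computable_nth.
exact: (computable_app2 h (computable_nth _) (computable_const _ 0)).
Qed.

Lemma computable2_sub : computable2 subn.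
Proof.
apply: (computable2_swap (F := fun y x => x - y)).
apply: (computable_rec2 (f := id) (g := fun _ r _ => r.-1)).
- exact: computable1_id.
- exact: (computable_app1 computable1_pred (computable_nth _)).
- by move=> x; rewrite subn0.
- by move=> k x; rewrite subnS.
Qed.

Lemma computable2_exp : computable2 expn.
Proof.
apply: (computable2_swap (F := fun y x => x ^ y)).
apply: (computable_rec2 (f := fun=> 1) (g := fun _ r x => x * r)) => //.
- exact: computable_const.
- by apply: (computable_app2 computable2_mul); exact: computable_nth.
- by move=> k x; rewrite expnS.
Qed.

Lemma computable2_leq : computable2 (fun x y => nat_of_bool (x <= y)).
Proof.
apply: computable_ext (computable_app2 computable2_sub (computable_const _ 1)
  (computable_app2 computable2_sub (computable_nth (i := 0) _)
     (computable_nth (i := 1) _))) _ => // v /=.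
by rewrite /leq; case: (nth 0 v 0 - nth 0 v 1).
Qed.

Lemma computable_min1 (P : nat -> nat -> bool) (h : nat -> nat) :
  computable2 (fun k x => nat_of_bool (P k x)) ->
  (forall x, P (h x) x) -> (forall x k, P k x -> h x <= k) ->
  computable1 h.
Proof.
move=> cP Ph hP.
have c : computable (fun w : 2.-tuple nat =>
    1 - nat_of_bool (P (nth 0 w 0) (nth 0 w 1))).
  exact: (computable_app2 computable2_sub (computable_const _ 1) cP).
apply: (computable_min (n := 1) c) => [v|v k] /=; first by rewrite Ph.
by rewrite ltnNge; case: (P k _) (hP (nth 0 v 0) k) => // ->.
Qed.

Lemma computable2_min (P : nat -> nat -> nat -> bool) (h : nat -> nat -> nat) :
  computable3 (fun k x y => nat_of_bool (P k x y)) ->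
  (forall x y, P (h x y) x y) -> (forall x y k, P k x y -> h x y <= k) ->
  computable2 h.
Proof.
move=> cP Ph hP.
have c : computable (fun w : 3.-tuple nat =>
    1 - nat_of_bool (P (nth 0 w 0) (nth 0 w 1) (nth 0 w 2))).
  exact: (computable_app2 computable2_sub (computable_const _ 1) cP).
apply: (computable_min (n := 2) c) => [v|v k] /=; first by rewrite Ph.
by rewrite ltnNge; case: (P k _ _) (hP (nth 0 v 0) (nth 0 v 1) k) => // ->.
Qed.

(* [x %/ 0 = 0] forces the disjunct [y == 0]. *)
Lemma computable2_div : computable2 divn.
Proof.
apply: (computable2_min
  (P := fun k x y => (y <= 0) + (x.+1 <= k.+1 * y) >= 1)).
- apply: (computable_app2 computable2_leq (computable_const _ 1)).
  apply: (computable_app2 computable2_add).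
    exact: (computable_app2 computable2_leq (computable_nth _)
      (computable_const _ 0)).
  apply: (computable_app2 computable2_leq).
    exact: (computable_app1 computable1_succ (computable_nth _)).
  apply: (computable_app2 computable2_mul); last exact: computable_nth.
  exact: (computable_app1 computable1_succ (computable_nth _)).
- move=> x [|y] //; rewrite addn_gt0; apply/orP; right.
  by rewrite lt0b ltn_ceil.
- move=> x [|y] k; first by rewrite divn0.
  by rewrite add0n lt0b -ltn_divLR.
Qed.

End computable_tuples.

Section pairing.
Local Open Scope nat_scope.

(** The value is never 0, which leaves 0 available as a number that codes no pair. The first
    component is the 2-adic valuation. *)
Definition npair (x y : nat) : nat := 2 ^ x * y.*2.+1.
Definition nfst (z : nat) : nat := logn 2 z.
Definition nsnd (z : nat) : nat := (z %/ 2 ^ nfst z)./2.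

Lemma npairK1 x y : nfst (npair x y) = x.
Proof.
rewrite /nfst /npair lognM ?expn_gt0// pfactorK// lognE/= dvdn2 /=.
by rewrite odd_double addn0.
Qed.

Lemma npairK2 x y : nsnd (npair x y) = y.
Proof.
rewrite /nsnd npairK1 /npair mulKn ?expn_gt0//.
by rewrite -[_.+1]addn1 addnC halfD/= odd_double doubleK.
Qed.

Lemma computable2_pair : computable2 npair.
Proof.
apply: (computable_app2 computable2_mul).
  exact: (computable_app2 computable2_exp (computable_const _ 2)
    (computable_nth _)).
apply: (computable_app1 computable1_succ).
apply: computable_ext (computable_app2 computable2_mul
  (computable_nth (i := 1) _) (computable_const _ 2)) _ => // v.
by rewrite muln2.
Qed.

Lemma computable1_half : computable1 half.
Proof.
apply: computable_ext (computable_app2 computable2_div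
  (computable_nth (i := 0) _) (computable_const _ 2)) _ => // v.
by rewrite divn2.
Qed.

Lemma computable1_fst : computable1 nfst.
Proof.
(* The valuation is the least k such that 2^(k+1) does not divide z. A sum of truth values that is
   at least 1 expresses a disjunction, and the disjunct z <= 0 gives the value 0 at z = 0, in
   agreement with [logn]. *)
apply: (computable_min1 (P := fun k z =>
  (z <= 0) + (2 ^ k.+1 * (z %/ 2 ^ k.+1) + 1 <= z) >= 1)).
- apply: (computable_app2 computable2_leq (computable_const _ 1)).
  apply: (computable_app2 computable2_add).
    exact: (computable_app2 computable2_leq (computable_nth _)
      (computable_const _ 0)).
  have c : computable (fun v : 2.-tuple nat => 2 ^ (nth 0 v 0).+1).
    apply: (computable_app2 computable2_exp (computable_const _ 2)).
    exact: (computable_app1 computable1_succ (computable_nth _)).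
  apply: (computable_app2 computable2_leq); last exact: computable_nth.
  apply: (computable_app2 computable2_add); last exact: computable_const.
  apply: (computable_app2 computable2_mul) => //.
  by apply: (computable_app2 computable2_div) => //; exact: computable_nth.
- move=> [|z] //; rewrite add0n lt0b addn1 mulnC.
  rewrite ltn_neqAle leq_divM andbT; apply/eqP => h.
  have : 2 ^ (nfst z.+1).+1 %| z.+1 by apply/dvdnP; exists (z.+1 %/ 2 ^ (nfst z.+1).+1).
  by rewrite pfactor_dvdn// ltnn.
- move=> [|z] k; first by rewrite /nfst logn0.
  rewrite add0n lt0b addn1 mulnC => lt; rewrite leqNgt; apply/negP => h.
  by move: lt; rewrite divnK ?ltnn// pfactor_dvdn.
Qed.

Lemma computable1_snd : computable1 nsnd.
Proof.
apply: (computable_app1 computable1_half).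
apply: (computable_app2 computable2_div); first exact: computable_nth.
apply: (computable_app2 computable2_exp); first exact: computable_const.
exact: (computable_app1 computable1_fst (computable_nth _)).
Qed.

End pairing.

(* A coding of [X] by natural numbers; [code_normal] says that the junk numbers
   can be computably replaced by proper codes. *)
Class coded (X : Type) := Coded {
  code : X -> nat ;
  decode : nat -> X ;
  codeK : cancel code decode ;
  code_normal : computable1 (fun n => code (decode n)) }.

#[export] Instance coded_nat : coded nat := {|
  code := id ; decode := id ; codeK := fun=> erefl ;
  code_normal := computable1_id |}.

Lemma coded_bool_normal : computable1 (fun n => nat_of_bool (0 < n)%N).
Proof.
exact: (computable_app2 computable2_leq (computable_const _ 1)
  (computable_nth _)).
Qed.

Lemma coded_boolK : cancel nat_of_bool (fun n => (0 < n)%N).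
Proof. by case. Qed.

#[export] Instance coded_bool : coded bool := {|
  codeK := coded_boolK ; code_normal := coded_bool_normal |}.

Section coded_prod.
Variables (X Y : Type) (cX : coded X) (cY : coded Y).

Definition code_prod (p : X * Y) : nat := npair (code p.1) (code p.2).
Definition decode_prod (n : nat) : X * Y := (decode (nfst n), decode (nsnd n)).

Lemma code_prodK : cancel code_prod decode_prod.
Proof. by case=> x y; rewrite /decode_prod npairK1 npairK2 !codeK. Qed.

Lemma code_prod_normal : computable1 (fun n => code_prod (decode_prod n)).
Proof.
apply: (computable_app2 computable2_pair) => /=.
- exact: (computable_app1 (F := fun n => code (decode (nfst n)))
    (computable_app1 code_normal computable1_fst) (computable_nth _)).
- exact: (computable_app1 (F := fun n => code (decode (nsnd n)))
    (computable_app1 code_normal computable1_snd) (computable_nth _)).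
Qed.

#[export] Instance coded_prod : coded (X * Y) := {|
  codeK := code_prodK ; code_normal := code_prod_normal |}.

End coded_prod.

(** With coded arguments in place of tuples, functions of several variables obey a single
    composition rule, so that the computability of a term can be read off its syntax. *)
Definition cfun (X Y : Type) {cX : coded X} {cY : coded Y} (f : X -> Y) : Prop :=
  computable1 (fun n => code (f (decode n))).

Section cfun_theory.
Context {X Y Z : Type} {cX : coded X} {cY : coded Y} {cZ : coded Z}.

Lemma cfun_ext (f g : X -> Y) : cfun f -> f =1 g -> cfun g.
Proof. by move=> cf /funext <-. Qed.

Lemma cfun_id : cfun (@id X).
Proof. exact: code_normal. Qed.

Lemma cfun_app (F : Y -> Z) (a : X -> Y) :
  cfun F -> cfun a -> cfun (fun x => F (a x)).
Proof.
move=> cF ca; apply: computable_ext (computable_app1 cF ca) _ => v /=.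
by rewrite codeK.
Qed.

Lemma cfun_cst (y : Y) : cfun (fun _ : X => y).
Proof. exact: computable_const. Qed.

Lemma cfun_pair (f : X -> Y) (g : X -> Z) :
  cfun f -> cfun g -> cfun (fun x => (f x, g x)).
Proof. by move=> cf cg; exact: (computable_app2 computable2_pair cf cg). Qed.

Lemma cfun_fst (f : X -> Y * Z) : cfun f -> cfun (fun x => (f x).1).
Proof.
move=> cf; apply: computable_ext (computable_app1 computable1_fst cf) _ => v /=.
by rewrite npairK1.
Qed.

Lemma cfun_snd (f : X -> Y * Z) : cfun f -> cfun (fun x => (f x).2).
Proof.
move=> cf; apply: computable_ext (computable_app1 computable1_snd cf) _ => v /=.
by rewrite npairK2.
Qed.

End cfun_theory.

Definition cfun2 {X Y Z : Type} {cX : coded X} {cY : coded Y} {cZ : coded Z}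
  (F : X -> Y -> Z) : Prop := cfun (fun p : X * Y => F p.1 p.2).

Definition cfun3 {X Y Z W : Type} {cX : coded X} {cY : coded Y} {cZ : coded Z}
    {cW : coded W} (F : X -> Y -> Z -> W) : Prop :=
  cfun (fun p : X * Y * Z => F p.1.1 p.1.2 p.2).

Definition cfun4 {X Y Z W V : Type} {cX : coded X} {cY : coded Y} {cZ : coded Z}
    {cW : coded W} {cV : coded V} (F : X -> Y -> Z -> W -> V) : Prop :=
  cfun (fun p : X * Y * Z * W => F p.1.1.1 p.1.1.2 p.1.2 p.2).

Section cfun_app.
Context {X Y1 Y2 Y3 Y4 Z : Type} {cX : coded X} {c1 : coded Y1} {c2 : coded Y2}
  {c3 : coded Y3} {c4 : coded Y4} {cZ : coded Z}.
Variables (a1 : X -> Y1) (a2 : X -> Y2) (a3 : X -> Y3) (a4 : X -> Y4).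

Lemma cfun_app2 (F : Y1 -> Y2 -> Z) : cfun2 F -> cfun a1 -> cfun a2 ->
  cfun (fun x => F (a1 x) (a2 x)).
Proof. by move=> cF h1 h2; exact: (cfun_app cF (cfun_pair h1 h2)). Qed.

Lemma cfun_app3 (F : Y1 -> Y2 -> Y3 -> Z) :
  cfun3 F -> cfun a1 -> cfun a2 -> cfun a3 ->
  cfun (fun x => F (a1 x) (a2 x) (a3 x)).
Proof.
move=> cF h1 h2 h3; exact: (cfun_app cF (cfun_pair (cfun_pair h1 h2) h3)).
Qed.

Lemma cfun_app4 (F : Y1 -> Y2 -> Y3 -> Y4 -> Z) :
  cfun4 F -> cfun a1 -> cfun a2 -> cfun a3 -> cfun a4 ->
  cfun (fun x => F (a1 x) (a2 x) (a3 x) (a4 x)).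
Proof.
move=> cF h1 h2 h3 h4.
exact: (cfun_app cF (cfun_pair (cfun_pair (cfun_pair h1 h2) h3) h4)).
Qed.

End cfun_app.

Section cfun_tuples.
Local Open Scope nat_scope.

Lemma cfun2_computable2 (f : nat -> nat -> nat) : computable2 f -> cfun2 f.
Proof.
move=> cf; exact: (computable_app2 cf computable1_fst computable1_snd).
Qed.

Lemma cfun2_computable2b (f : nat -> nat -> bool) :
  computable2 (fun x y => nat_of_bool (f x y)) -> cfun2 f.
Proof.
move=> cf; exact: (computable_app2 cf computable1_fst computable1_snd).
Qed.

Lemma cfun3_computable3 (f : nat -> nat -> nat -> nat) :
  computable3 f -> cfun3 f.
Proof.
move=> cf; apply: (computable_app3 cf) computable1_snd.
- exact: (computable_app1 computable1_fst computable1_fst).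
- exact: (computable_app1 computable1_snd computable1_fst).
Qed.

Lemma computable_cfun1 X (cX : coded X) n (a : n.-tuple nat -> X) (f : X -> nat) :
  cfun f -> computable (fun v => code (a v)) -> computable (fun v => f (a v)).
Proof.
move=> cf ca; apply: computable_ext (computable_app1 cf ca) _ => v /=.
by rewrite codeK.
Qed.

Lemma computable_code_pair X Y (cX : coded X) (cY : coded Y) n
    (a : n.-tuple nat -> X) (b : n.-tuple nat -> Y) :
  computable (fun v => code (a v)) -> computable (fun v => code (b v)) ->
  computable (fun v => code (a v, b v)).
Proof. by move=> ca cb; exact: (computable_app2 computable2_pair ca cb). Qed.

End cfun_tuples.

Section cfun_arith.
Local Open Scope nat_scope.
Context {X : Type} {cX : coded X}.
Implicit Types (a b c : X -> nat) (p q : X -> bool).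

Lemma cfun_succ a : cfun a -> cfun (fun x => (a x).+1).
Proof. exact: (cfun_app (F := S) computable1_succ). Qed.

Lemma cfun_add a b : cfun a -> cfun b -> cfun (fun x => a x + b x).
Proof. exact: (cfun_app2 (cfun2_computable2 computable2_add)). Qed.

Lemma cfun_mul a b : cfun a -> cfun b -> cfun (fun x => a x * b x).
Proof. exact: (cfun_app2 (cfun2_computable2 computable2_mul)). Qed.

Lemma cfun_sub a b : cfun a -> cfun b -> cfun (fun x => a x - b x).
Proof. exact: (cfun_app2 (cfun2_computable2 computable2_sub)). Qed.

Lemma cfun_exp a b : cfun a -> cfun b -> cfun (fun x => a x ^ b x).
Proof. exact: (cfun_app2 (cfun2_computable2 computable2_exp)). Qed.

Lemma cfun_div a b : cfun a -> cfun b -> cfun (fun x => a x %/ b x).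
Proof. exact: (cfun_app2 (cfun2_computable2 computable2_div)). Qed.

Lemma cfun_mod a b : cfun a -> cfun b -> cfun (fun x => a x %% b x).
Proof.
move=> ca cb; apply: cfun_ext (cfun_sub ca (cfun_mul (cfun_div ca cb) cb)) _.
by move=> x; rewrite {1}(divn_eq (a x) (b x)) addKn.
Qed.

Lemma cfun_leq a b : cfun a -> cfun b -> cfun (fun x => a x <= b x).
Proof. exact: (cfun_app2 (cfun2_computable2b computable2_leq)). Qed.

Lemma cfun_nat_of_bool p : cfun p -> cfun (fun x => nat_of_bool (p x)).
Proof. by []. Qed.

Lemma cfun_gt0 a : cfun a -> cfun (fun x => 0 < a x).
Proof. by move=> ca; apply: cfun_leq; first exact: cfun_cst. Qed.

Lemma cfun_and p q : cfun p -> cfun q -> cfun (fun x => p x && q x).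
Proof.
move=> cp cq; apply: cfun_ext (cfun_gt0 (cfun_mul (cfun_nat_of_bool cp)
  (cfun_nat_of_bool cq))) _.
by move=> x; case: (p x); case: (q x).
Qed.

Lemma cfun_neg p : cfun p -> cfun (fun x => ~~ p x).
Proof.
move=> cp; apply: cfun_ext (cfun_gt0 (cfun_sub (cfun_cst 1)
  (cfun_nat_of_bool cp))) _.
by move=> x; case: (p x).
Qed.

Lemma cfun_or p q : cfun p -> cfun q -> cfun (fun x => p x || q x).
Proof.
move=> cp cq; apply: cfun_ext (cfun_neg (cfun_and (cfun_neg cp) (cfun_neg cq))) _.
by move=> x; case: (p x); case: (q x).
Qed.

Lemma cfun_imply p q : cfun p -> cfun q -> cfun (fun x => p x ==> q x).
Proof.
move=> cp cq; apply: cfun_ext (cfun_or (cfun_neg cp) cq) _.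
by move=> x; rewrite implybE.
Qed.

Lemma cfun_eqn a b : cfun a -> cfun b -> cfun (fun x => a x == b x).
Proof.
move=> ca cb; apply: cfun_ext (cfun_and (cfun_leq ca cb) (cfun_leq cb ca)) _.
by move=> x; rewrite eqn_leq.
Qed.

Lemma cfun_if p a b :
  cfun p -> cfun a -> cfun b -> cfun (fun x => if p x then a x else b x).
Proof.
move=> cp ca cb; apply: cfun_ext (cfun_add (cfun_mul (cfun_nat_of_bool cp) ca)
  (cfun_mul (cfun_nat_of_bool (cfun_neg cp)) cb)) _.
by move=> x; case: (p x); rewrite /= ?mul1n ?mul0n ?addn0.
Qed.

Lemma cfun_minn a b : cfun a -> cfun b -> cfun (fun x => minn (a x) (b x)).
Proof.
by move=> ca cb; apply: (cfun_if (p := fun x => a x < b x)) => //;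
  exact: cfun_leq (cfun_succ ca) cb.
Qed.

Lemma cfun_maxn a b : cfun a -> cfun b -> cfun (fun x => maxn (a x) (b x)).
Proof.
by move=> ca cb; apply: (cfun_if (p := fun x => a x < b x)) => //;
  exact: cfun_leq (cfun_succ ca) cb.
Qed.

Lemma cfun_iteri Y (cY : coded Y) (n : X -> nat) (s : X -> nat -> Y -> Y)
    (z : X -> Y) :
  cfun n -> cfun3 s -> cfun z -> cfun (fun x => iteri (n x) (s x) (z x)).
Proof.
move=> cn cs cz.
(* The recursion runs on codes: the intermediate value is stored as a code and decoded at each step,
   and the parameter is an arbitrary number m, normalized by [decode]. *)
have h : computable2 (fun k m => code (iteri k (s (decode m)) (z (decode m)))).
  apply: (computable_rec2 (f := fun m => code (z (decode m)))
    (g := fun k r m => code (s (decode m) k (decode r)))) => //=; last first.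
    by move=> k m; rewrite codeK.
  apply: (computable_cfun1
    (f := fun p : X * nat * Y => code (s p.1.1 p.1.2 p.2))
    (a := fun v : 3.-tuple nat =>
      (decode (nth 0 v 2), nth 0 v 0, decode (nth 0 v 1)))) => //=.
  do 2?apply: computable_code_pair; last 2 first.
  - exact: computable_nth.
  - exact: (computable_app1 code_normal (computable_nth _)).
  - exact: (computable_app1 code_normal (computable_nth _)).
exact: (computable_app2 h cn (computable_nth _)).
Qed.

Lemma cfun_mu (P : X -> nat -> bool) (h : X -> nat) :
  cfun2 P -> (forall x, P x (h x)) -> (forall x k, P x k -> h x <= k) ->
  cfun h.
Proof.
move=> cP Ph hP.
apply: (computable_min1 (P := fun k n => P (decode n) k)) => // [|x k]; last first.
  exact: hP.
apply: (computable_cfun1 (f := fun p : X * nat => nat_of_bool (P p.1 p.2))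
  (a := fun v : 2.-tuple nat => (decode (nth 0 v 1), nth 0 v 0))) => //.
apply: computable_code_pair; last exact: computable_nth.
exact: (computable_app1 code_normal (computable_nth _)).
Qed.

End cfun_arith.

(* Proves [cfun (fun x => t)] by structural recursion on [t]; [H] is tried on
   the subterms that are not built from the operations above. *)
Ltac cfun_auto H :=
  first
  [ assumption
  | lazymatch goal with
    | |- cfun (fun _ => ?c) => exact: (cfun_cst c)
    | |- cfun (fun x => x) => exact: cfun_id
    | |- cfun fst => exact: (cfun_fst cfun_id)
    | |- cfun snd => exact: (cfun_snd cfun_id)
    | |- cfun S => exact: (cfun_succ cfun_id)
    | |- cfun (leq ?c) => exact: (cfun_leq (cfun_cst c) cfun_id)
    | |- cfun (muln ?c) => exact: (cfun_mul (cfun_cst c) cfun_id)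
    | |- cfun (addn ?c) => exact: (cfun_add (cfun_cst c) cfun_id)
    | |- cfun (expn ?c) => exact: (cfun_exp (cfun_cst c) cfun_id)
    | |- cfun (fun x => pair _ _) => apply: cfun_pair; cfun_auto H
    | |- cfun (fun x => fst _) => apply: cfun_fst; cfun_auto H
    | |- cfun (fun x => snd _) => apply: cfun_snd; cfun_auto H
    | |- cfun (fun x => S _) => apply: cfun_succ; cfun_auto H
    | |- cfun (fun x => addn _ _) => apply: cfun_add; cfun_auto H
    | |- cfun (fun x => muln _ _) => apply: cfun_mul; cfun_auto H
    | |- cfun (fun x => subn _ _) => apply: cfun_sub; cfun_auto H
    | |- cfun (fun x => expn _ _) => apply: cfun_exp; cfun_auto H
    | |- cfun (fun x => divn _ _) => apply: cfun_div; cfun_auto H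
    | |- cfun (fun x => modn _ _) => apply: cfun_mod; cfun_auto H
    | |- cfun (fun x => leq _ _) => apply: cfun_leq; cfun_auto H
    | |- cfun (fun x => minn _ _) => apply: cfun_minn; cfun_auto H
    | |- cfun (fun x => maxn _ _) => apply: cfun_maxn; cfun_auto H
    | |- cfun (fun x => nat_of_bool _) => apply: cfun_nat_of_bool; cfun_auto H
    | |- cfun (fun x => negb _) => apply: cfun_neg; cfun_auto H
    | |- cfun (fun x => andb _ _) => apply: cfun_and; cfun_auto H
    | |- cfun (fun x => orb _ _) => apply: cfun_or; cfun_auto H
    | |- cfun (fun x => implb _ _) => apply: cfun_imply; cfun_auto H
    | |- cfun (fun x => eq_op _ _) => apply: cfun_eqn; cfun_auto H
    | |- cfun (fun x => if _ then _ else _) => apply: cfun_if; cfun_auto H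
    end
  | H; cfun_auto H
  | idtac ].

Ltac cfun_app1 L := first [exact: L | apply: (cfun_app L)].

Section cfun_bounded.
Local Open Scope nat_scope.
Context {X : Type} {cX : coded X}.

Lemma cfun_sum (F : X -> nat -> nat) (n : X -> nat) :
  cfun2 F -> cfun n -> cfun (fun x => \sum_(0 <= j < n x) F x j).
Proof.
move=> cF cn.
apply: cfun_ext (cfun_iteri (n := n) (s := fun x j r => r + F x j)
  (z := fun=> 0) cn _ (cfun_cst _)) _ => [|x].
  rewrite /cfun3; cfun_auto ltac:(apply: (cfun_app2 cF)).
by elim: (n x) => [|k IH]; [rewrite big_geq|rewrite big_nat_recr//= IH].
Qed.

Lemma cfun_max (F : X -> nat -> nat) (n : X -> nat) :
  cfun2 F -> cfun n -> cfun (fun x => \max_(0 <= j < n x) F x j).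
Proof.
move=> cF cn.
apply: cfun_ext (cfun_iteri (n := n) (s := fun x j r => maxn r (F x j))
  (z := fun=> 0) cn _ (cfun_cst _)) _ => [|x].
  rewrite /cfun3; cfun_auto ltac:(apply: (cfun_app2 cF)).
by elim: (n x) => [|k IH]; [rewrite big_geq|rewrite big_nat_recr//= IH].
Qed.

Lemma cfun_all (P : X -> nat -> bool) (n : X -> nat) :
  cfun2 P -> cfun n -> cfun (fun x => all (P x) (iota 0 (n x))).
Proof.
move=> cP cn.
apply: cfun_ext (cfun_iteri (n := n) (s := fun x j r => r && P x j)
  (z := fun=> true) cn _ (cfun_cst _)) _ => [|x].
  rewrite /cfun3; cfun_auto ltac:(apply: (cfun_app2 cP)).
elim: (n x) => // k IH.
by rewrite -[in RHS]addn1 iotaD all_cat -IH /= andbT.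
Qed.

End cfun_bounded.

(** * The circle group *)

Section distance_to_int.
Variable R : realType.
Implicit Types x y z : R.

Definition nint x : R := (Num.floor (x + 1 / 2))%:~R.

Definition dist_int x : R := `|x - nint x|.

Lemma nint_int x : nint x \is a Num.int.
Proof. exact: intr_int. Qed.

Lemma dist_int_half x : dist_int x <= 1 / 2.
Proof.
rewrite /dist_int /nint; set f := Num.floor _.
have h1 : f%:~R <= x + 1 / 2 :> R by exact: floor_le_tmp.
have h2 : x + 1 / 2 < f%:~R + 1 :> R.
  by have := floorD1_gt (x + 1 / 2); rewrite intrD.
by rewrite ler_norml; apply/andP; split; lra.
Qed.

Lemma dist_int_ge0 x : 0 <= dist_int x.
Proof. exact: normr_ge0. Qed.

(** The integer [nint x] is within 1/2 of x, and every other integer is at distance at least 1 from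
    it. *)
Lemma dist_int_le x z : z \is a Num.int -> dist_int x <= `|x - z|.
Proof.
move=> zi; have [->//|neq] := eqVneq z (nint x).
have h : 1 <= `|z - nint x|.
  by apply: norm_intr_ge1; rewrite ?subr_eq0// rpredB// nint_int.
have := dist_int_half x; have := ler_distD x z (nint x).
by rewrite /dist_int (distrC z x); lra.
Qed.

Lemma dist_int_normr x : dist_int x <= `|x|.
Proof. by rewrite -{2}(subr0 x) dist_int_le. Qed.

Lemma dist_int_small x : `|x| <= 1 / 2 -> dist_int x = `|x|.
Proof.
move=> xs; apply/eqP; rewrite eq_le dist_int_normr andTb /dist_int.
have [->|neq] := eqVneq (nint x) 0; first by rewrite subr0.
have h : 1 <= `|nint x| by rewrite norm_intr_ge1 ?nint_int.
have := ler_distD x (nint x) 0; rewrite !subr0 (distrC _ x); lra.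
Qed.

Lemma dist_int_eq x y : x - y \is a Num.int -> dist_int x = dist_int y.
Proof.
move=> xy; apply/eqP; rewrite eq_le; apply/andP; split.
  rewrite {2}/dist_int (_ : y - _ = x - (x - y + nint y)); last by ring.
  by rewrite dist_int_le// rpredD// nint_int.
rewrite {2}/dist_int (_ : x - _ = y - (nint x - (x - y))); last by ring.
by rewrite dist_int_le// rpredB// nint_int.
Qed.

Lemma dist_intN x : dist_int (- x) = dist_int x.
Proof.
have le w : dist_int (- w) <= dist_int w.
  rewrite {2}/dist_int -normrN opprB addrC -(opprK (nint w)).
  by rewrite dist_int_le// rpredN nint_int.
by apply/eqP; rewrite eq_le le -{1}(opprK x) le.
Qed.

Lemma dist_intD x y : dist_int (x + y) <= dist_int x + dist_int y.
Proof.
apply: le_trans (ler_normD _ _).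
have := @dist_int_le (x + y) (nint x + nint y).
by rewrite opprD addrACA; apply; rewrite rpredD ?nint_int.
Qed.

Lemma dist_int_eq0 x : (dist_int x == 0) = (x \is a Num.int).
Proof.
apply/idP/idP => [|xi].
  by rewrite normr_eq0 subr_eq0 => /eqP ->; exact: nint_int.
rewrite eq_le dist_int_ge0 andbT.
by have := dist_int_le x xi; rewrite subrr normr0.
Qed.

End distance_to_int.

(** * The norm of the circle group and its completeness *)

Section RmodZ_norm.
Variable R : realType.
Local Notation T := (RmodZ R).
Implicit Types (x y : R) (s t : T).

Definition rmz x : T := \pi_T x.

Lemma rmzD x y : rmz (x + y) = rmz x + rmz y.
Proof. exact: RmodZ_piD. Qed.

Lemma rmzN x : rmz (- x) = - rmz x.
Proof. exact: RmodZ_piN. Qed.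

Lemma rmzB x y : rmz (x - y) = rmz x - rmz y.
Proof. by rewrite rmzD rmzN. Qed.

Lemma rmz_repr t : rmz (repr t) = t.
Proof. exact: reprK. Qed.

Lemma rmz_eqP x y : reflect (rmz x = rmz y) (x - y \is a Num.int).
Proof. exact: RmodZ_eqP. Qed.

Lemma rmz_eq0P x : reflect (rmz x = 0) (x \is a Num.int).
Proof. by rewrite -[x in X in reflect _ X]subr0; exact: rmz_eqP. Qed.

Definition rnorm t : R := dist_int (repr t).

Lemma rnorm_rmz x : rnorm (rmz x) = dist_int x.
Proof. by apply: dist_int_eq; apply/rmz_eqP; rewrite rmz_repr. Qed.

Lemma rnorm_ge0 t : 0 <= rnorm t. Proof. exact: dist_int_ge0. Qed.

Lemma rnorm_half t : rnorm t <= 1 / 2. Proof. exact: dist_int_half. Qed.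

Lemma rnorm_eq0 t : rnorm t = 0 <-> t = 0.
Proof.
rewrite -(rmz_repr t) rnorm_rmz; split=> [/eqP|/rmz_eq0P h].
  by rewrite dist_int_eq0 => /rmz_eq0P.
by apply/eqP; rewrite dist_int_eq0.
Qed.

Lemma rnorm0 : rnorm 0 = 0. Proof. exact/rnorm_eq0. Qed.

Lemma rnormN t : rnorm (- t) = rnorm t.
Proof. by rewrite -(rmz_repr t) -rmzN !rnorm_rmz dist_intN. Qed.

Lemma rnormD s t : rnorm (s + t) <= rnorm s + rnorm t.
Proof.
by rewrite -(rmz_repr s) -(rmz_repr t) -rmzD !rnorm_rmz dist_intD.
Qed.

Lemma rnorm_distC s t : rnorm (s - t) = rnorm (t - s).
Proof. by rewrite -rnormN opprB. Qed.

Lemma rnorm_distD u s t : rnorm (s - t) <= rnorm (s - u) + rnorm (u - t).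
Proof. by rewrite -{1}(subrK u s) -addrA rnormD. Qed.

(** The representative of least absolute value, which is the norm of t. *)
Definition rlift t : R := repr t - nint (repr t).

Lemma rliftK t : rmz (rlift t) = t.
Proof.
rewrite -[RHS]rmz_repr; apply/rmz_eqP.
by rewrite /rlift addrAC subrr add0r rpredN nint_int.
Qed.

Lemma normr_rlift t : `|rlift t| = rnorm t.
Proof. by []. Qed.

Lemma rnorm_double t : rnorm t <= 1 / 4 -> rnorm (t *+ 2) = 2 * rnorm t.
Proof.
move=> ts; rewrite -{1}(rliftK t) mulr2n -rmzD rnorm_rmz.
have -> : rlift t + rlift t = 2 * rlift t by ring.
have h : `|2 * rlift t| = 2 * rnorm t by rewrite normrM normr_nat normr_rlift.
by rewrite dist_int_small h//; lra.
Qed.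

(** As long as the norm is at most 1/4, doubling an element doubles its norm, so the repeated
    doublings of a nonzero element leave the ball of radius 1/4. This is the absence of small
    subgroups. *)
Lemma rnorm_small_multiples t :
  (forall k, rnorm (t *+ 2 ^ k) <= 1 / 4) -> t = 0.
Proof.
move=> ts; apply/rnorm_eq0.
have h k : rnorm (t *+ 2 ^ k) = 2 ^+ k * rnorm t.
  elim: k => [|k IH]; first by rewrite expr0 mul1r.
  by rewrite expnSr mulrnA rnorm_double// IH exprS mulrA.
apply/eqP; rewrite eq_le rnorm_ge0 andbT leNgt; apply/negP => t0.
have [k hk] : exists k, 1 / rnorm t < k%:R.
  by exists (Num.truncn (1 / rnorm t)).+1; exact: truncnS_gt.
have := ts k; rewrite h leNgt => /negP; apply.
apply: (@lt_le_trans _ _ (k%:R * rnorm t)).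
  have : 1 < k%:R * rnorm t by rewrite -ltr_pdivrMr.
  by apply: le_lt_trans; lra.
by rewrite ler_pM2r// -natrX ler_nat ltnW// ltn_expl.
Qed.

Lemma nbhs_rnormP t (A : set T) :
  nbhs t A <-> exists2 e : R, 0 < e & forall s, rnorm (s - t) < e -> A s.
Proof.
split=> [|[e e0 eA]].
  rewrite -{1}(rmz_repr t).
  move=> /(@pi_continuous _ {eq_quot (@eqmodZ_equiv_rel R)} (repr t)).
  move=> /nbhs_ballP[e /= e0 eA]; exists e => // s st.
  have -> : s = rmz (repr t + rlift (s - t)).
    by rewrite rmzD rliftK rmz_repr addrC subrK.
  apply: eA; rewrite /ball /= opprD addNKr normrN.
  by rewrite normr_rlift.
apply: (@filterS _ _ _ (\pi_T @` ball (repr t) e)).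
  move=> _ [x xe <-]; apply: eA.
  rewrite -[\pi_T x]/(rmz x) -{1}(rmz_repr t) -rmzB rnorm_rmz.
  by apply: le_lt_trans (dist_int_normr _) _; rewrite distrC.
apply: open_nbhs_nbhs; split.
  exact/RmodZ_pi_open/ball_open.
by exists (repr t); [exact: ballxx|exact: rmz_repr].
Qed.

(** From some index on, all terms are within 1/4 of a fixed term. Lifts of elements of that ball
    differ by at most 1/2, so lifting preserves distances there and completeness is inherited from
    the reals. *)
Lemma RmodZ_cauchy_cvg (u : nat -> T) :
  (forall e : R, 0 < e -> exists N, forall m n,
     (N <= m)%N -> (N <= n)%N -> rnorm (u m - u n) < e) ->
  exists l, forall e : R, 0 < e -> exists N, forall n,
     (N <= n)%N -> rnorm (u n - l) < e.
Proof.
move=> cu; have [N0 hN0] := cu (1 / 4) ltac:(lra).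
pose z n := rlift (u n - u N0).
have zE m n : (N0 <= m)%N -> (N0 <= n)%N -> `|z m - z n| = rnorm (u m - u n).
  move=> mN nN; have hm := hN0 _ _ mN (leqnn _); have hn := hN0 _ _ nN (leqnn _).
  have -> : u m - u n = rmz (z m - z n).
    by rewrite rmzB !rliftK opprB addrA subrK.
  rewrite rnorm_rmz dist_int_small//.
  apply: le_trans (ler_normB _ _) _; rewrite !normr_rlift; lra.
have cz : cauchy (z @ \oo).
  apply/cauchy_ballP => e e0; have [N hN] := cu e e0.
  pose S := z @` [set n | (maxn N0 N <= n)%N].
  exists (S, S); first by split; exists (maxn N0 N) => // n /= Nn; exists n.
  move=> [_ _] /= [[m mN <-] [n nN <-]].
  move: mN nN => /=; rewrite !geq_max => /andP[m0 mN] /andP[n0 nN].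
  by rewrite /ball /= zE//; exact: hN.
have /cauchy_cvg/cvg_ex[/= L zL] := cz.
exists (u N0 + rmz L) => e e0.
have /cvgrPdist_lt/(_ e e0)[N _ hN] := zL.
exists N => n nN.
have -> : u n - (u N0 + rmz L) = rmz (z n - L) by rewrite rmzB rliftK opprD addrA.
rewrite rnorm_rmz; apply: le_lt_trans (dist_int_normr _) _.
by rewrite distrC; exact: (hN n).
Qed.

End RmodZ_norm.

(** * Homomorphisms modulo the integers *)

(** The generator is the least positive element, by Euclidean division, and 0 if there is none. *)
Lemma int_subgroup_generator (D : set int) :
  D 0 -> (forall k l, D k -> D l -> D (k - l)) ->
  exists2 m : nat, D m%:Z & forall k, D k -> (m%:Z %| k)%Z.
Proof.
move=> D0 DB.
have DN k : D k -> D (- k) by move=> Dk; rewrite -sub0r; exact: DB.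
have DM k (j : int) : D k -> D (j * k).
  move=> Dk; have hn (n : nat) : D (n%:Z * k).
    elim: n => [|n IH]; first by rewrite mul0r.
    by have := DB _ _ IH (DN _ Dk); rewrite intS mulrDl mul1r opprK addrC.
  by case: j => n; rewrite ?NegzE ?mulNr; [exact: hn|apply/DN/hn].
have [[n n0 Dn]|none] := pselect (exists2 n : nat, (0 < n)%N & D n%:Z).
  pose Q := [pred n : nat | (0 < n)%N && `[< D n%:Z >]].
  have exQ : exists n, Q n by exists n; rewrite /Q /= n0; exact/asboolP.
  have [m /andP[m0 /asboolP Dm] mmin] := ex_minnP exQ.
  exists m => // k Dk; apply/dvdz_mod0P.
  have mE : (m%:Z == 0) = false by case: (m) m0.
  have r_ge0 : 0 <= (k %% m%:Z)%Z by rewrite modz_ge0 ?mE.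
  have r_lt : (k %% m%:Z)%Z < m%:Z by rewrite ltz_pmod// ltz_nat.
  have Dr : D (k %% m%:Z)%Z.
    have -> : (k %% m%:Z)%Z = k - (k %/ m%:Z)%Z * m%:Z.
      by rewrite {2}(divz_eq k m%:Z) addrAC subrr add0r.
    exact/DB/DM.
  have [q rq] : exists q : nat, (k %% m%:Z)%Z = q%:Z.
    by exists `|(k %% m%:Z)%Z|%N; rewrite gez0_abs.
  move: r_lt Dr; rewrite rq; case: q {rq} => // q q_lt Dq.
  have /mmin : Q q.+1 by apply/andP; split=> //; exact/asboolP.
  by move: q_lt; rewrite ltz_nat ltnNge => /negbTE ->.
exists 0%N => // k Dk; rewrite dvd0z; apply/negPn/negP => k0.
apply: none; exists `|k|%N; first by rewrite absz_gt0.
case: (leP 0 k) => [k_ge0|/ltW k_le0]; first by rewrite gez0_abs.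
by rewrite lez0_abs//; exact: DN.
Qed.

Section hom_mod_int.
Variables (V : zmodType) (F : archiRealFieldType).

(* [theta] induces a homomorphism from [V] to the quotient of [F] by the
   integers. *)
Definition mod_int_hom (theta : V -> F) : Prop :=
  forall x y, theta (x + y) - (theta x + theta y) \is a Num.int.

Section mod_int_hom_theory.
Variable theta : V -> F.
Hypothesis thetaD : mod_int_hom theta.

Lemma mod_int_hom0 : theta 0 \is a Num.int.
Proof.
have := thetaD 0 0; rewrite addr0 opprD addrA subrr sub0r.
by rewrite rpredN.
Qed.

Lemma mod_int_homN x : theta (- x) + theta x \is a Num.int.
Proof.
have := rpredB mod_int_hom0 (thetaD (- x) x).
by rewrite addNr opprB addrC subrK.
Qed.

Lemma mod_int_homB x y : theta (x - y) - (theta x - theta y) \is a Num.int.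
Proof.
have := rpredB (thetaD (x - y) y) (mod_int_homN 0).
rewrite subrK; have := mod_int_hom0; rewrite oppr0 => h0 h.
have -> : theta (x - y) - (theta x - theta y)
  = - (theta x - (theta (x - y) + theta y) - (theta 0 + theta 0))
    - (theta 0 + theta 0) by ring.
by rewrite rpredB ?rpredN// rpredD.
Qed.

Lemma mod_int_homMz x (k : int) : theta (x *~ k) - theta x *~ k \is a Num.int.
Proof.
have hn (n : nat) : theta (x *+ n) - theta x *+ n \is a Num.int.
  elim: n => [|n IH]; first by rewrite !mulr0n subr0 mod_int_hom0.
  rewrite !mulrS.
  have := rpredD (thetaD x (x *+ n)) IH.
  rewrite opprD addrA addrA subrK.
  by rewrite opprD addrA.
case: k => n; first exact: hn.
rewrite NegzE !mulrNz.
have := rpredB (mod_int_homN (x *~ n.+1)) (hn n.+1).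
set a := theta (- _); set b := theta _; set c := theta x *~ _.
by have -> : a + b - (b - theta x *+ n.+1) = a - - c by rewrite /c -pmulrn; ring.
Qed.

End mod_int_hom_theory.

Lemma pairMz (a : V) (b : F) (k : int) : (a, b) *~ k = (a *~ k, b *~ k).
Proof.
have hn (n : nat) : (a, b) *+ n = (a *+ n, b *+ n).
  by elim: n => // n IH; rewrite !mulrS IH.
by case: k => n; rewrite ?NegzE ?mulrNz -!pmulrn hn.
Qed.

(** The graph of a partial homomorphism from V to F modulo the integers: the condition on the fibre
    over 0 says that two values at the same point differ by an integer. *)
Definition mod_int_subgroup (U : set (V * F)) : Prop :=
  [/\ U 0, forall a b, U a -> U b -> U (a - b) &
      forall z, U (0, z) -> z \is a Num.int].

Lemma mod_int_subgroupMz U a (k : int) :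
  mod_int_subgroup U -> U a -> U (a *~ k).
Proof.
move=> [U0 UB _] Ua.
have UN b : U b -> U (- b) by move=> Ub; rewrite -sub0r; exact: UB.
have hn (n : nat) : U (a *+ n).
  elim: n => [|n IH]; first by rewrite mulr0n.
  by have := UB _ _ IH (UN _ Ua); rewrite opprK -mulrSr.
by case: k => n; [exact: hn|rewrite NegzE mulrNz; apply/UN/hn].
Qed.

(* Divisibility of [F]: the value at [x] is a quotient of the value at the
   smallest positive multiple of [x] in the domain. *)
Lemma mod_int_subgroup_extend U (x : V) : mod_int_subgroup U ->
  exists y, forall (k : int) w, U (x *~ k, w) -> w - y *~ k \is a Num.int.
Proof.
move=> gU; have [U0 UB Uz] := gU.
have [|k l [v Uv] [w Uw]|m [v Uv] mP] :=
    @int_subgroup_generator [set k | exists v, U (x *~ k, v)].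
- by exists 0; rewrite mulr0z.
- by exists (v - w); rewrite mulrzBr; exact: (UB _ _ Uv Uw).
exists (v / m%:R) => k w Uw; have /dvdzP[j kE] : (m%:Z %| k)%Z.
  by apply: mP; exists w.
have Uj := mod_int_subgroupMz j gU Uv; rewrite pairMz in Uj.
have Uk : U (0, w - v *~ j).
  have := UB _ _ Uw Uj; congr U; apply/pair_equal_spec; split=> //=.
  by rewrite kE mulrC mulrzA subrr.
have [m0|m0] := eqVneq m 0%N.
  by apply: Uz; move: Uw; rewrite kE m0 mulr0 !mulr0z subr0.
have -> : (v / m%:R) *~ k = v *~ j; last exact: Uz.
by rewrite kE [j * _]mulrC mulrzA -pmulrn -[_ *+ m]mulr_natr divfK// pnatr_eq0.
Qed.

(** A maximal graph containing W is total, since otherwise the one-point extension would enlarge it;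
    [theta] then picks a value from each fibre. *)
Lemma mod_int_hom_extend (W : set (V * F)) :
  mod_int_subgroup W ->
  exists2 theta, mod_int_hom theta &
    forall x v, W (x, v) -> theta x - v \is a Num.int.
Proof.
move=> gW; have [W0 WB Wz] := gW.
(* The condition bears on A together with W, rather than on A, so that it also holds for the empty
   union of the empty chain. *)
have [|A [gA Amax]] :=
    @Zorn_bigcup _ (fun A : set (V * F) => mod_int_subgroup (A `|` W)).
  move=> C gC totC; split=> [|a b|z].
  - by right.
  - have step X : C X -> (X `|` W) a -> (X `|` W) b ->
        (\bigcup_(X in C) X `|` W) (a - b).
      move=> CX Xa Xb; have [_ XB _] := gC _ CX.
      by case: (XB _ _ Xa Xb) => ?; [left; exists X|right].
    case=> [[A CA Aa]|Wa] [[B CB Bb]|Wb].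
    + by have [AB|BA] := totC _ _ CA CB; [apply: (step B CB)|apply: (step A CA)];
        left => //; [exact: AB|exact: BA].
    + by apply: (step A CA); [left|right].
    + by apply: (step B CB); [right|left].
    + by right; exact: WB.
  - case=> [[A CA Az]|/Wz//].
    by have [_ _] := gC _ CA; apply; left.
set U := A `|` W in gA; have [U0 UB Uz] := gA.
have total x : exists y, U (x, y).
  apply: contrapT => nx; have [y yP] := mod_int_subgroup_extend x gA.
  pose B := [set p | exists (k : int) a, U a /\ p = a + (x *~ k, y *~ k)].
  have AB : U `<=` B.
    by move=> a Ua; exists 0, a; rewrite !mulr0z addr0.
  have Bxy : B (x, y) by exists 1, 0; rewrite !mulr1z add0r.
  have BW : B `|` W = B.
    by apply/setUidPl => a Wa; apply: AB; right.
  apply: (Amax B).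
    split; first by move=> a Aa; apply: AB; left.
    by move=> /(_ _ Bxy) Axy; apply: nx; exists y; left.
  rewrite BW; split.
  - exact: AB.
  - move=> _ _ [k [a [Ua ->]]] [l [b [Ub ->]]].
    exists (k - l), (a - b); split; first exact: UB.
    rewrite opprD addrACA; congr (_ + _).
    by apply/pair_equal_spec; rewrite !mulrzBr.
  - move=> z [k [[a b] [Uab /pair_equal_spec[/= az ->]]]].
    have := yP (- k) b; rewrite !mulrNz opprK; apply.
    by rewrite (_ : - _ = a)//; apply/eqP; rewrite eq_sym -addr_eq0 -az.
have [theta thetaP] := choice total; exists theta => [x y|x v Wxv].
  apply: Uz; have := UB _ _ (UB _ _ (thetaP (x + y)) (thetaP x)) (thetaP y).
  congr U; apply/pair_equal_spec; split=> /=; last by rewrite opprD addrA.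
  by rewrite addrAC addrK subrr.
apply: Uz; have Uxv : U (x, v) by right.
have := UB _ _ (thetaP x) Uxv.
by congr U; apply/pair_equal_spec; split=> //=; rewrite subrr.
Qed.

End hom_mod_int.

(** The value at x is 1/m, where m is the order of x modulo N, or 1/2 if that order is infinite; the
    rest is extension by divisibility. Rational values have a common denominator at finitely many
    points, which makes the averages below finite. *)
Lemma mod_int_hom_separate (V : zmodType) (N : {pred V}) (x : V) :
  zmod_closed N -> x \notin N ->
  exists theta : V -> rat, [/\ mod_int_hom theta,
    {in N, forall y, theta y \is a Num.int} & theta x \isn't a Num.int].
Proof.
move=> [N0 NB] xN.
have [||m mN mP] := @int_subgroup_generator [set k | x *~ k \in N].
- by rewrite /= mulr0z.
- by move=> k l /= kN lN; rewrite mulrzBr NB.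
have m1 : m <> 1%N by move=> m1; move: mN; rewrite /= m1 mulr1z; exact/negP.
pose q : rat := if m is 0%N then 1 / 2 else m%:R^-1.
have qk k : x *~ k \in N -> q *~ k \is a Num.int.
  move=> /mP/dvdzP[j ->]; rewrite [j * _]mulrC mulrzA -mulrzr /q -pmulrn.
  case: (m) => [|m']; first by rewrite mul0r rpred0.
  by rewrite -[_^-1 *+ _]mulr_natr mulVf ?pnatr_eq0// mul1r intr_int.
have qN : q \isn't a Num.int.
  have q01 : 0 < q < 1.
    rewrite /q; case: (m) m1 => [|[|m']]// _.
    by rewrite invr_gt0 ltr0n invf_lt1 ?ltr0n// ltr1n.
  apply/negP => /intrP[z qz]; move: q01; rewrite qz ltr0z ltrz1; lia.
pose W := [set p : V * rat |
  exists (k : int) y j, [/\ y \in N, j \is a Num.int & p = (y + x *~ k, q *~ k + j)]].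
have gW : mod_int_subgroup W.
  split.
  - by exists 0, 0, 0; rewrite !mulr0z !addr0; split.
  - move=> _ _ [k [y [j [yN ji ->]]]] [k' [y' [j' [y'N j'i ->]]]].
    exists (k - k'), (y - y'), (j - j'); split; [exact: NB|exact: rpredB|].
    by apply/pair_equal_spec; split=> /=; rewrite mulrzBr opprD addrACA.
  - move=> z [k [y [j [yN ji /pair_equal_spec[/= yx ->]]]]].
    apply: rpredD => //; apply: qk.
    have -> : x *~ k = 0 - y by rewrite yx addrAC subrr add0r.
    exact: NB.
have [theta thetaD thetaW] := mod_int_hom_extend gW.
exists theta; split=> // [y yN|].
  rewrite -[theta y]subr0; apply: thetaW.
  by exists 0, y, 0; rewrite !mulr0z !addr0; split.
apply: contra qN => xi; have : theta x - q \is a Num.int.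
  by apply: thetaW; exists 1, 0, 0; rewrite !mulr1z addr0 add0r; split.
by move=> h; have := rpredB xi h; rewrite opprB addrC subrK.
Qed.

(** * Approximation by characters *)

Section cos_turns.
Variable R : realType.
Implicit Types x y q : R.

(* Angles are measured in turns. *)
Definition cosT x : R := cos (x * (pi *+ 2)).
Definition sinT x : R := sin (x * (pi *+ 2)).

Lemma cosT_eq x y : x - y \is a Num.int -> cosT x = cosT y.
Proof.
move=> /intrP[k xy]; have -> : x = y + k%:~R by rewrite -xy addrC subrK.
rewrite /cosT mulrDl; have hn (n : nat) (z : R) : cos (z + n%:R * (pi *+ 2)) = cos z.
  by rewrite mulr_natl periodicn//; exact: cosD2pi.
case: k {xy} => n; first exact: hn.
by rewrite NegzE mulrNz mulNr -(hn n.+1) subrK.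
Qed.

Lemma cosTN x : cosT (- x) = cosT x.
Proof. by rewrite /cosT mulNr cosN. Qed.

Lemma sinT_eq x y : x - y \is a Num.int -> sinT x = sinT y.
Proof.
move=> /intrP[k xy]; have -> : x = y + k%:~R by rewrite -xy addrC subrK.
rewrite /sinT mulrDl; have hn (n : nat) (z : R) : sin (z + n%:R * (pi *+ 2)) = sin z.
  by rewrite mulr_natl periodicn//; exact: sinD2pi.
case: k {xy} => n; first exact: hn.
by rewrite NegzE mulrNz mulNr -(hn n.+1) subrK.
Qed.

Lemma cosT_int x : x \is a Num.int -> cosT x = 1.
Proof.
by move=> xi; rewrite (@cosT_eq x 0) ?subr0// /cosT mul0r cos0.
Qed.

Lemma cosT1_int x : cosT x = 1 -> x \is a Num.int.
Proof.
rewrite -dist_int_eq0 /dist_int => x1; apply/eqP.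
have : cosT `|x - nint x| = 1.
  have xe : cosT x = cosT (x - nint x).
    by apply: cosT_eq; rewrite opprB addrC subrK nint_int.
  by case: (ger0P (x - nint x)) => _; rewrite ?cosTN -xe.
have := dist_int_half x; rewrite /dist_int; set d := `|_| => dh.
have d0 : 0 <= d by exact: normr_ge0.
have pi0 : 0 < pi :> R := pi_gt0 R.
have dpi : d * (pi *+ 2) = 2 * d * pi by rewrite mulr2n; ring.
rewrite /cosT dpi => e.
have /cos_inj h : cos (2 * d * pi) = cos 0 by rewrite cos0.
have : 2 * d * pi = 0.
  apply: h; rewrite in_itv/= ?lexx ?(ltW pi0)// ger_pMl// mulr_ge0 ?(ltW pi0)//.
    by lra.
  by lra.
move=> /eqP; rewrite mulf_eq0 (gt_eqF pi0) orbF mulf_eq0 pnatr_eq0 /=.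
by move=> /eqP.
Qed.

Lemma cosTD x y : cosT (x + y) = cosT x * cosT y - sinT x * sinT y.
Proof. by rewrite /cosT mulrDl cosD. Qed.

Lemma sinTD x y : sinT (x + y) = sinT x * cosT y + cosT x * sinT y.
Proof. by rewrite /sinT mulrDl sinD. Qed.

Lemma cos2sin2T x : cosT x ^+ 2 + sinT x ^+ 2 = 1.
Proof. exact: cos2Dsin2. Qed.

(** As N q is an integer, the vector of the cosine and sine sums is invariant under the rotation by
    q. This rotation is not the identity, so the vector is 0. *)
Lemma sum_cosT_orbit x q N : N%:R * q \is a Num.int -> q \isn't a Num.int ->
  \sum_(0 <= k < N) cosT (x + k%:R * q) = 0.
Proof.
move=> Nq qi; set C := LHS; pose S := \sum_(0 <= k < N) sinT (x + k%:R * q).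
have shift (f : R -> R) : (forall y z, y - z \is a Num.int -> f y = f z) ->
    \sum_(0 <= k < N) f (x + k%:R * q) = \sum_(0 <= k < N) f (x + k%:R * q + q).
  move=> fe; have -> : \sum_(0 <= k < N) f (x + k%:R * q + q)
      = \sum_(0 <= k < N) f (x + k.+1%:R * q).
    by apply: eq_bigr => k _; congr f; rewrite -addrA -natr1 mulrDl mul1r.
  have [->|N0] := posnP N; first by rewrite !big_geq.
  rewrite -(prednK N0) big_nat_recl// big_nat_recr//= addrC; congr (_ + _).
  by apply: fe; rewrite mul0r addr0 (prednK N0) opprD addrA subrr sub0r rpredN.
have hC : C = C * cosT q - S * sinT q.
  rewrite {1}/C (shift _ cosT_eq) /C /S !mulr_suml -sumrB.
  by apply: eq_bigr => k _; rewrite cosTD.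
have hS : S = S * cosT q + C * sinT q.
  rewrite {1}/S (shift _ sinT_eq) /C /S !mulr_suml -big_split/=.
  by apply: eq_bigr => k _; rewrite sinTD.
have c1 : cosT q != 1 by apply/eqP => /cosT1_int; exact/negP.
have : C * (1 - cosT q) ^+ 2 + C * sinT q ^+ 2 = 0.
  have e1 : C * (1 - cosT q) = - S * sinT q by rewrite mulrBr mulr1 {1}hC; ring.
  have e2 : S * (1 - cosT q) = C * sinT q by rewrite mulrBr mulr1 {1}hS; ring.
  have -> : C * (1 - cosT q) ^+ 2 = C * (1 - cosT q) * (1 - cosT q) by ring.
  have -> : C * sinT q ^+ 2 = C * sinT q * sinT q by ring.
  by rewrite e1 -e2; ring.
rewrite -mulrDr => /eqP; rewrite mulf_eq0 => /orP[/eqP//|/eqP h].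
have h1 : (1 - cosT q) ^+ 2 > 0 by rewrite exprn_even_gt0//= subr_eq0 eq_sym.
by have := sqr_ge0 (sinT q); lra.
Qed.

End cos_turns.

(** * Averaging a trigonometric polynomial over characters *)

Section averaging.
Variables (R : realType) (V : zmodType) (N : {pred V}).
Hypothesis zN : zmod_closed N.

(* Averaging over the multiples of a character that separates some [b i] from
   [N] removes the corresponding terms, and repeating this leaves the terms with
   [b i] in [N]; some character does at least as well as the average. *)
Lemma mod_int_hom_average (I : eqType) (s : seq I) (p phi : I -> R) (b : I -> V) :
  exists chi : V -> R, [/\ mod_int_hom chi,
    {in N, forall y, chi y \is a Num.int} &
    \sum_(i <- s | b i \in N) p i * cosT (phi i)
      <= \sum_(i <- s) p i * cosT (phi i - chi (b i))].
Proof.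
have [n] := ubnP (size s); elim: n s => // n IH s /ltnSE sn.
have [/allP sN|/allPn[i0 i0s i0N]] := boolP (all (fun i => b i \in N) s).
  exists (fun=> 0); split; [by move=> x y; rewrite addr0 subr0 rpred0|
    by move=> y _; exact: rpred0|].
  rewrite big_seq_cond (eq_bigl (fun i => i \in s)); last first.
    by move=> i; case: (boolP (i \in s)) => // /sN ->.
  by rewrite -big_seq; under [leRHS]eq_bigr do rewrite subr0.
have [th [thD thN thi0]] := mod_int_hom_separate zN i0N.
(* The terms that survive the averaging over the multiples of [th]. The term [i0] is not among them,
   and all terms with [b i] in N are. *)
pose s' := [seq i <- s | th (b i) \is a Num.int].
have [|chi [chiD chiN chi_le]] := IH s'.
  apply: leq_trans sn; rewrite size_filter -[ltnRHS](count_predC (fun i => th (b i) \is a Num.int)).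
  by rewrite -[ltnLHS]addn0 ltn_add2l -has_count; apply/hasP; exists i0.
have [M M0 MP] : exists2 M : nat, (0 < M)%N &
    forall i, i \in s -> M%:R * th (b i) \is a Num.int.
  elim: (s) => [|i t [M M0 MP]]; first by exists 1%N.
  exists (M * `|denq (th (b i))|)%N; first by rewrite muln_gt0 M0 absz_gt0 denq_neq0.
  move=> j; rewrite inE => /orP[/eqP ->|jt]; rewrite natrM; last first.
    by rewrite mulrAC rpredM ?natr_int ?MP.
  rewrite -mulrA rpredM ?natr_int// -[X in _ * X](divq_num_den (th (b i))).
  rewrite -[`|_|%:R]/(`|denq (th (b i))|%:Z%:~R) absz_denq mulrC divfK ?intr_int//.
  by rewrite intr_eq0 denq_neq0.
(* As M clears the denominators of the values of [th], letting k run below M covers whole periods: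
   the terms outside [s'] cancel and the others do not depend on k. *)
pose ps (k : nat) y : R := chi y + k%:R * ratr (th y).
have int_ratr (w : rat) : w \is a Num.int -> (ratr w : R) \is a Num.int.
  by move=> /intrP[z ->]; rewrite ratr_int intr_int.
have psD k : mod_int_hom (ps k).
  move=> x y; rewrite /ps.
  have -> : chi (x + y) + k%:R * ratr (th (x + y)) -
      (chi x + k%:R * ratr (th x) + (chi y + k%:R * ratr (th y)))
    = (chi (x + y) - (chi x + chi y)) +
      k%:R * ratr (th (x + y) - (th x + th y)) :> R.
    by rewrite rmorphB rmorphD /=; ring.
  by rewrite rpredD// rpredM ?natr_int ?int_ratr.
have psN k : {in N, forall y, ps k y \is a Num.int}.
  by move=> y yN; rewrite rpredD ?chiN// rpredM ?natr_int ?int_ratr ?thN.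
pose E k := \sum_(i <- s) p i * cosT (phi i - ps k (b i)).
have sumE : \sum_(0 <= k < M) E k
    = M%:R * \sum_(i <- s') p i * cosT (phi i - chi (b i)).
  rewrite exchange_big /= big_filter mulr_sumr [RHS]big_mkcond /=.
  apply: eq_big_seq => i ise; rewrite -mulr_sumr.
  have termE k : cosT (phi i - ps k (b i))
      = cosT (phi i - chi (b i) + k%:R * ratr (- th (b i))).
    by rewrite rmorphN /=; congr cosT; rewrite /ps; ring.
  case: ifPn => [thi|thi].
    have termE' k : cosT (phi i - ps k (b i)) = cosT (phi i - chi (b i)).
      rewrite termE; apply: cosT_eq; rewrite addrAC subrr add0r.
      by apply: rpredM; [exact: natr_int|apply: int_ratr; rewrite rpredN].
    rewrite (eq_bigr (fun=> cosT (phi i - chi (b i)))); last by move=> k _.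
    by rewrite sumr_const_nat subn0 mulrnAr -[LHS]mulr_natl.
  under eq_bigr => k _ do rewrite termE.
  rewrite sum_cosT_orbit ?mulr0//.
    by rewrite -[M%:R](ratr_nat R) -rmorphM /= mulrN int_ratr ?rpredN ?MP.
  apply: contra thi => /intrP[z]; rewrite -(rmorph_int (@ratr R)).
  by move=> /fmorph_inj thz; rewrite -rpredN thz intr_int.
have [k kE] : exists k, \sum_(i <- s') p i * cosT (phi i - chi (b i)) <= E k.
  apply: contrapT => nk; have : \sum_(0 <= k < M) E k < \sum_(0 <= k < M)
      \sum_(i <- s') p i * cosT (phi i - chi (b i)).
    rewrite big_mkord [ltRHS]big_mkord; apply: ltr_sum => [|k _].
      by apply/hasP; exists (Ordinal M0); rewrite ?mem_index_enum.
    by rewrite ltNge; apply/negP => ?; apply: nk; exists k.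
  by rewrite sumE sumr_const_nat subn0 -[ltRHS]mulr_natl ltxx.
exists (ps k); split=> //; apply: le_trans kE; apply: le_trans chi_le.
rewrite big_filter_cond; rewrite le_eqVlt; apply/orP; left; apply/eqP.
apply: eq_bigl => i; case: (boolP (b i \in N)) => [/thN ->//|]; by rewrite andbF.
Qed.

End averaging.

(** * Digit expansions, used to code coefficient vectors and grid points *)

Section digits.
Local Open Scope nat_scope.

Definition digit (B e j : nat) : nat := e %/ B ^ j %% B.

Lemma digit_lt B e j : 0 < B -> digit B e j < B.
Proof. exact: ltn_pmod. Qed.

Lemma digit_add B n e k j : 0 < B -> j < n ->
  digit B (e + k * B ^ n) j = digit B e j.
Proof.
move=> B0 jn; have -> : k * B ^ n = k * B ^ (n - j.+1) * B * B ^ j.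
  by rewrite -!mulnA -expnS -expnD subnK.
by rewrite /digit addnC divnMDl ?expn_gt0 ?B0// modnMDl.
Qed.

Lemma digit_top B n e k : e < B ^ n -> k < B -> digit B (e + k * B ^ n) n = k.
Proof.
move=> en kB; have B0 : 0 < B by exact: leq_ltn_trans kB.
by rewrite /digit addnC divnMDl ?expn_gt0 ?B0// divn_small// addn0 modn_small.
Qed.

Lemma digits_exist B n (r : nat -> nat) :
  (forall j, j < n -> r j < B) ->
  exists2 e, e < B ^ n & forall j, j < n -> digit B e j = r j.
Proof.
elim: n => [|n IH] rB; first by exists 0.
have [|e en eP] := IH; first by move=> j jn; apply: rB; exact: ltnW.
have rn := rB n (ltnSn n).
exists (e + r n * B ^ n).
  by rewrite expnS; nia.
move=> j; rewrite ltnS leq_eqVlt => /orP[/eqP ->|jn]; first exact: digit_top.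
by rewrite digit_add ?eP//; exact: leq_ltn_trans rn.
Qed.

End digits.

Lemma big_nat_mul_range (R : nmodType) (B M : nat) (f : nat -> R) :
  \sum_(0 <= e < B * M) f e
    = \sum_(0 <= k < B) \sum_(0 <= e < M) f (e + k * M)%N.
Proof.
elim: B => [|B IH]; first by rewrite !big_geq.
rewrite big_nat_recr//= -IH mulSn addnC.
rewrite (big_cat_nat (n := (B * M)%N)) ?leq_addr//=; congr (_ + _).
by rewrite -{1}[(B * M)%N]add0n [(B * M + M)%N]addnC big_addn addnK.
Qed.

(** * The trigonometric kernel and its expansion *)

Section kernel.
Variable R : realType.
Implicit Types (x u alpha : R) (theta : nat -> R).

(** The real part of the binomial expansion of (e(u/2) + e(-u/2))^n e(alpha), where e(x) = exp(2 i
    pi x). Pascal's rule splits the sum into two sums with [alpha] shifted by u/2 in either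
    direction. *)
Lemma sum_binomial_cosT alpha u n :
  \sum_(0 <= k < n.+1) 'C(n, k)%:R * cosT (alpha + (k%:R - n%:R / 2) * u)
    = cosT alpha * (2 * cosT (u / 2)) ^+ n.
Proof.
elim: n alpha => [|n IH] alpha.
  by rewrite big_nat1 bin0 mul1r mul0r subr0 mul0r addr0 expr0 mulr1.
pose f a (k : nat) := cosT (a + (k%:R - n%:R / 2) * u).
have e0 k : cosT (alpha + (k%:R - n.+1%:R / 2) * u) = f (alpha - u / 2) k.
  by rewrite /f -natr1; congr cosT; field.
have e1 k : f (alpha - u / 2) k.+1 = f (alpha + u / 2) k.
  by rewrite /f -natr1; congr cosT; field.
under eq_bigr do rewrite e0.
rewrite big_nat_recl//= bin0 mul1r.
under eq_bigr do rewrite binS natrD mulrDl e1.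
rewrite big_split/= addrA.
have -> : f (alpha - u / 2) 0%N +
    \sum_(0 <= i < n.+1) 'C(n, i.+1)%:R * f (alpha + u / 2) i
  = \sum_(0 <= i < n.+1) 'C(n, i)%:R * f (alpha - u / 2) i.
  rewrite [in LHS]big_nat_recr//= bin_small// mul0r addr0.
  rewrite [in RHS]big_nat_recl//= bin0 mul1r; congr (_ + _).
  by apply: eq_bigr => i _; rewrite e1.
rewrite !IH -mulrDl exprS mulrA; congr (_ * _).
rewrite !cosTD cosTN; have -> : sinT (- (u / 2)) = - sinT (u / 2).
  by rewrite /sinT mulNr sinN.
by ring.
Qed.

(* The [n] digits of [e] in base [2m + 1], shifted by [m], code a vector of
   coefficients in [-m, m]. *)
Definition lin_digits (m n e : nat) theta : R :=
  \sum_(0 <= j < n) ((digit m.*2.+1 e j)%:R - m%:R) * theta j.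

Definition bin_digits (m n e : nat) : R :=
  \prod_(0 <= j < n) 'C(m.*2, digit m.*2.+1 e j)%:R.

(** The exponent 2m is even, so the frequencies k - m of each factor are integers and the factor
    depends on [theta j] modulo 1 only, although the cosine of half the angle does not. *)
Lemma sum_bin_digits (m n : nat) alpha theta :
  \sum_(0 <= e < m.*2.+1 ^ n) bin_digits m n e * cosT (alpha + lin_digits m n e theta)
    = cosT alpha * \prod_(0 <= j < n) (2 * cosT (theta j / 2)) ^+ m.*2.
Proof.
elim: n alpha => [|n IH] alpha.
  by rewrite expn0 big_nat1 /bin_digits /lin_digits !big_geq// mul1r addr0 mulr1.
rewrite expnS big_nat_mul_range [in RHS]big_nat_recr//= [RHS]mulrA mulrAC.
rewrite -sum_binomial_cosT mulr_suml; apply: eq_big_nat => k /andP[_ kB].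
rewrite -mulrA -IH mulr_sumr; apply: eq_big_nat => e /andP[_ eB].
have big_eq (T : Type) (idx : T) op (F : nat -> nat -> T) :
    \big[op/idx]_(0 <= j < n) F j (digit m.*2.+1 (e + k * m.*2.+1 ^ n) j)
    = \big[op/idx]_(0 <= j < n) F j (digit m.*2.+1 e j).
  by apply: eq_big_nat => j /andP[_ jn]; rewrite digit_add.
rewrite /bin_digits /lin_digits !big_nat_recr//= digit_top//.
rewrite (big_eq _ _ _ (fun _ d => 'C(m.*2, d)%:R)).
rewrite (big_eq _ _ _ (fun j d => (d%:R - m%:R) * theta j)).
rewrite mulrCA mulrA [_ * 'C(_, k)%:R]mulrC; congr (_ * cosT _).
have -> : m.*2%:R / 2 = m%:R :> R by rewrite -muln2 natrM mulfK// pnatr_eq0.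
by ring.
Qed.

Lemma cosT_half_ge0 x : dist_int x <= 1 / 4 -> 0 <= cosT x.
Proof.
move=> x4; rewrite (@cosT_eq _ _ (x - nint x)); last first.
  by rewrite opprB addrC subrK nint_int.
move: x4; rewrite /dist_int; set y := x - _; rewrite ler_norml => /andP[y1 y2].
have pi0 : 0 < pi :> R := pi_gt0 R.
rewrite /cosT; apply: cos_ge0_pihalf; rewrite [pi *+ 2]mulr2n.
have h1 : 0 <= pi * (y + 1 / 4) by rewrite mulr_ge0 ?(ltW pi0)//; lra.
have h2 : 0 <= pi * (1 / 4 - y) by rewrite mulr_ge0 ?(ltW pi0)//; lra.
by apply/andP; split; lra.
Qed.

Lemma cosT_half_le0 x : 1 / 4 <= dist_int x -> cosT x <= 0.
Proof.
move=> x4; have -> : cosT x = - cosT (x + 1 / 2).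
  rewrite /cosT mulrDl [pi *+ 2]mulr2n (_ : 1 / 2 * (pi + pi) = pi); last by field.
  by rewrite cosDpi opprK.
rewrite oppr_le0; apply: cosT_half_ge0.
have := dist_int_half x; move: x4; rewrite {1 2}/dist_int.
have := nint_int x; set z := nint x => zi.
case: (ger0P (x - z)) => xz h1 h2.
  have := @dist_int_le _ (x + 1 / 2) (z + 1) ltac:(by rewrite rpredD// rpred1).
  by move/le_trans; apply; rewrite ler_norml; apply/andP; split; lra.
have := @dist_int_le _ (x + 1 / 2) z zi.
by move/le_trans; apply; rewrite ler_norml; apply/andP; split; lra.
Qed.

Lemma cosT_double x : cosT (x + x) = 2 * cosT x ^+ 2 - 1.
Proof. by rewrite cosTD; have := cos2sin2T x; rewrite !expr2; lra. Qed.

(* [(1 - cosT x) / 2] is the square of the sine of half the angle, and doubling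
   the angle multiplies it by at most 4. *)
Lemma cosT_far t x : 2 ^- t <= dist_int x -> 4 ^- t <= (1 - cosT x) / 2.
Proof.
have base (y : R) : 1 / 4 <= dist_int y -> 1 / 2 <= (1 - cosT y) / 2.
  by move=> y4; have := cosT_half_le0 y4; lra.
elim: t x => [|t IH] x xt.
  by have := dist_int_half x; move: xt; rewrite expr0 invr1; lra.
have t4 : 4 ^- t <= 1 :> R by rewrite invf_le1 ?exprn_gt0 ?exprn_ege1 ?ler1n ?ltr0n.
have tS : 4 ^- t.+1 = 4 ^- t / 4 :> R by rewrite exprS invfM mulrC.
have [x4|x4] := leP (1 / 4) (dist_int x).
  by apply: le_trans (base _ x4); rewrite tS; lra.
have : 2 ^- t <= dist_int (x + x).
  have := @rnorm_double R (rmz x); rewrite rnorm_rmz mulr2n -rmzD rnorm_rmz => ->.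
    by move: xt; rewrite exprS invfM; lra.
  exact: ltW.
move=> /IH; rewrite cosT_double tS => h.
have := cos2sin2T x; have := sqr_ge0 (sinT x); have := sqr_ge0 (1 - cosT x).
rewrite !expr2 in h *; nra.
Qed.

End kernel.

(** The 2m + 1 coefficients add up to 4^m, and the central one is at least their mean. The induction
    uses the ratio 2(2m + 1)/(m + 1) of consecutive central coefficients. *)
Lemma expn4_central_bin m : (4 ^ m <= m.*2.+1 * 'C(m.*2, m))%N.
Proof.
elim: m => // m IH; rewrite expnS doubleS.
have e1 : (m.*2.+2 * 'C(m.*2.+1, m) = m.+1 * 'C(m.*2.+2, m.+1))%N.
  exact: (mul_bin_diag m.*2.+2 m).
have e2 : (m.*2.+1 * 'C(m.*2, m) = m.+1 * 'C(m.*2.+1, m.+1))%N.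
  exact: (mul_bin_diag m.*2.+1 m).
have e3 : 'C(m.*2.+1, m) = 'C(m.*2.+1, m.+1).
  rewrite -[LHS]bin_sub; last by lia.
  by congr 'C(_, _); lia.
by rewrite e3 in e1; nia.
Qed.

(** * The quantitative Kronecker theorem *)

Section approximation.
Variables (R : realType) (V : zmodType) (N : {pred V}).
Hypothesis zN : zmod_closed N.
Variables (a : nat -> V) (theta : nat -> R).

(** The coefficient is split into two natural multiples because a level only computes powers of an
    element and of its inverse. *)
Definition digit_comb (m n e : nat) : V :=
  \sum_(0 <= j < n) (a j *+ digit m.*2.+1 e j - a j *+ m).

Lemma mod_int_hom_digit_comb (chi : V -> R) m n e : mod_int_hom chi ->
  chi (digit_comb m n e) - lin_digits m n e (chi \o a) \is a Num.int.
Proof.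
move=> chiD; rewrite /digit_comb /lin_digits.
elim: n => [|n IH]; first by rewrite !big_geq// subr0 mod_int_hom0.
rewrite !big_nat_recr//=.
set A := \sum_(0 <= i < n) _ in IH *; set L := \sum_(0 <= i < n) _ in IH *.
set d := digit _ _ _.
have h1 := chiD A (a n *+ d - a n *+ m).
have h2 := mod_int_homB chiD (a n *+ d) (a n *+ m).
have h3 := mod_int_homMz chiD (a n) d%:Z.
have h4 := mod_int_homMz chiD (a n) m%:Z.
rewrite -!pmulrn in h3 h4.
have -> : chi (A + (a n *+ d - a n *+ m)) - (L + (d%:R - m%:R) * chi (a n))
  = (chi (A + (a n *+ d - a n *+ m)) - (chi A + chi (a n *+ d - a n *+ m)))
  + (chi A - L) +
  (chi (a n *+ d - a n *+ m) - (chi (a n *+ d) - chi (a n *+ m)))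
  + (chi (a n *+ d) - chi (a n) *+ d) - (chi (a n *+ m) - chi (a n) *+ m).
  by rewrite -!(mulr_natr (chi (a n))); ring.
apply: rpredB; last by [].
do 2!(apply: rpredD; last by []).
by apply: rpredD.
Qed.

(* If [theta] respects the relations modulo [N] with small coefficients, it is
   close to a character.  For a character [chi], the product of the
   [(2 cos pi (theta_j - chi (a_j)))^(2m)] is a trigonometric polynomial with
   nonnegative coefficients, whose terms at the relations are nonnegative; hence
   for some [chi] it is at least its constant term, which forces all factors to
   be close to their maximum. *)
Lemma mod_int_hom_approx m n t :
  (1 - 4 ^- t) ^+ m * m.*2.+1%:R ^+ n < 1 :> R ->
  (forall e, (e < m.*2.+1 ^ n)%N -> digit_comb m n e \in N ->
     dist_int (lin_digits m n e theta) <= 1 / 4) ->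
  exists chi : V -> R, [/\ mod_int_hom chi,
    {in N, forall y, chi y \is a Num.int} &
    forall j, (j < n)%N -> dist_int (theta j - chi (a j)) <= 2 ^- t].
Proof.
move=> small rel.
have [chi [chiD chiN]] := mod_int_hom_average zN (index_iota 0 (m.*2.+1 ^ n))
  (fun e => bin_digits R m n e) (fun e => lin_digits m n e theta) (digit_comb m n).
have bin_ge0 e : 0 <= bin_digits R m n e by apply: prodr_ge0.
have -> : \sum_(0 <= e < m.*2.+1 ^ n) bin_digits R m n e *
      cosT (lin_digits m n e theta - chi (digit_comb m n e))
    = \prod_(0 <= j < n) (2 * cosT ((theta j - chi (a j)) / 2)) ^+ m.*2.
  transitivity (\sum_(0 <= e < m.*2.+1 ^ n) bin_digits R m n e *
      cosT (0 + lin_digits m n e (fun j => theta j - chi (a j)))).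
    apply: eq_bigr => e _; congr (_ * _); apply: cosT_eq.
    have := mod_int_hom_digit_comb m n e chiD; rewrite -rpredN.
    congr (_ \is a Num.int); rewrite add0r.
    have -> : lin_digits m n e (fun j => theta j - chi (a j))
        = lin_digits m n e theta - lin_digits m n e (chi \o a).
      by rewrite /lin_digits -sumrB; apply: eq_bigr => j _; rewrite mulrBr.
    by ring.
  by rewrite sum_bin_digits cosT_int ?rpred0// mul1r.
(* All digits equal to m code the zero vector, because of the shift by m: this is the constant
   term. *)
have [|e0 e0B e0P] := @digits_exist m.*2.+1 n (fun=> m).
  by move=> j _; rewrite ltnS -addnn leq_addr.
move=> le_prod.
have center : 'C(m.*2, m)%:R ^+ n <=
    \prod_(0 <= j < n) (2 * cosT ((theta j - chi (a j)) / 2)) ^+ m.*2.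
  apply: le_trans le_prod.
  rewrite big_mkcond (bigD1_seq e0) ?mem_index_iota ?iota_uniq//=.
  have -> : digit_comb m n e0 = 0.
    rewrite /digit_comb big_nat_cond big1// => j /andP[/andP[_ jn] _].
    by rewrite e0P// subrr.
  rewrite zN.1.
  rewrite (_ : lin_digits m n e0 theta = 0); last first.
    rewrite /lin_digits big_nat_cond big1// => j /andP[/andP[_ jn] _].
    by rewrite e0P// subrr mul0r.
  rewrite cosT_int ?rpred0// mulr1 (_ : bin_digits R m n e0 = 'C(m.*2, m)%:R ^+ n).
    (* The other terms are nonnegative: at a relation the angle is within 1/4 of an integer, so its
       cosine is nonnegative. *)
    rewrite lerDl big_seq_cond sumr_ge0// => e.
    rewrite mem_index_iota => /andP[eB _]; case: ifPn => // eN.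
    by rewrite mulr_ge0// cosT_half_ge0// rel.
  rewrite /bin_digits (@eq_big_nat _ _ _ _ _ _ (fun=> 'C(m.*2, m)%:R)).
    by rewrite prodr_const_nat subn0.
  by move=> j /andP[_ jn]; rewrite e0P.
exists chi; split=> // j jn; rewrite leNgt; apply/negP => far.
have termE i : (2 * cosT ((theta i - chi (a i)) / 2)) ^+ m.*2
    = 4 ^+ m * ((1 + cosT (theta i - chi (a i))) / 2) ^+ m.
  rewrite -muln2 mulnC exprM -exprMn; congr (_ ^+ m).
  by rewrite [in RHS](splitr (theta i - chi (a i))) cosT_double; field.
have cos_le1 (x : R) : (1 + cosT x) / 2 <= 1.
  by have := cos_le1 (x * (pi *+ 2)); rewrite /cosT; lra.
have cos_ge0 (x : R) : 0 <= (1 + cosT x) / 2.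
  by have := cos_geN1 (x * (pi *+ 2)); rewrite /cosT; lra.
(* If the j-th value were far from [theta j], the j-th factor, divided by its maximum 4^m, would be
   at most (1 - 4^-t)^m; the other factors are bounded by their maximum. *)
have : \prod_(0 <= i < n) (2 * cosT ((theta i - chi (a i)) / 2)) ^+ m.*2
    <= 4 ^+ m ^+ n * (1 - 4 ^- t) ^+ m.
  under eq_bigr do rewrite termE.
  rewrite big_split/= prodr_const_nat subn0 ler_wpM2l ?exprn_ge0//.
  rewrite (bigD1_seq j) ?mem_index_iota ?iota_uniq//=.
  apply: (@le_trans _ _ (((1 + cosT (theta j - chi (a j))) / 2) ^+ m * 1)).
    rewrite ler_wpM2l ?exprn_ge0//; apply: prodr_ile1 => i _.
    by rewrite exprn_ge0//= exprn_ile1.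
  rewrite mulr1 lerXn2r ?nnegrE//.
    by rewrite subr_ge0 invf_le1 ?exprn_gt0 ?exprn_ege1 ?ler1n ?ltr0n.
  have := cosT_far (ltW far); lra.
move=> /(le_trans center); apply/negP; rewrite -ltNge.
have B0 : 0 < m.*2.+1%:R ^+ n :> R by rewrite exprn_gt0 ?ltr0n.
(* Since 4^m is at most 2m + 1 times the central coefficient, the hypothesis [small] pushes the
   upper bound strictly below the constant term. *)
have C4 : 4 ^+ m ^+ n <= m.*2.+1%:R ^+ n * 'C(m.*2, m)%:R ^+ n :> R.
  by rewrite -exprMn lerXn2r ?nnegrE ?exprn_ge0// -natrX -natrM ler_nat expn4_central_bin.
have C0 : 0 < 'C(m.*2, m)%:R ^+ n :> R.
  by rewrite exprn_gt0 ?ltr0n// bin_gt0 -addnn leq_addr.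
have q0 : 0 <= (1 - 4 ^- t) ^+ m :> R.
  by rewrite exprn_ge0// subr_ge0 invf_le1 ?exprn_gt0 ?exprn_ege1 ?ler1n ?ltr0n.
apply: (le_lt_trans (ler_wpM2r q0 C4)).
rewrite mulrAC -[ltRHS]mul1r ltr_pM2r// mulrC.
exact: small.
Qed.

End approximation.

(* Large enough for the exponential decay of [(1 - 4 ^- t) ^+ m] to beat the
   number [(2m + 1)^t] of coefficient vectors. *)
Definition coef_bound (t : nat) : nat := (2 ^ (4 * t + 6))%N.

(** Bernoulli's inequality gives (1 + 4^-t)^(4^t) >= 2, hence (1 - 4^-t)^(4^t) <= 1/2. As m = 4^t
    2^(2t+6), the first factor is at most 2^-(2^(2t+6)), while 2m + 1 <= 2^(4t+8) and t(4t + 8) <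
    2^(2t+6). *)
Lemma coef_boundP (R : realType) t :
  (1 - 4 ^- t) ^+ coef_bound t * (coef_bound t).*2.+1%:R ^+ t < 1 :> R.
Proof.
set m := coef_bound t.
have x0 : 0 < 4 ^- t :> R by rewrite invr_gt0 exprn_gt0 ?ltr0n.
have x1 : 4 ^- t <= 1 :> R by rewrite invf_le1 ?exprn_gt0 ?exprn_ege1 ?ler1n ?ltr0n.
have half_pow : (1 - 4 ^- t) ^+ (4 ^ t) <= 2^-1 :> R.
  have bern : 2 <= (1 + 4 ^- t) ^+ (4 ^ t) :> R.
    have bn n : 1 + n%:R * 4 ^- t <= (1 + 4 ^- t) ^+ n :> R.
      elim: n => [|n IH]; first by rewrite mul0r addr0 expr0.
      rewrite exprS; apply: le_trans (ler_wpM2l _ IH); last by lra.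
      rewrite -natr1; have : 0 <= n%:R * 4 ^- t :> R by rewrite mulr_ge0// ltW.
      by nra.
    have := bn (4 ^ t)%N; rewrite natrX mulfV ?expf_neq0 ?pnatr_eq0//.
  have h : (1 - 4 ^- t) ^+ (4 ^ t) * (1 + 4 ^- t) ^+ (4 ^ t) <= 1 :> R.
    by rewrite -exprMn exprn_ile1//; nra.
  have h0 : 0 <= (1 - 4 ^- t) ^+ (4 ^ t) :> R by rewrite exprn_ge0// subr_ge0.
  by nra.
have mE : m = (4 ^ t * 2 ^ (2 * t + 6))%N.
  rewrite /m /coef_bound (_ : 4 ^ t = 2 ^ (2 * t))%N; last by rewrite expnM.
  by rewrite -expnD; congr expn; lia.
have le1 : (1 - 4 ^- t) ^+ m <= 2^-1 ^+ (2 ^ (2 * t + 6)) :> R.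
  by rewrite mE exprM lerXn2r ?nnegrE ?exprn_ge0 ?subr_ge0 ?invr_ge0.
apply: (le_lt_trans (ler_wpM2r _ le1)); first by rewrite exprn_ge0.
rewrite exprVn mulrC ltr_pdivrMr ?exprn_gt0// mul1r -!natrX ltr_nat.
have : (m.*2.+1 <= 2 ^ (4 * t + 8))%N.
  rewrite (_ : 4 * t + 8 = (4 * t + 6).+2)%N; last by lia.
  have m0 : (0 < m)%N by rewrite expn_gt0.
  by rewrite expnS expnS -[(2 ^ (4 * t + 6))%N]/m; lia.
have [->|t0] := posnP t; first by rewrite expn0 => _; rewrite -{1}(expn0 2) ltn_exp2l// expn_gt0.
rewrite -(leq_exp2r _ _ t0) => /leq_ltn_trans; apply.
rewrite -expnM ltn_exp2l//.
have : (t < 2 ^ t)%N by exact: ltn_expl.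
rewrite expnD mulnC expnM (_ : 2 ^ 2 = 4)%N// (_ : 2 ^ 6 = 64)%N//.
have -> : (4 ^ t = 2 ^ t * 2 ^ t)%N by rewrite -(expnMn 2 2).
by nia.
Qed.

(** * Algorithms on a computable presentation *)

Section circle_codes.
Local Open Scope nat_scope.

(* [grid_dist Q x / Q] is the distance of [x / Q] to the nearest integer. *)
Definition grid_dist (Q x : nat) : nat := minn (x %% Q) (Q - x %% Q).

(** Fine enough that rounding t values to the grid moves any combination with coefficients at most
    [coef_bound t] by at most 1/4, and each value by at most 2^-t. *)
Definition grid (t : nat) : nat := 2 ^ t.+2 * (t * coef_bound t).+1.

(* The relation code [e] evaluated at the grid point [c], modulo [grid t]. *)
Definition grid_lin (t c e : nat) : nat :=
  \sum_(0 <= j < t) (digit (coef_bound t).*2.+1 e j * digit (grid t) c j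
    + coef_bound t * (grid t - digit (grid t) c j)).

(** Coordinates are compared over the common denominator; adding it once, that is, one whole turn,
    keeps the subtraction of naturals exact. *)
Definition grid_near (t c c' : nat) : bool :=
  all (fun j => grid_dist (grid t * grid t.+1)
        (digit (grid t) c j * grid t.+1
         + (grid t * grid t.+1 - digit (grid t.+1) c' j * grid t)) * 2 ^ t
      <= 2 * (grid t * grid t.+1)) (iota 0 t).

End circle_codes.

Section algorithms.
Local Open Scope nat_scope.
Variables (S : inverse_system) (ker_code : nat -> nat).

(* The image at level [i - d] of [y] at level [i]. *)
Definition level_proj (i d y : nat) : nat :=
  iteri d (fun k z => isys_map S (i - k) z) y.

(** Numbers outside the domain stand for the identity, so that every natural number indexes an
    element of the level. *)
Definition level_gen (i j : nat) : nat :=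
  if isys_dom S i j then j else isys_one S i.

Definition level_pow (i x n : nat) : nat :=
  iteri n (fun _ z => isys_mul S i x z) (isys_one S i).

Definition level_word (i m n e : nat) : nat :=
  iteri n (fun j z => isys_mul S i z
      (isys_mul S i (level_pow i (level_gen i j) (digit m.*2.+1 e j))
                    (level_pow i (isys_inv S i (level_gen i j)) m)))
    (isys_one S i).

(* The grid point [c] respects, up to 1/4, all relations between the first [t]
   elements of level [i] with coefficients at most [coef_bound t]. *)
Definition grid_hom (i t c : nat) : bool :=
  all (fun e => (level_word i (coef_bound t) t e == isys_one S i) ==>
      (grid_dist (grid t) (grid_lin t c e) * 4 <= grid t))
    (iota 0 ((coef_bound t).*2.+1 ^ t)).

(** The search runs over all grid points of the next stage. A failed search would return the length
    of the list; [grid_nextP] excludes this when [c] passes the test. *)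
Definition grid_next (i t c : nat) : nat :=
  find (fun c' => grid_hom i t.+1 c' && grid_near t c c')
    (iota 0 (grid t.+1 ^ t.+1)).

Definition grid_iter (i t c s : nat) : nat :=
  iteri s (fun k c' => grid_next i (t + k) c') c.

(* A seed codes a level, a stage and a grid point of that stage; the number [0]
   codes no seed and is used for the trivial character. *)
Definition seed (i t c : nat) : nat := npair i (npair t c).
Definition seed_level (u : nat) : nat := nfst u.
Definition seed_stage (u : nat) : nat := nfst (nsnd u).
Definition seed_point (u : nat) : nat := nsnd (nsnd u).
Definition seed_valid (u : nat) : bool :=
  (0 < u) && grid_hom (seed_level u) (seed_stage u) (seed_point u).

Definition seed_digit (u s y : nat) : nat :=
  digit (grid (seed_stage u + s))
    (grid_iter (seed_level u) (seed_stage u) (seed_point u) s) y.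

(* [seed_value u y K / 2 ^ K] approximates the character of seed [u] at the
   element [y] of its level. *)
Definition seed_value (u y K : nat) : nat :=
  if seed_valid u then
    (seed_digit u (y + K).+2 y * 2 ^ K) %/ grid (seed_stage u + (y + K).+2)
  else 0.

Definition level_lift (lift : nat -> nat -> nat) : Prop :=
  forall i y, isys_dom S i y ->
    isys_dom S i.+1 (lift i y) /\ isys_map S i.+1 (lift i y) = y.

(* Bounds the elements of level [l] with image below [K] at level 0, of which
   there are finitely many since the kernels are finite. *)
Definition level_bound (lift : nat -> nat -> nat) (l K : nat) : nat :=
  iteri l (fun j b => (\sum_(0 <= y < b) \sum_(0 <= z < ker_code j.+1)
    isys_mul S j.+1 (lift j y) z).+1) K.

(* [norm_code lift u u' v K / 4 ^ K] approximates the norm of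
   [X u + X u' - X v], where [X u] is the character of seed [u]. *)
Definition norm_code (lift : nat -> nat -> nat) (u u' v K : nat) : nat :=
  let l := seed_level u + seed_level u' + seed_level v in
  let pr w y := level_proj l (l - seed_level w) y in
  \max_(0 <= y < level_bound lift l K)
    if isys_dom S l y && (level_proj l l y < K) then
      2 ^ (K - level_proj l l y) * grid_dist (2 ^ K)
        (seed_value u (pr u y) K + seed_value u' (pr u' y) K
         + (2 ^ K - seed_value v (pr v y) K))
    else 0.

End algorithms.

(** * Computability of the algorithms *)

Section algorithms_computable.
Local Open Scope nat_scope.
Variables (S : inverse_system) (ker_code : nat -> nat) (lift : nat -> nat -> nat).
Hypotheses (cdom : cfun2 (isys_dom S)) (cone : cfun (isys_one S))
  (cmul : cfun3 (isys_mul S)) (cinv : cfun2 (isys_inv S))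
  (cmap : cfun2 (isys_map S)) (cker : cfun ker_code) (clift : cfun2 lift).

Lemma cfun_double X (cX : coded X) (a : X -> nat) :
  cfun a -> cfun (fun x => (a x).*2).
Proof.
move=> ca; apply: cfun_ext (cfun_mul (cfun_cst 2) ca) _ => x.
by rewrite mul2n.
Qed.

Lemma cfun_digit : cfun3 digit.
Proof. by rewrite /cfun3 /digit; cfun_auto ltac:(fail). Qed.

Lemma cfun_coef_bound : cfun coef_bound.
Proof. by rewrite /coef_bound; cfun_auto ltac:(fail). Qed.

Lemma cfun_grid : cfun grid.
Proof.
by rewrite /grid; cfun_auto ltac:(cfun_app1 cfun_coef_bound).
Qed.

Lemma cfun_grid_dist : cfun2 grid_dist.
Proof. by rewrite /cfun2 /grid_dist; cfun_auto ltac:(fail). Qed.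

Lemma cfun_grid_lin : cfun3 grid_lin.
Proof.
rewrite /cfun3 /grid_lin; apply: cfun_sum; last by cfun_auto ltac:(fail).
by rewrite /cfun2; cfun_auto ltac:(first
  [cfun_app1 cfun_coef_bound|cfun_app1 cfun_grid
  |apply: (cfun_app3 cfun_digit)|apply: cfun_double]).
Qed.

Lemma cfun_grid_near : cfun3 grid_near.
Proof.
rewrite /cfun3 /grid_near; apply: cfun_all; last by cfun_auto ltac:(fail).
by rewrite /cfun2; cfun_auto ltac:(first
  [cfun_app1 cfun_grid|apply: (cfun_app3 cfun_digit)
  |apply: (cfun_app2 cfun_grid_dist)]).
Qed.

Lemma cfun_level_proj : cfun3 (level_proj S).
Proof.
rewrite /cfun3 /level_proj; apply: cfun_iteri; try by cfun_auto ltac:(fail).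
by rewrite /cfun3; cfun_auto ltac:(apply: (cfun_app2 cmap)).
Qed.

Lemma cfun_level_gen : cfun2 (level_gen S).
Proof.
by rewrite /cfun2 /level_gen; cfun_auto ltac:(first
  [apply: (cfun_app2 cdom)|cfun_app1 cone]).
Qed.

Lemma cfun_level_pow : cfun3 (level_pow S).
Proof.
rewrite /cfun3 /level_pow; apply: cfun_iteri; first by cfun_auto ltac:(fail).
  by rewrite /cfun3; cfun_auto ltac:(apply: (cfun_app3 cmul)).
by cfun_auto ltac:(cfun_app1 cone).
Qed.

Lemma cfun_level_word : cfun4 (level_word S).
Proof.
rewrite /cfun4 /level_word; apply: cfun_iteri; first by cfun_auto ltac:(fail).
  by rewrite /cfun3; cfun_auto ltac:(first
    [apply: (cfun_app3 cmul)|apply: (cfun_app3 cfun_level_pow)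
    |apply: (cfun_app2 cfun_level_gen)|apply: (cfun_app3 cfun_digit)
    |apply: (cfun_app2 cinv)|apply: cfun_double]).
by cfun_auto ltac:(cfun_app1 cone).
Qed.

Lemma cfun_grid_hom : cfun3 (grid_hom S).
Proof.
rewrite /cfun3 /grid_hom; apply: cfun_all; last first.
  by cfun_auto ltac:(first [cfun_app1 cfun_coef_bound|apply: cfun_double]).
by rewrite /cfun2; cfun_auto ltac:(first
  [apply: (cfun_app4 cfun_level_word)|cfun_app1 cfun_coef_bound
  |cfun_app1 cone|cfun_app1 cfun_grid
  |apply: (cfun_app2 cfun_grid_dist)|apply: (cfun_app3 cfun_grid_lin)]).
Qed.

(** The result is the least k that satisfies p or reaches the length of the list, so it is a
    minimization that always succeeds. *)
Lemma cfun_find X (cX : coded X) (p : X -> nat -> bool) (n : X -> nat) :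
  cfun2 p -> cfun n -> cfun (fun x => find (p x) (iota 0 (n x))).
Proof.
move=> cp cn; apply: (cfun_mu (P := fun x k => (n x <= k) || p x k)).
- by rewrite /cfun2; cfun_auto ltac:(first
    [apply: (cfun_app2 cp)|cfun_app1 cn]).
- move=> x; case: (ltnP (find (p x) (iota 0 (n x))) (n x)) => //= h.
  have := h; rewrite -{2}(size_iota 0 (n x)) -has_find => /(nth_find 0).
  by rewrite nth_iota.
- move=> x k /orP[nk|pk].
    by apply: leq_trans nk; rewrite -{2}(size_iota 0 (n x)) find_size.
  rewrite leqNgt; apply/negP => kf.
  have kn : k < n x.
    by apply: leq_trans kf _; rewrite -{2}(size_iota 0 (n x)) find_size.
  by have := before_find 0 kf; rewrite nth_iota// pk.
Qed.

Lemma cfun_grid_next : cfun3 (grid_next S).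
Proof.
rewrite /cfun3 /grid_next; apply: cfun_find; last first.
  by cfun_auto ltac:(cfun_app1 cfun_grid).
by rewrite /cfun2; cfun_auto ltac:(first
  [apply: (cfun_app3 cfun_grid_hom)|apply: (cfun_app3 cfun_grid_near)]).
Qed.

Lemma cfun_grid_iter : cfun4 (grid_iter S).
Proof.
rewrite /cfun4 /grid_iter; apply: cfun_iteri; try by cfun_auto ltac:(fail).
by rewrite /cfun3; cfun_auto ltac:(apply: (cfun_app3 cfun_grid_next)).
Qed.

Lemma cfun_nfst : cfun nfst. Proof. exact: computable1_fst. Qed.

Lemma cfun_nsnd : cfun nsnd. Proof. exact: computable1_snd. Qed.

Lemma cfun_seed_level : cfun seed_level.
Proof. exact: cfun_nfst. Qed.

Lemma cfun_seed_stage : cfun seed_stage.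
Proof. exact: (cfun_app cfun_nfst cfun_nsnd). Qed.

Lemma cfun_seed_point : cfun seed_point.
Proof. exact: (cfun_app cfun_nsnd cfun_nsnd). Qed.

Ltac cfun_seed := first
  [cfun_app1 cfun_seed_point|cfun_app1 cfun_seed_stage
  |cfun_app1 cfun_seed_level].

Lemma cfun_seed_valid : cfun (seed_valid S).
Proof.
by rewrite /seed_valid; cfun_auto ltac:(first
  [apply: (cfun_app3 cfun_grid_hom)|cfun_seed]).
Qed.

Lemma cfun_seed_digit : cfun3 (seed_digit S).
Proof.
by rewrite /cfun3 /seed_digit; cfun_auto ltac:(first
  [apply: (cfun_app3 cfun_digit)|apply: (cfun_app4 cfun_grid_iter)
  |cfun_app1 cfun_grid|cfun_seed]).
Qed.

Lemma cfun_seed_value : cfun3 (seed_value S).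
Proof.
by rewrite /cfun3 /seed_value; cfun_auto ltac:(first
  [cfun_app1 cfun_seed_valid|apply: (cfun_app3 cfun_seed_digit)
  |cfun_app1 cfun_grid|cfun_seed]).
Qed.

Lemma cfun_level_bound : cfun2 (level_bound S ker_code lift).
Proof.
rewrite /cfun2 /level_bound; apply: cfun_iteri; try by cfun_auto ltac:(fail).
rewrite /cfun3; apply: cfun_succ; apply: cfun_sum; last by cfun_auto ltac:(fail).
rewrite /cfun2; apply: cfun_sum; last first.
  by cfun_auto ltac:(cfun_app1 cker).
by rewrite /cfun2; cfun_auto ltac:(first
  [apply: (cfun_app3 cmul)|apply: (cfun_app2 clift)]).
Qed.

Lemma cfun_norm_code : cfun4 (norm_code S ker_code lift).
Proof.
rewrite /cfun4 /norm_code /=; apply: cfun_max; last first.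
  by cfun_auto ltac:(first [apply: (cfun_app2 cfun_level_bound)|cfun_seed]).
by rewrite /cfun2; cfun_auto ltac:(first
  [apply: (cfun_app2 cdom)|apply: (cfun_app3 cfun_level_proj)
  |apply: (cfun_app2 cfun_grid_dist)|apply: (cfun_app3 cfun_seed_value)
  |cfun_seed]).
Qed.

End algorithms_computable.

(** * Grid points as real numbers modulo 1 *)

Section grid_reals.
Variable R : realType.

Lemma grid_distE Q x : (0 < Q)%N ->
  dist_int (x%:R / Q%:R : R) = (grid_dist Q x)%:R / Q%:R.
Proof.
move=> Q0; have QR : 0 < Q%:R :> R by rewrite ltr0n.
have QE : Q%:R != 0 :> R by rewrite gt_eqF.
rewrite /grid_dist; set r := (x %% Q)%N.
have rQ : (r < Q)%N by rewrite ltn_mod.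
have -> : dist_int (x%:R / Q%:R : R) = dist_int (r%:R / Q%:R : R).
  apply: dist_int_eq; rewrite {1}(divn_eq x Q) natrD natrM mulrDl mulfK//.
  by rewrite addrK natr_int.
have [rs|rs] := leqP r (Q - r).
  rewrite dist_int_small ger0_norm ?divr_ge0//.
  rewrite ler_pdivrMr//; have : (r.*2 <= Q)%N by lia.
  by rewrite -(ler_nat R) -muln2 natrM; lra.
have -> : r%:R / Q%:R = - ((Q - r)%:R / Q%:R) + 1 :> R.
  by rewrite natrB 1?ltnW// mulrBl divff//; ring.
rewrite (@dist_int_eq _ _ (- ((Q - r)%:R / Q%:R))); last first.
  by rewrite addrAC subrr add0r rpred1.
rewrite dist_intN dist_int_small ger0_norm ?divr_ge0//.
rewrite ler_pdivrMr//; have : ((Q - r).*2 <= Q)%N by lia.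
by rewrite -(ler_nat R) -muln2 natrM; lra.
Qed.

Lemma grid_gt0 t : (0 < grid t)%N.
Proof. by rewrite /grid muln_gt0 expn_gt0. Qed.

Definition grid_point (t c j : nat) : R := (digit (grid t) c j)%:R / (grid t)%:R.

(** Using m (Q - x) in place of -m x in the integer computation adds m whole turns to each term. *)
Lemma dist_int_grid_lin t c e :
  dist_int (lin_digits (coef_bound t) t e (grid_point t c))
    = (grid_dist (grid t) (grid_lin t c e))%:R / (grid t)%:R.
Proof.
rewrite -grid_distE ?grid_gt0//; apply: dist_int_eq.
set m := coef_bound t; set Q := grid t.
have QE : Q%:R != 0 :> R by rewrite pnatr_eq0 -lt0n grid_gt0.
rewrite /lin_digits /grid_lin natr_sum mulr_suml -sumrB big_seq_cond.
apply: rpred_sum => j _; rewrite -/m -/Q.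
set d := digit _ e j; set x := digit Q c j.
have xQ : (x <= Q)%N by apply: ltnW; exact: digit_lt (grid_gt0 t).
have -> : (d%:R - m%:R) * grid_point t c j
    - (d * x + m * (Q - x))%:R / Q%:R = - m%:R :> R.
  have alg (u v w q : R) : q != 0 -> (u - w) * (v / q) - (u * v + w * (q - v)) / q = - w.
    by move=> q0; field.
  by rewrite /grid_point -/Q -/x natrD (natrM _ d x) (natrM _ m) natrB// alg.
by rewrite rpredN natr_int.
Qed.

Lemma grid_nearP t c c' : reflect
  (forall j, (j < t)%N -> dist_int (grid_point t c j - grid_point t.+1 c' j)
     <= 2 * 2 ^- t)
  (grid_near t c c').
Proof.
set Q := grid t; set Q' := grid t.+1.
have Q0 : (0 < Q)%N := grid_gt0 t; have Q'0 : (0 < Q')%N := grid_gt0 t.+1.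
have QE : Q%:R != 0 :> R by rewrite pnatr_eq0 -lt0n.
have Q'E : Q'%:R != 0 :> R by rewrite pnatr_eq0 -lt0n.
have eqv j : (dist_int (grid_point t c j - grid_point t.+1 c' j) <= 2 * 2 ^- t)
    = (grid_dist (Q * Q') (digit Q c j * Q'
        + (Q * Q' - digit Q' c' j * Q)) * 2 ^ t <= 2 * (Q * Q'))%N.
  have x'Q : (digit Q' c' j * Q <= Q * Q')%N.
    by rewrite mulnC leq_mul2l ltnW ?orbT// digit_lt.
  have -> : dist_int (grid_point t c j - grid_point t.+1 c' j)
      = dist_int ((digit Q c j * Q' + (Q * Q' - digit Q' c' j * Q))%:R
                  / (Q * Q')%:R : R).
    apply: dist_int_eq; rewrite natrD natrB// /grid_point -/Q -/Q'.
    rewrite (natrM _ (digit Q c j)) (natrM _ Q Q') (natrM _ (digit Q' c' j)).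
    have alg (u v q q' : R) : q != 0 -> q' != 0 ->
        u / q - v / q' - (u * q' + (q * q' - v * q)) / (q * q') = - 1.
      by move=> q0 q'0; field; rewrite q0 q'0.
    by rewrite alg// rpredN rpred1.
  have QQ0 : (0 < Q * Q')%N by rewrite muln_gt0 Q0.
  rewrite grid_distE//; set D := (Q * Q')%N in QQ0 *.
  have DR : 0 < D%:R :> R by rewrite ltr0n.
  rewrite (ler_pdivrMr _ _ DR) mulrAC ler_pdivlMr ?exprn_gt0 ?ltr0n//.
  by rewrite -natrX -(natrM _ 2) -(natrM _ (grid_dist _ _)) ler_nat.
apply: (iffP allP) => [h j jt|h j].
  by rewrite eqv; apply: h; rewrite mem_iota.
by rewrite mem_iota add0n => jt; rewrite -eqv; exact: h.
Qed.

Lemma dist_intMn (x : R) n : dist_int (n%:R * x) <= n%:R * dist_int x.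
Proof.
have := @dist_int_le _ (n%:R * x) (n%:R * nint x).
rewrite -mulrBr normrM normr_nat; apply.
by rewrite rpredM ?natr_int ?nint_int.
Qed.

Lemma dist_int_lin_digits m n e (theta theta' : nat -> R) (d : R) :
  (forall j, (j < n)%N -> dist_int (theta j - theta' j) <= d) ->
  dist_int (lin_digits m n e theta)
    <= dist_int (lin_digits m n e theta') + (n * m)%:R * d.
Proof.
move=> close; rewrite -{1}(subrK (lin_digits m n e theta') (lin_digits m n e theta)).
apply: le_trans (dist_intD _ _) _; rewrite addrC lerD2l /lin_digits -sumrB.
elim: n close => [|n IH] close.
  by rewrite big_geq// mul0n mul0r dist_int_small normr0//; lra.
rewrite big_nat_recr//=.
have -> : (n.+1 * m)%:R * d = (n * m)%:R * d + m%:R * d.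
  by rewrite mulSn addnC natrD mulrDl.
apply: le_trans (dist_intD _ _) _; apply: lerD.
  by apply: IH => j jn; apply: close; exact: ltnW.
rewrite -mulrBr; set k := digit _ _ _.
have km : (k <= m.*2)%N by rewrite -ltnS digit_lt.
have d0 : 0 <= d by apply: le_trans (close n _); rewrite ?dist_int_ge0.
have h := close n (ltnSn n).
have [mk|/ltnW mk] := leqP m k.
  rewrite -natrB//; apply: le_trans (dist_intMn _ _) _.
  by apply: ler_pM; rewrite ?dist_int_ge0// ler_nat; lia.
rewrite -opprB -natrB// mulNr dist_intN; apply: le_trans (dist_intMn _ _) _.
by apply: ler_pM; rewrite ?dist_int_ge0// ler_nat; lia.
Qed.

Lemma grid_approx t (theta : nat -> R) : exists2 c, (c < grid t ^ t)%N &
  forall j, (j < t)%N -> dist_int (theta j - grid_point t c j) <= (grid t)%:R^-1.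
Proof.
set Q := grid t; have Q0 : (0 < Q)%N := grid_gt0 t.
have QR : 0 < Q%:R :> R by rewrite ltr0n.
have ex j : exists r : nat, (r < Q)%N /\ dist_int (theta j - r%:R / Q%:R) <= Q%:R^-1.
  pose y := theta j - (Num.floor (theta j))%:~R.
  have y0 : 0 <= y by rewrite subr_ge0 floor_le_tmp.
  have y1 : y < 1.
    by have := floorD1_gt (theta j); rewrite /y intrD; lra.
  have /andP[r1 r2] : (Num.truncn (y * Q%:R))%:R <= y * Q%:R
      < (Num.truncn (y * Q%:R)).+1%:R.
    by apply: truncn_itv; rewrite mulr_ge0// ltW.
  set r := Num.truncn _ in r1 r2; exists r; split.
    rewrite -(ltr_nat R); apply: le_lt_trans r1 _.
    by rewrite -[ltRHS]mul1r ltr_pM2r.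
  rewrite (@dist_int_eq _ _ (y - r%:R / Q%:R)); last first.
    rewrite opprD addrACA opprK.
    have -> : theta j + - y = (Num.floor (theta j))%:~R by rewrite /y opprB addrC subrK.
    by rewrite addNr addr0 intr_int.
  apply: le_trans (dist_int_normr _) _.
  rewrite ger0_norm ?subr_ge0 ?ler_pdivrMr// lerBlDr.
  have -> : Q%:R^-1 + r%:R / Q%:R = r.+1%:R / Q%:R :> R by rewrite -natr1 mulrDl mul1r addrC.
  by rewrite ler_pdivlMr// ltW.
have [r rP] := choice ex.
have [c cQ cP] := digits_exist (n := t) (fun j (_ : (j < t)%N) => (rP j).1).
by exists c => // j jt; rewrite /grid_point cP//; have [] := rP j.
Qed.

End grid_reals.

(** * The dual group *)

Section presentation.
Variables (G : topologicalZmodType) (S : inverse_system).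
Hypothesis presS : computable_tdlc_presentation G S.
Variables (f : G -> {ptws nat -> nat}) (g : {ptws nat -> nat} -> G).
Hypotheses (f_lim : forall x, inverse_limit S (f x)) (fK : cancel f g)
  (gK : forall u, inverse_limit S u -> f (g u) = u)
  (fM : forall x y i, f (x + y) i = isys_mul S i (f x i) (f y i))
  (f_cont : continuous f) (g_cont : {within inverse_limit S, continuous g}).

Local Notation dom := (isys_dom S).
Local Notation one := (isys_one S).
Local Notation mul := (isys_mul S).
Local Notation inv := (isys_inv S).
Local Notation map := (isys_map S).

Lemma level_dom x i : dom i (f x i).
Proof. by have [+ _] := f_lim x; apply. Qed.

Lemma level_map x i : map i.+1 (f x i.+1) = f x i.
Proof. by have [_] := f_lim x; apply. Qed.

Lemma level_one_dom i : dom i (one i).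
Proof. by case: (tdlc_group presS i). Qed.

Lemma level_mul_dom i x y : dom i x -> dom i y -> dom i (mul i x y).
Proof. by case: (tdlc_group presS i) => _ [h _] _ _ _; exact: h. Qed.

Lemma level_inv_dom i x : dom i x -> dom i (inv i x).
Proof. by case: (tdlc_group presS i) => _ [_ h] _ _ _; exact: h. Qed.

Lemma level_mulA i x y z : dom i x -> dom i y -> dom i z ->
  mul i x (mul i y z) = mul i (mul i x y) z.
Proof. by case: (tdlc_group presS i) => _ _ h _ _; exact: h. Qed.

Lemma level_mul1l i x : dom i x -> mul i (one i) x = x.
Proof. by case: (tdlc_group presS i) => _ _ _ h _ /h[]. Qed.

Lemma level_mul1r i x : dom i x -> mul i x (one i) = x.
Proof. by case: (tdlc_group presS i) => _ _ _ h _ /h[]. Qed.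

Lemma level_mulVl i x : dom i x -> mul i (inv i x) x = one i.
Proof. by case: (tdlc_group presS i) => _ _ _ _ h /h[]. Qed.

Lemma level_mulVr i x : dom i x -> mul i x (inv i x) = one i.
Proof. by case: (tdlc_group presS i) => _ _ _ _ h /h[]. Qed.

Lemma level_mulKV i x y : dom i x -> dom i y -> mul i x (mul i (inv i x) y) = y.
Proof.
by move=> dx dy; rewrite level_mulA ?level_mulVr ?level_mul1l ?level_inv_dom.
Qed.

Lemma level_mulI i x y z : dom i x -> dom i y -> dom i z ->
  mul i x y = mul i x z -> y = z.
Proof.
move=> dx dy dz e; rewrite -[y](level_mul1l dy) -[z](level_mul1l dz).
by rewrite -(level_mulVl dx) -!level_mulA ?level_inv_dom// e.
Qed.

Lemma level0 i : f 0 i = one i.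
Proof.
apply: (@level_mulI i (f 0 i)); rewrite ?level_dom ?level_one_dom//.
by rewrite level_mul1r ?level_dom// -fM addr0.
Qed.

Lemma levelN x i : f (- x) i = inv i (f x i).
Proof.
apply: (@level_mulI i (f x i)); rewrite ?level_inv_dom ?level_dom//.
by rewrite level_mulVr ?level_dom// -fM subrr level0.
Qed.

(** Level i is treated as the quotient of G by this subgroup: its characters become homomorphisms of
    G modulo the integers with integer values here, and no group type has to be built on the
    codes. *)
Definition level_ker (i : nat) : {pred G} := [pred x | f x i == one i].

Lemma level_ker_zmod i : zmod_closed (level_ker i).
Proof.
split=> [|x y /eqP xi /eqP yi]; rewrite inE ?level0//.
by rewrite fM levelN xi yi level_mulVr ?level_one_dom.
Qed.

Lemma level_kerB x y i : (x - y \in level_ker i) = (f x i == f y i).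
Proof.
apply/eqP/eqP => [e|e]; last first.
  by rewrite fM levelN e level_mulVr ?level_dom.
by rewrite -[in LHS](subrK y x) fM e level_mul1l ?level_dom.
Qed.

Lemma level_proj_level x i d : (d <= i)%N -> level_proj S i d (f x i) = f x (i - d)%N.
Proof.
elim: d => [|d IH] di; first by rewrite subn0.
rewrite /level_proj /= -/(level_proj S i d _) IH ?(ltnW di)//.
have -> : (i - d = (i - d.+1).+1)%N by lia.
exact: level_map.
Qed.

Lemma level_eq_le x y i j : (j <= i)%N -> f x i = f y i -> f x j = f y j.
Proof.
move=> ji e; have := level_proj_level x (leq_subr j i).
by rewrite e level_proj_level ?leq_subr// subKn.
Qed.

Lemma computable_level_lift :
  exists2 lift, cfun2 lift & level_lift S lift.
Proof.
(* The disjunct [~~ dom i y] lets the search succeed at every y, as minimization requires. *)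
have ex i y : exists x, (dom i.+1 x && (map i.+1 x == y)) || ~~ dom i y.
  case: (boolP (dom i y)) => [dy|]; last by exists 0%N; rewrite orbT.
  have [_ _ /(_ y dy)[x dx e]] := tdlc_map presS i.
  by exists x; rewrite e dx eqxx.
exists (fun i y => ex_minn (ex i y)).
  apply: (cfun_mu (P := fun p x =>
    (dom p.1.+1 x && (map p.1.+1 x == p.2)) || ~~ dom p.1 p.2)).
  - have cdom := cfun2_computable2b (tdlc_comp_dom presS).
    have cmap := cfun2_computable2 (tdlc_comp_map presS).
    by rewrite /cfun2; cfun_auto ltac:(first
      [apply: (cfun_app2 cdom)|apply: (cfun_app2 cmap)]).
  - by move=> p; case: ex_minnP.
  - by move=> p k; case: ex_minnP => m _ h /h.
move=> i y dy; case: ex_minnP => x + _.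
by rewrite dy orbF => /andP[dx /eqP].
Qed.

Variable lift : nat -> nat -> nat.
Hypothesis liftP : level_lift S lift.

(** The element y is completed to a compatible sequence, upwards by [lift] and downwards by the
    maps; [g] turns this sequence into an element of G. *)
Lemma level_surj i y : dom i y -> exists x, f x i = y.
Proof.
move=> dy.
pose up k := iteri k (fun j z => lift (i + j) z) y.
have upP k : dom (i + k) (up k) /\ map (i + k).+1 (up k.+1) = up k.
  elim: k => [|k [IH _]].
    by rewrite addn0; split=> //=; rewrite addn0; have [] := liftP dy.
  have /liftP[d1 e1] : dom (i + k)%N (up k) by [].
  have d2 : dom (i + k.+1)%N (up k.+1) by rewrite addnS.
  by split=> //; have /liftP[] := d2.
have mapd j z : dom j.+1 z -> dom j (map j.+1 z).
  by have [h _ _] := tdlc_map presS j; exact: h.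
have dn k : (k <= i)%N -> dom (i - k) (level_proj S i k y).
  elim: k => [|k IH] ki; first by rewrite subn0.
  rewrite /level_proj /= -/(level_proj S i k y).
  have := IH (ltnW ki); have -> : (i - k = (i - k.+1).+1)%N by lia.
  exact: mapd.
pose u j := if (i <= j)%N then up (j - i)%N else level_proj S i (i - j) y.
exists (g u); rewrite gK /u; first by rewrite leqnn subnn.
split=> j; rewrite /u.
  case: (leqP i j) => ij; first by have [+ _] := upP (j - i)%N; rewrite subnKC.
  by have := dn (i - j)%N (leq_subr _ _); rewrite subKn// ltnW.
case: (leqP i j) => ij.
  rewrite (leqW ij); have [_] := upP (j - i)%N; rewrite subnKC//.
  by rewrite subSn.
case: (leqP i j.+1) => ij'.
  have -> : i = j.+1 by lia.
  by rewrite subnn subSn// subnn.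
have -> : (i - j = (i - j.+1).+1)%N by lia.
rewrite [in RHS]/level_proj /= -/(level_proj S i _ y).
by have -> : (i - (i - j.+1) = j.+1)%N by lia.
Qed.

Variable ker_code : nat -> nat.
Hypothesis kerP : forall i, isys_ker S i.+1 = canonical_set (ker_code i.+1).

(** An element of level l + 1 is the lift of its image times a kernel element z. Membership in the
    set of strong index k gives 2^z <= k, so z < k, and a sum over all such products dominates each
    of them. *)
Lemma level_bound_lt x K l : (f x 0%N < K)%N ->
  (f x l < level_bound S ker_code lift l K)%N.
Proof.
move=> x0; elim: l => // l IH; rewrite /level_bound /=.
rewrite -/(level_bound S ker_code lift l K).
have [dw mw] := liftP (level_dom x l); set w := lift _ _ in dw mw.
have dz : dom l.+1 (mul l.+1 (inv l.+1 w) (f x l.+1)).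
  by apply: level_mul_dom; rewrite ?level_inv_dom ?level_dom.
set z := mul _ _ _ in dz.
have zE : mul l.+1 w z = f x l.+1 by rewrite level_mulKV ?level_dom.
have [mapD mapM _] := tdlc_map presS l.
have zk : isys_ker S l.+1 z.
  split=> //=; apply: (@level_mulI l (f x l)).
  - exact: level_dom.
  - exact: mapD.
  - exact: level_one_dom.
  by rewrite level_mul1r ?level_dom// -{1}mw -mapM// zE level_map.
have zlt : (z < ker_code l.+1)%N.
  move: zk; rewrite kerP /canonical_set /= => zo.
  have : (0 < ker_code l.+1 %/ 2 ^ z)%N by case: (_ %/ _)%N zo.
  by rewrite divn_gt0 ?expn_gt0//; apply: leq_trans; exact: ltn_expl.
rewrite ltnS (bigD1_seq (f x l)) ?mem_index_iota ?iota_uniq//=.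
rewrite (bigD1_seq z) ?mem_index_iota ?iota_uniq//= zE -addnA.
exact: leq_addr.
Qed.

Lemma nbhs_coord (u : {ptws nat -> nat}) i :
  nbhs u [set v : {ptws nat -> nat} | v i = u i].
Proof.
have /(_ u) := @proj_continuous nat (fun=> nat) i.
by move=> /(_ [set n | n = u i]); apply; exact: discrete_set1.
Qed.

Lemma nbhs_level x i : nbhs x [set y | f y i = f x i].
Proof. exact: (f_cont (nbhs_coord (f x) i)). Qed.

(** Otherwise there would be points outside U in every kernel. Their images under f converge
    coordinatewise to that of 0, and the continuity of g on the inverse limit would bring them into
    U. *)
Lemma level_ker_base (U : set G) :
  nbhs 0 U -> exists i, forall x, x \in level_ker i -> U x.
Proof.
move=> U0; apply: contrapT => nU.
have ex i : exists x, f x i = one i /\ ~ U x.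
  apply: contrapT => nx; apply: nU; exists i => x /eqP xi.
  by apply: contrapT => Ux; apply: nx; exists x.
have [x xP] := choice ex.
have fx0 : (f (x n) : {ptws nat -> nat}) @[n --> \oo] --> (f 0 : {ptws nat -> nat}).
  apply/pointwise_cvgP => j A /= /nbhs_singleton Aj.
  exists j => // n jn /=.
  rewrite (@level_eq_le (x n) 0 n j jn)//.
  by have [-> _] := xP n; rewrite level0.
have gU : nbhs (g (f 0)) U by rewrite fK.
have /(_ U gU) := @g_cont (f 0).
have -> : nbhs (f 0 : subspace (inverse_limit S)) = within (inverse_limit S) (nbhs (f 0)).
  by rewrite nbhs_subspace_in//; exact: f_lim.
rewrite /within /= => /fx0 [N _ /(_ N (leqnn N))] /=.
by move=> /(_ (f_lim _)); rewrite /from_subspace fK; have [_] := xP N.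
Qed.

(** The corresponding sequences form a closed subset of a product of finite sets, given by
    [level_bound] and compact by Tychonoff's theorem; its image under [g] is the set in question. *)
Lemma compact_level K : compact [set x | (f x 0%N < K)%N].
Proof.
pose F i := [set n | (n < level_bound S ker_code lift i K)%N].
have cF : compact [set u : {ptws nat -> nat} | forall i, F i (u i)].
  apply: (@tychonoff nat (fun=> nat) F) => i.
  exact/finite_compact/finite_II.
pose L := inverse_limit S `&` [set u : {ptws nat -> nat} | (u 0%N < K)%N].
have openQ i j (Q : nat -> nat -> Prop) :
    open [set u : {ptws nat -> nat} | Q (u i) (u j)].
  rewrite openE => u Qu; apply: filterS2 (nbhs_coord u i) (nbhs_coord u j).
  by move=> v /= -> ->.
have closedQ i j (Q : nat -> nat -> Prop) :
    closed [set u : {ptws nat -> nat} | Q (u i) (u j)].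
  by rewrite -[X in closed X]setCK; apply: open_closedC; exact: (openQ i j (fun x y => ~ Q x y)).
have cL : closed L.
  apply: closedI; last exact: (closedQ 0%N 0%N (fun x _ => x < K)%N).
  have -> : inverse_limit S = \bigcap_i [set u | dom i (u i) /\ map i.+1 (u i.+1) = u i].
    apply/seteqP; split=> [u [h1 h2] i _|u h]; first by split.
    by split=> i; have [] := h i I.
  by apply: closed_bigI => i _; exact: (closedQ i i.+1 (fun x y => dom i x /\ map i.+1 y = x)).
have LF : L `<=` [set u | forall i, F i (u i)].
  move=> u [uL uK] i; rewrite /F /= -(gK uL).
  by apply: level_bound_lt; rewrite gK.
have coL := subclosed_compact cL cF LF.
have -> : [set x | (f x 0%N < K)%N] = g @` L.
  apply/seteqP; split=> [x xK|_ [u [uL uK] <-]] /=; last by rewrite gK.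
  by exists (f x).
apply: continuous_compact coL.
by apply: continuous_subspaceW g_cont; exact: subIsetl.
Qed.

Lemma compact_coset x i : compact [set y | f y i = f x i].
Proof.
apply: (subclosed_compact _ (@compact_level (f x 0%N).+1)).
  rewrite -[X in closed X]setCK; apply: open_closedC.
  rewrite openE => y /= yx; apply: filterS (nbhs_level y i) => z /= ->.
  exact: yx.
by move=> y /= yx; rewrite (level_eq_le (leq0n i) yx).
Qed.

(** * From grid points that pass the test to characters *)

Variable R : realType.

Lemma level_gen_dom i j : dom i (level_gen S i j).
Proof. by rewrite /level_gen; case: ifP => // _; exact: level_one_dom. Qed.

Lemma level_gen_id x i : level_gen S i (f x i) = f x i.
Proof. by rewrite /level_gen level_dom. Qed.

Variable gen : nat -> nat -> G.
Hypothesis genP : forall i j, f (gen i j) i = level_gen S i j.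

Lemma level_powE x i n : f (x *+ n) i = level_pow S i (f x i) n.
Proof.
elim: n => [|n IH]; first by rewrite mulr0n level0.
by rewrite mulrS fM IH.
Qed.

Lemma level_digit_comb i m n e :
  f (digit_comb (gen i) m n e) i = level_word S i m n e.
Proof.
elim: n => [|n IH]; first by rewrite /digit_comb big_geq// level0.
rewrite /digit_comb big_nat_recr//= fM -/(digit_comb (gen i) m n e) IH.
by rewrite fM -mulNrn !level_powE levelN genP.
Qed.

Lemma gen_ker x i : gen i (f x i) - x \in level_ker i.
Proof. by rewrite level_kerB genP level_gen_id. Qed.

(** Soundness of the test, by the Kronecker theorem for G modulo the i-th kernel. *)
Lemma grid_hom_approx i t c : grid_hom S i t c ->
  exists chi : G -> R, [/\ mod_int_hom chi,
    {in level_ker i, forall y, chi y \is a Num.int} &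
    forall j, (j < t)%N ->
      dist_int (grid_point R t c j - chi (gen i j)) <= 2 ^- t].
Proof.
move=> /allP hc; apply: (mod_int_hom_approx (level_ker_zmod i) (coef_boundP R t)).
move=> e eB eN; rewrite dist_int_grid_lin ler_pdivrMr ?ltr0n ?grid_gt0//.
have /implyP := hc e ltac:(by rewrite mem_iota).
rewrite -level_digit_comb => /(_ eN); rewrite -(ler_nat R) natrM; lra.
Qed.

(** Completeness of the test: a relation has an integer value under [chi], and rounding its t terms
    moves this value by at most t * coef_bound t / grid t <= 1/4. *)
Lemma grid_hom_of_hom i t (chi : G -> R) : mod_int_hom chi ->
  {in level_ker i, forall y, chi y \is a Num.int} ->
  exists c, [/\ (c < grid t ^ t)%N, grid_hom S i t c &
    forall j, (j < t)%N ->
      dist_int (chi (gen i j) - grid_point R t c j) <= (grid t)%:R^-1].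
Proof.
move=> chiD chiN; have [c cQ cP] := grid_approx t (chi \o gen i).
exists c; split=> //; apply/allP => e _; apply/implyP.
rewrite -level_digit_comb => eN.
have Q0 := grid_gt0 t; have QR : 0 < (grid t)%:R :> R by rewrite ltr0n.
suff : dist_int (lin_digits (coef_bound t) t e (grid_point R t c)) <= 1 / 4.
  rewrite dist_int_grid_lin ler_pdivrMr// -(ler_nat R) natrM; lra.
have lin0 : dist_int (lin_digits (coef_bound t) t e (chi \o gen i)) = 0.
  apply/eqP; rewrite dist_int_eq0.
  have := rpredB (chiN _ eN) (mod_int_hom_digit_comb (gen i) (coef_bound t) t e chiD).
  by rewrite opprB addrC subrK.
have := @dist_int_lin_digits R (coef_bound t) t e (grid_point R t c) (chi \o gen i)
  (grid t)%:R^-1.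
rewrite lin0 add0r => /(_ _)/le_trans; apply.
  by move=> j jt; rewrite -dist_intN opprB; exact: cP.
rewrite ler_pdivrMr//.
have : (4 * (t * coef_bound t) <= grid t)%N.
  rewrite /grid !expnS; have : (0 < 2 ^ t)%N by rewrite expn_gt0. nia.
by rewrite -(ler_nat R) natrM; lra.
Qed.

Lemma grid_invS_le t : (grid t)%:R^-1 <= 2 ^- t :> R.
Proof.
rewrite lef_pV2 ?posrE ?ltr0n ?grid_gt0 ?exprn_gt0 ?ltr0n// -natrX ler_nat.
rewrite /grid !expnS; have : (0 < 2 ^ t)%N by rewrite expn_gt0. nia.
Qed.

(** A point that passes is within 2^-t of a character, whose rounding at stage t + 1 passes too. The
    two errors add up to at most 2 * 2^-t, the tolerance of [grid_near]. *)
Lemma grid_nextP i t c : grid_hom S i t c ->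
  grid_hom S i t.+1 (grid_next S i t c) /\ grid_near t c (grid_next S i t c).
Proof.
move=> hc; have [chi [chiD chiN chi_c]] := grid_hom_approx hc.
have [c' [c'Q hc' chi_c']] := grid_hom_of_hom t.+1 chiD chiN.
have near' : grid_near t c c'.
  apply/(grid_nearP R) => j jt.
  have -> : grid_point R t c j - grid_point R t.+1 c' j =
    (grid_point R t c j - chi (gen i j)) + (chi (gen i j) - grid_point R t.+1 c' j).
    by rewrite addrA subrK.
  apply: le_trans (dist_intD _ _) _.
  have h1 := chi_c j jt; have h2 := chi_c' j (ltnW jt).
  have h3 := grid_invS_le t.+1.
  have h4 : 2 ^- t.+1 <= 2 ^- t :> R.
    by rewrite lef_pV2 ?posrE ?exprn_gt0 ?ltr0n// ler_eXn2l ?ltr1n.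
  by lra.
have hasp : has (fun c' => grid_hom S i t.+1 c' && grid_near t c c')
    (iota 0 (grid t.+1 ^ t.+1)).
  by apply/hasP; exists c'; rewrite ?mem_iota ?hc'.
have := nth_find 0%N hasp; move: hasp; rewrite has_find size_iota => lt.
by rewrite nth_iota// add0n => /andP[].
Qed.

Section seed_character.
Variable u : nat.
Hypothesis u_valid : seed_valid S u.

Let i := seed_level u.
Let t s := (seed_stage u + s)%N.
Let c s := grid_iter S i (seed_stage u) (seed_point u) s.
Let z s j : RmodZ R := rmz (grid_point R (t s) (c s) j).

Lemma grid_iter_hom s : grid_hom S i (t s) (c s).
Proof.
elim: s => [|s IH]; first by rewrite /t addn0; case/andP: u_valid.
by rewrite /t addnS; case: (grid_nextP IH).
Qed.

Lemma grid_iter_near s : grid_near (t s) (c s) (c s.+1).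
Proof. by case: (grid_nextP (grid_iter_hom s)). Qed.

Lemma grid_iter_cauchy s d j : (j < t s)%N ->
  rnorm (z s j - z (s + d) j) <= 4 * 2 ^- t s.
Proof.
(* The stronger bound is the exact sum of the steps 2 * 2^-t between the two stages, which makes the
   induction go through. *)
move=> jt; suff : rnorm (z s j - z (s + d) j) <= 4 * 2 ^- t s - 4 * 2 ^- t (s + d).
  have : 0 <= 2 ^- t (s + d) :> R by rewrite invr_ge0 exprn_ge0.
  by lra.
elim: d => [|d IH]; first by rewrite addn0 !subrr rnorm0.
apply: le_trans (rnorm_distD (z (s + d) j) _ _) _; rewrite addnS.
have tS : t (s + d).+1 = (t (s + d)).+1 by rewrite /t addnS.
have jt' : (j < t (s + d))%N by apply: leq_trans jt _; rewrite /t addnA leq_addr.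
have near := elimT (grid_nearP R _ _ _) (grid_iter_near (s + d)) j jt'.
rewrite -tS -rnorm_rmz rmzB -/(z (s + d) j) -/(z (s + d).+1 j) in near.
have -> : 2 ^- t (s + d).+1 = 2 ^- t (s + d) / 2 :> R.
  by rewrite tS exprS invfM mulrC.
by lra.
Qed.

Lemma grid_iter_limit j : exists l : RmodZ R,
  forall s, (j < t s)%N -> rnorm (z s j - l) <= 4 * 2 ^- t s.
Proof.
have pow0 e : 0 < e -> exists N, forall n, (N <= n)%N -> 2 ^- n < e :> R.
  move=> e0; exists (Num.truncn e^-1).+1 => n nN.
  rewrite invf_plt ?posrE ?exprn_gt0 ?ltr0n//.
  apply: lt_le_trans (truncnS_gt _) _; apply: (@le_trans _ _ n%:R).
    by rewrite ler_nat.
  by rewrite -natrX ler_nat ltnW// ltn_expl.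
have [|l lP] := @RmodZ_cauchy_cvg R (z^~ j).
  move=> e e0; have [N NP] := pow0 (e / 8) ltac:(lra).
  exists (maxn N j.+1) => m n; rewrite !geq_max => /andP[Nm jm] /andP[Nn jn].
  have jt k : (j < k)%N -> (j < t k)%N by move=> jk; apply: ltn_addl.
  have small k : (N <= k)%N -> 2 ^- t k < e / 8.
    by move=> Nk; apply: NP; apply: leq_trans Nk (leq_addl _ _).
  have [mn|/ltnW nm] := leqP m n.
    have := grid_iter_cauchy (n - m) (jt m jm); rewrite subnKC//.
    by have := small m Nm; lra.
  have := grid_iter_cauchy (m - n) (jt n jn); rewrite subnKC// rnorm_distC.
  by have := small n Nn; lra.
exists l => s js; apply/ler_addgt0Pr => e e0; have [N NP] := lP e e0.
apply: le_trans (rnorm_distD (z (s + N) j) _ _) _.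
apply: lerD; first exact: grid_iter_cauchy.
by apply/ltW/NP; rewrite leq_addl.
Qed.

(** Each stage is within 2^-t of a genuine homomorphism and within 4 * 2^-t of the limit. The limit
    is thus additive up to 15 * 2^-t, three values being involved, for every large t. *)
Lemma seed_character_exists : exists chi : G -> RmodZ R,
  [/\ {morph chi : x y / x + y},
      forall x y, f x i = f y i -> chi x = chi y &
      forall x s, (f x i < t s)%N ->
        rnorm (z s (f x i) - chi x) <= 4 * 2 ^- t s].
Proof.
have [l lP] := choice grid_iter_limit.
exists (fun x => l (f x i)); split=> [x y|x y ->//|x s xs]; last exact: lP.
apply/eqP; rewrite -subr_eq0; apply/eqP/rnorm_eq0/eqP.
rewrite eq_le rnorm_ge0 andbT; apply/ler_addgt0Pr => e e0; rewrite add0r.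
have [n ne] : exists n : nat, e^-1 * 15 < n%:R.
  by exists (Num.truncn (e^-1 * 15)).+1; exact: truncnS_gt.
(* Large enough for the grid points to have coordinates at the three elements and for 15 * 2^-t to
   be at most e. *)
pose s := (n + f x i + f y i + f (x + y) i).+1.
have lt j : (j < s)%N -> (j < t s)%N by move=> js; apply: ltn_addl.
have [theta [thD thN thP]] := grid_hom_approx (grid_iter_hom s).
have close w : (f w i < s)%N -> rnorm (l (f w i) - rmz (theta w)) <= 5 * 2 ^- t s.
  move=> ws; apply: le_trans (rnorm_distD (z s (f w i)) _ _) _.
  have h1 := lP (f w i) s (lt _ ws); have h2 := thP (f w i) (lt _ ws).
  have -> : rmz (theta w) = rmz (theta (gen i (f w i))).
    apply/rmz_eqP; have := rpredD (thN _ (gen_ker w i))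
      (mod_int_homB thD (gen i (f w i)) w).
    rewrite addrC -rpredN.
    set A := theta (gen i _ - w); set B := theta (gen _ _); set C := theta w.
    have -> : - (A - (B - C) + A) = - (A + A) + (B - C) by ring.
    have A2 : A + A \is a Num.int by rewrite rpredD// thN// gen_ker.
    by move=> /(rpredD A2); rewrite addrA subrr add0r -rpredN opprB.
  rewrite rnorm_distC; rewrite -rnorm_rmz rmzB in h2.
  by rewrite -/(z s (f w i)) in h2; lra.
have hx := close x ltac:(rewrite /s; lia).
have hy := close y ltac:(rewrite /s; lia).
have hxy := close (x + y) ltac:(rewrite /s; lia).
have -> : l (f (x + y) i) - (l (f x i) + l (f y i)) =
  (l (f (x + y) i) - rmz (theta (x + y)))
  + (- (l (f x i) - rmz (theta x)) + - (l (f y i) - rmz (theta y))).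
  have -> : rmz (theta (x + y)) = rmz (theta x) + rmz (theta y).
    by rewrite -rmzD; apply/rmz_eqP; exact: thD.
  by rewrite !opprB [X in _ = _ + X]addrACA -opprD addrA subrK.
apply: le_trans (rnormD _ _) _.
have := rnormD (- (l (f x i) - rmz (theta x))) (- (l (f y i) - rmz (theta y))).
rewrite !(rnormN).
have : 15 * 2 ^- t s <= e.
  rewrite -ler_pdivlMl ?ltr0n// invf_ple ?posrE ?exprn_gt0 ?ltr0n ?mulr_gt0//.
  rewrite invfM invrK mulrC; apply: le_trans (ltW ne) _.
  rewrite -natrX ler_nat; apply: leq_trans (ltnW (ltn_expl n (ltnSn 1))) _.
  by rewrite leq_exp2l// /t /s; lia.
by lra.
Qed.

End seed_character.

(** * The metric on the dual: compatibility and completeness *)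

Local Notation T := (RmodZ R).
Local Notation D := (pontryagin_dual R G).
Implicit Types chi psi : D.

Lemma char_cont chi : continuous (chi : G -> T).
Proof. by have /asboolP[] := char_valP chi. Qed.

Lemma charD chi x y : chi (x + y) = chi x + chi y.
Proof. by have /asboolP[_] := char_valP chi; apply. Qed.

Lemma char_valB chi psi x : (chi - psi) x = chi x - psi x.
Proof. by []. Qed.

Lemma char_valD chi psi x : (chi + psi) x = chi x + psi x.
Proof. by []. Qed.

Lemma char_valN chi x : (- chi) x = - chi x.
Proof. by []. Qed.

Lemma char_val0 x : (0 : D) x = 0.
Proof. by []. Qed.

Lemma morph_muln (chi : G -> T) x n :
  {morph chi : x y / x + y} -> chi (x *+ n) = chi x *+ n.
Proof.
move=> chiD; have chi0 : chi 0 = 0.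
  by apply: (addrI (chi 0)); rewrite -chiD !addr0.
by elim: n => [|n IH]; rewrite ?mulr0n// !mulrS chiD IH.
Qed.

Lemma morph_sub (chi : G -> T) x y :
  {morph chi : x y / x + y} -> chi (x - y) = chi x - chi y.
Proof.
by move=> chiD; apply/eqP; rewrite eq_sym subr_eq -chiD subrK.
Qed.

Lemma level_char (chi : G -> T) i : {morph chi : x y / x + y} ->
  (forall x y, f x i = f y i -> chi x = chi y) ->
  exists psi : D, psi = chi :> (G -> T).
Proof.
move=> chiD chi_i; have cP : chi \in @character R G.
  apply/asboolP; split=> // x A /nbhs_singleton Ax.
  by apply: filterS (nbhs_level x i) => y /= /chi_i ->.
by exists (PontryaginDual cP).
Qed.

(* R/Z has no small subgroups. *)
Lemma morph_ker_trivial (chi : G -> T) i : {morph chi : x y / x + y} ->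
  (forall x, x \in level_ker i -> rnorm (chi x) <= 1 / 4) ->
  forall x y, f x i = f y i -> chi x = chi y.
Proof.
move=> chiD small x y /eqP; rewrite -level_kerB => xyN.
apply/eqP; rewrite -subr_eq0 -morph_sub//; apply/eqP.
apply: rnorm_small_multiples => k; rewrite -morph_muln//; apply: small.
have [k0 kB] := level_ker_zmod i.
have kD w w' : w \in level_ker i -> w' \in level_ker i -> w + w' \in level_ker i.
  by move=> hw hw'; rewrite -[w']opprK kB// -sub0r kB.
by elim: (2 ^ k)%N => [|n IH]; rewrite ?mulr0n// mulrS kD.
Qed.

Lemma char_level chi : exists i, forall x y, f x i = f y i -> chi x = chi y.
Proof.
have [|i iP] := @level_ker_base [set x | rnorm (chi x) < 1 / 4].
  apply: (@char_cont chi 0 [set t | rnorm t < 1 / 4]).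
  apply/nbhs_rnormP; exists (1 / 4); first by lra.
  have -> : chi 0 = 0 by apply: (addrI (chi 0)); rewrite -charD !addr0.
  by move=> s; rewrite subr0.
exists i; apply: morph_ker_trivial => [x y|x /iP/ltW//]; exact: charD.
Qed.

Definition weight (x : G) : R := 2 ^- f x 0%N.

Lemma weight_gt0 x : 0 < weight x.
Proof. by rewrite invr_gt0 exprn_gt0. Qed.

Lemma weight_le1 x : weight x <= 1.
Proof. by rewrite invf_le1 ?exprn_gt0 ?exprn_ege1 ?ler1n ?ltr0n. Qed.

(* A supremum over all of [G] rather than over representatives of level 0, so
   that a character of small norm is small, hence trivial, on the kernel of the
   map to level 0. *)
Definition dual_norm (chi : G -> T) : R :=
  sup (range (fun x => weight x * rnorm (chi x))).

Lemma dual_norm_ub (chi : G -> T) x : weight x * rnorm (chi x) <= dual_norm chi.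
Proof.
apply: ub_le_sup; last by exists x.
exists 1 => _ [y _ <-]; apply: mulr_ile1; rewrite ?rnorm_ge0 ?weight_le1//.
  exact: ltW (weight_gt0 y).
by apply: le_trans (rnorm_half _) _; lra.
Qed.

Lemma dual_norm_le (chi : G -> T) e :
  (forall x, weight x * rnorm (chi x) <= e) -> dual_norm chi <= e.
Proof.
move=> h; apply: ge_sup; first by exists (weight 0 * rnorm (chi 0)), 0.
by move=> _ [x _ <-].
Qed.

Lemma dual_norm_ge0 (chi : G -> T) : 0 <= dual_norm chi.
Proof.
apply: le_trans (dual_norm_ub chi 0).
by rewrite mulr_ge0 ?rnorm_ge0// ltW// weight_gt0.
Qed.

Definition dual_dist chi psi : R := dual_norm (chi - psi : D).

Lemma dual_dist_pointwise chi psi x e : dual_dist chi psi < weight x * e ->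
  rnorm (chi x - psi x) < e.
Proof.
move=> h; have := le_lt_trans (dual_norm_ub (chi - psi : D) x) h.
by rewrite ltr_pM2l ?weight_gt0.
Qed.

Lemma dual_normD chi psi :
  dual_norm (chi + psi : D) <= dual_norm chi + dual_norm psi.
Proof.
apply: dual_norm_le => x.
apply: le_trans (lerD (dual_norm_ub chi x) (dual_norm_ub psi x)).
by rewrite -mulrDr ler_wpM2l ?(ltW (weight_gt0 x))// rnormD.
Qed.

Lemma dual_normN chi : dual_norm (- chi : D) = dual_norm chi.
Proof.
rewrite /dual_norm; have -> // : (fun x => weight x * rnorm ((- chi : D) x))
  = (fun x => weight x * rnorm (chi x)).
by apply/funext => x; rewrite char_valN rnormN.
Qed.

Lemma dual_dist_metric : is_metric dual_dist.
Proof.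
split=> [chi psi|chi psi|x y z].
- split=> [h|->]; last first.
    apply/eqP; rewrite eq_le dual_norm_ge0 andbT; apply: dual_norm_le => x.
    by rewrite subrr rnorm0 mulr0.
  apply: val_inj; apply/funext => x; apply/eqP; rewrite -subr_eq0; apply/eqP/rnorm_eq0.
  apply/eqP; rewrite eq_le rnorm_ge0 andbT.
  have := dual_norm_ub (chi - psi : D) x.
  by rewrite -[dual_norm _]/(dual_dist _ _) h pmulr_rle0 ?weight_gt0.
- by rewrite /dual_dist -opprB dual_normN.
- by rewrite /dual_dist -[x - z](subrKA y) dual_normD.
Qed.

Lemma open_rnorm_ball (t : T) (e : R) : open [set s | rnorm (s - t) < e].
Proof.
rewrite openE => s /= st; apply/nbhs_rnormP; exists (e - rnorm (s - t)).
  by rewrite subr_gt0.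
by move=> w ws; apply: le_lt_trans (rnorm_distD s _ _) _; lra.
Qed.

Lemma char_val_continuous : continuous (@char_val R G : D -> {compact-open, G -> T}).
Proof. exact: initial_continuous. Qed.

(* On the complement of a finite union of compact cosets the weight is small,
   and on each of these cosets [chi] is constant. *)
Lemma nbhs_dual_ball chi e : 0 < e -> nbhs chi (mball dual_dist chi e).
Proof.
move=> e0; have [i chi_i] := char_level chi.
have [K Ke] : exists K : nat, e^-1 < K%:R.
  by exists (Num.truncn e^-1).+1; exact: truncnS_gt.
have near n : nbhs chi [set psi : D | forall x, (f x i < n)%N ->
    rnorm (psi x - chi x) < e / 2].
  elim: n => [|n IH]; first exact: filterS filterT.
  have [[x0 x0n]|nx] := pselect (exists x0, f x0 i = n); last first.
    apply: filterS IH => psi h x; rewrite ltnS leq_eqVlt => /orP[/eqP xn|/h//].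
    by exfalso; apply: nx; exists x.
  have near0 : nbhs chi [set psi : D | psi @` [set y | f y i = f x0 i]
      `<=` [set s | rnorm (s - chi x0) < e / 2]].
    have : nbhs (char_val chi : {compact-open, G -> T})
        [set h : {compact-open, G -> T} | h @` [set y | f y i = f x0 i]
          `<=` [set s | rnorm (s - chi x0) < e / 2]].
      apply: open_nbhs_nbhs; split.
        exact: (compact_open_open (@compact_coset x0 i)
          (@open_rnorm_ball (chi x0) (e / 2))).
      by move=> _ [y /= yx <-] /=; rewrite (chi_i _ _ yx) subrr rnorm0; lra.
    exact: char_val_continuous.
  apply: filterS2 IH near0 => psi h h0 x.
  rewrite ltnS leq_eqVlt => /orP[/eqP xn|/h//].
  have xx0 : f x i = f x0 i by rewrite xn.
  by rewrite (chi_i _ _ xx0); apply: h0; exists x.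
(* Below this bound lie all the elements whose image at level 0 is less than K; the others have
   weight at most e, and norms in the circle are at most 1/2. *)
apply: filterS (near (level_bound S ker_code lift i K)) => psi h.
apply: (@le_lt_trans _ _ (e / 2)); last by lra.
apply: dual_norm_le => x; rewrite char_valB rnorm_distC.
have [xK|xK] := ltnP (f x 0%N) K.
  have := h x (level_bound_lt i xK); have := weight_le1 x; have := weight_gt0 x.
  by have := rnorm_ge0 (psi x - chi x); nra.
have : weight x <= e.
  rewrite /weight invf_ple ?posrE ?exprn_gt0//; apply: le_trans (ltW Ke) _.
  by rewrite -natrX ler_nat; apply: leq_trans xK _; exact/ltnW/ltn_expl.
by have := rnorm_half (psi x - chi x); have := rnorm_ge0 (psi x - chi x);
  have := weight_gt0 x; nra.
Qed.

(** It suffices that the filter of balls converges to [chi] in the compact-open topology.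
    Compactness in its near-covering form reduces this to a single point, around which [chi] and the
    weight are both constant on a coset. *)
Lemma dual_ball_nbhs chi (A : set D) :
  nbhs chi A -> exists2 e : R, 0 < e & mball dual_dist chi e `<=` A.
Proof.
pose F : set_system D := filter_from [set e : R | 0 < e] (mball dual_dist chi).
have FF : Filter F.
  apply: filter_from_filter; first by exists 1 => /=; lra.
  move=> e e' /= e0 e'0; exists (Num.min e e'); first by rewrite /= lt_min e0.
  by move=> psi; rewrite /mball /= lt_min => /andP[].
suff cvgF : (@char_val R G @ F : set_system {compact-open, G -> T}) -->
    (chi : {compact-open, G -> T}).
  move=> [_ [[B Bop <-] /= Bchi] BA].
  have /cvgF [e e0 eB] : nbhs (chi : {compact-open, G -> T}) B.
    by apply: open_nbhs_nbhs; split.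
  by exists e => // psi /eB; exact: BA.
apply/compact_open_cvgP => K O cK oO KO.
have [i chi_i] := char_level chi.
have := cK => /compact_near_coveringP/(_ _ F (fun psi x => O (psi x)) FF).
move=> h; have {}h := h _; apply: filterS (h _).
  by move=> psi OK _ [x Kx <-]; exact: OK.
move=> x Kx; have : nbhs (chi x) O.
  by apply: open_nbhs_nbhs; split=> //; apply: KO; exists x.
move=> /nbhs_rnormP[r r0 rO].
exists ([set y | f y (maxn i 0) = f x (maxn i 0)], mball dual_dist chi (weight x * r)).
  split; first exact: nbhs_level.
  by exists (weight x * r) => //=; rewrite mulr_gt0 ?weight_gt0.
move=> [y psi] /= [yx psichi]; rewrite maxn0 in yx.
apply: rO; rewrite -(chi_i _ _ yx) rnorm_distC; apply: dual_dist_pointwise.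
by rewrite /weight (level_eq_le (leq0n i) yx).
Qed.

Lemma dual_dist_compatible : compatible_metric dual_dist.
Proof.
move=> chi A; split=> [|[e e0 eA]]; first exact: dual_ball_nbhs.
exact: filterS eA (nbhs_dual_ball chi e0).
Qed.

(** The pointwise limit is additive, and the issue is its continuity. The weight is constant on the
    kernel of level 0, so some u_N is uniformly within 1/4 of the limit there; their difference is a
    homomorphism, hence trivial on that kernel, and the limit factors through the same level as u_N
    or through level 0, whichever is higher. *)
Lemma dual_dist_complete : complete_metric dual_dist.
Proof.
move=> u cu.
have lim x : exists l : T, forall e : R, 0 < e -> exists N, forall n,
    (N <= n)%N -> rnorm (u n x - l) < e.
  apply: (@RmodZ_cauchy_cvg R (fun n => u n x)) => e e0.
  have [N NP] := cu (weight x * e) (mulr_gt0 (weight_gt0 x) e0).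
  exists N => m n Nm Nn; apply: dual_dist_pointwise; exact: NP.
have [l lP] := choice lim.
have lD : {morph l : x y / x + y}.
  move=> x y; apply/eqP; rewrite -subr_eq0; apply/eqP/rnorm_eq0/eqP.
  rewrite eq_le rnorm_ge0 andbT; apply/ler_addgt0Pr => e e0; rewrite add0r.
  have e3 : 0 < e / 3 by lra.
  have [N1 h1] := lP x _ e3; have [N2 h2] := lP y _ e3.
  have [N3 h3] := lP (x + y) _ e3.
  pose n := (N1 + N2 + N3)%N.
  have {}h1 := h1 n ltac:(rewrite /n; lia); have {}h2 := h2 n ltac:(rewrite /n; lia).
  have {}h3 := h3 n ltac:(rewrite /n; lia).
  have -> : l (x + y) - (l x + l y)
      = - (u n (x + y) - l (x + y)) + ((u n x - l x) + (u n y - l y)).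
    by rewrite charD opprB [X in _ = _ + X]addrACA -opprD addrA subrK.
  apply: le_trans (rnormD _ _) _; rewrite rnormN.
  by have := rnormD (u n x - l x) (u n y - l y); lra.
have [N NP] : exists N, forall x, x \in level_ker 0 -> rnorm (u N x - l x) <= 1 / 4.
  pose w : R := 2 ^- one 0%N.
  have w0 : 0 < w by rewrite invr_gt0 exprn_gt0.
  have [N hN] := cu (w * (1 / 8)) ltac:(rewrite mulr_gt0//; lra).
  exists N => x /eqP x0; have [M hM] := lP x (1 / 8) ltac:(lra).
  apply: le_trans (rnorm_distD (u (N + M)%N x) _ _) _.
  have h1 : rnorm (u N x - u (N + M)%N x) < 1 / 8.
    by apply: dual_dist_pointwise; rewrite /weight x0; apply: hN; rewrite ?leq_addr.
  by have := hM (N + M)%N (leq_addl _ _); lra.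
have [i u_i] := char_level (u N).
have diffD : {morph (fun x => u N x - l x) : x y / x + y}.
  by move=> x y /=; rewrite charD lD opprD addrACA.
have [|psi psiE] := @level_char l i lD.
  move=> x y xy; have := morph_ker_trivial diffD NP (level_eq_le (leq0n i) xy).
  by rewrite (u_i _ _ xy) => /addrI/oppr_inj.
exists psi; apply/cvgrPdist_lt => e e0.
have [M MP] := cu (e / 2) ltac:(lra).
exists M => // n /= Mn; rewrite sub0r normrN ger0_norm ?dual_norm_ge0//.
apply: (@le_lt_trans _ _ (e / 2)); last by lra.
apply: dual_norm_le => x; rewrite char_valB psiE.
apply/ler_addgt0Pr => r r0; have [P PP] := lP x r r0.
have h1 := dual_norm_ub (u n - u (M + P)%N : D) x.
have h2 := MP n (M + P)%N Mn (leq_addr _ _); rewrite /dual_dist in h2.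
have h3 := PP (M + P)%N (leq_addl _ _).
have h4 := rnorm_distD (u (M + P)%N x) (u n x) (l x).
rewrite char_valB in h1.
have := weight_gt0 x; have := weight_le1 x; nra.
Qed.

(** * The dense sequence and its computable norms *)

Definition seed_spec u chi : Prop :=
  (forall x y, f x (seed_level u) = f y (seed_level u) -> chi x = chi y) /\
  if seed_valid S u then
    forall x s, (f x (seed_level u) < seed_stage u + s)%N ->
      rnorm (rmz ((seed_digit S u s (f x (seed_level u)))%:R
          / (grid (seed_stage u + s))%:R) - chi x)
        <= 4 * 2 ^- (seed_stage u + s)
  else chi = 0.

Lemma seed_points : exists X : nat -> D, forall u, seed_spec u (X u).
Proof.
suff /choice[X XP] : forall u, exists chi, seed_spec u chi by exists X.
move=> u; rewrite /seed_spec.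
case: (boolP (seed_valid S u)) => [uv|_]; last by exists 0.
have [chi [chiD chi_i chiP]] := seed_character_exists uv.
have [psi psiE] := level_char chiD chi_i; exists psi; rewrite psiE.
by split; [exact: chi_i|exact: chiP].
Qed.

Variable X : nat -> D.
Hypothesis XP : forall u, seed_spec u (X u).

Lemma seed_valueP u x K :
  rnorm (X u x - rmz ((seed_value S u (f x (seed_level u)) K)%:R / (2 ^ K)%:R))
    <= 2 * 2 ^- K.
Proof.
have [_] := XP u; rewrite /seed_value; case: ifP => uv; last first.
  have rmz0 : rmz (0 : R) = 0 by apply/rmz_eq0P; exact: rpred0.
  move=> ->; rewrite mul0r rmz0 subr0 char_val0 rnorm0.
  by rewrite mulr_ge0 ?invr_ge0 ?exprn_ge0.
(* This many refinements ensure that the y-th coordinate exists and that 4 * 2^-t <= 2^-K; rounding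
   down to a multiple of 2^-K costs another 2^-K. *)
set y := f x (seed_level u); set s := (y + K).+2 => /(_ x s) h.
have {}h := h ltac:(rewrite -/y /s; lia).
set t := (seed_stage u + s)%N in h *; set d := seed_digit S u s y in h *.
have Q0 : 0 < (grid t)%:R :> R by rewrite ltr0n grid_gt0.
have P0 : 0 < (2 ^ K)%:R :> R by rewrite ltr0n expn_gt0.
rewrite rnorm_distC.
apply: le_trans (rnorm_distD (rmz (d%:R / (grid t)%:R)) _ _) _.
have h1 : 4 * 2 ^- t <= 2 ^- K :> R.
  have -> : 2 ^- K = 4 * 2 ^- K.+2 :> R.
    by rewrite !exprS !invfM; field; rewrite expf_neq0 ?pnatr_eq0.
  rewrite ler_pM2l ?ltr0n// lef_pV2 ?posrE ?exprn_gt0 ?ltr0n// ler_eXn2l ?ltr1n//.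
  by rewrite /t /s; lia.
suff : rnorm (rmz ((d * 2 ^ K %/ grid t)%:R / (2 ^ K)%:R) - rmz (d%:R / (grid t)%:R))
    <= 2 ^- K :> R by move: h h1; lra.
rewrite -rmzB rnorm_rmz; apply: le_trans (dist_int_normr _) _.
rewrite distrC -natrX; set q := (_ %/ _)%N.
have qE : (q * grid t <= d * 2 ^ K < q.+1 * grid t)%N.
  by rewrite leq_divM ltn_ceil ?grid_gt0.
move: qE => /andP[]; rewrite -(ler_nat R) -(ltr_nat R).
rewrite (natrM _ q) (natrM _ q.+1) (natrM _ d) -natr1.
set Q := (grid t)%:R in Q0 *; set P := (2 ^ K)%:R in P0 * => q1 q2.
have -> : d%:R / Q - q%:R / P = (d%:R * P - q%:R * Q) / (Q * P).
  by field; rewrite !gt_eqF.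
rewrite ger0_norm; last by rewrite divr_ge0 ?subr_ge0// mulr_ge0 ?ltW.
rewrite ler_pdivrMr ?mulr_gt0// mulrCA mulVf ?gt_eqF// mulr1; lra.
Qed.

(** Three values, each known up to 2 * 2^-K, give an error of at most 6 * 2^-K, and elements with
    image at least K at level 0 contribute at most 2^-K. In the denominator, one factor 2^K clears
    the weights and the other the distances. *)
Lemma dual_norm_seed u u' v K :
  `|dual_norm (X u + X u' - X v : D)
    - (norm_code S ker_code lift u u' v K)%:R / ((2 ^ K)%:R * (2 ^ K)%:R)|
  <= 8 * 2 ^- K.
Proof.
set a := _ / _; set chi : D := X u + X u' - X v.
(* The sum is a level above all three, at which the three characters can be compared. *)
pose l := (seed_level u + seed_level u' + seed_level v)%N.
have P0 : 0 < (2 ^ K)%:R :> R by rewrite ltr0n expn_gt0.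
have K0 : 0 < 2 ^- K :> R by rewrite invr_gt0 exprn_gt0.
have PK : (2 ^ K)%:R * 2 ^- K = 1 :> R.
  by rewrite natrX mulfV// expf_neq0// pnatr_eq0.
have projE w x : (seed_level w <= l)%N ->
    level_proj S l (l - seed_level w) (f x l) = f x (seed_level w).
  by move=> wl; rewrite level_proj_level ?leq_subr// subKn.
have lu : (seed_level u <= l)%N by rewrite /l; lia.
have lu' : (seed_level u' <= l)%N by rewrite /l; lia.
have lv : (seed_level v <= l)%N by rewrite /l; lia.
pose pr w y := level_proj S l (l - seed_level w) y.
pose num y := (seed_value S u (pr u y) K + seed_value S u' (pr u' y) K
         + (2 ^ K - seed_value S v (pr v y) K))%N.
have value_le w y : (seed_value S w y K <= 2 ^ K)%N.
  rewrite /seed_value; case: ifP => // _.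
  rewrite -[leqRHS](mulKn _ (grid_gt0 (seed_stage w + (y + K).+2))) leq_div2r//.
  by rewrite leq_mul2r ltnW ?orbT// digit_lt// grid_gt0.
pose gd x : R := (grid_dist (2 ^ K) (num (f x l)))%:R / (2 ^ K)%:R.
have close x : `|rnorm (chi x) - gd x| <= 6 * 2 ^- K.
  have -> : gd x = rnorm (rmz ((num (f x l))%:R / (2 ^ K)%:R) : T).
    by rewrite rnorm_rmz grid_distE// expn_gt0.
  set n := rmz _.
  have hn : rnorm (chi x - n) <= 6 * 2 ^- K.
    have hu := seed_valueP u x K; have hu' := seed_valueP u' x K.
    have hv := seed_valueP v x K.
    have nE : n = rmz ((seed_value S u (f x (seed_level u)) K)%:R / (2 ^ K)%:R)
       + rmz ((seed_value S u' (f x (seed_level u')) K)%:R / (2 ^ K)%:R)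
       - rmz ((seed_value S v (f x (seed_level v)) K)%:R / (2 ^ K)%:R).
      rewrite -rmzD -rmzB; apply/rmz_eqP.
      rewrite /num /pr !projE// !natrD natrB//.
      set p1 := _%:R; set p2 := _%:R; set p3 := _%:R; set p4 := _%:R.
      have -> : (p1 + p2 + (p3 - p4)) / p3 - (p1 / p3 + p2 / p3 - p4 / p3) = 1.
        by field; rewrite gt_eqF.
      exact: rpred1.
    rewrite nE; set r1 := rmz _ in hu *; set r2 := rmz _ in hu' *; set r3 := rmz _ in hv *.
    have -> : chi x - (r1 + r2 - r3) = (X u x - r1) + (X u' x - r2) + - (X v x - r3).
      rewrite /chi char_valB char_valD (addrACA (X u x)) -opprD !opprB.
      rewrite [LHS]addrACA [RHS]addrACA; congr (_ + _).
      by rewrite addrC.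
    apply: le_trans (rnormD _ _) _; rewrite rnormN.
    by have := rnormD (X u x - r1) (X u' x - r2); lra.
  have h1 := rnormD (chi x - n) n; rewrite subrK in h1.
  have h2 := rnormD (n - chi x) (chi x); rewrite subrK rnorm_distC in h2.
  by rewrite ler_norml; apply/andP; split; lra.
pose term y := (if isys_dom S l y && (level_proj S l l y < K) then
      2 ^ (K - level_proj S l l y) * grid_dist (2 ^ K) (num y) else 0)%N.
have codeE : norm_code S ker_code lift u u' v K
    = \max_(0 <= y < level_bound S ker_code lift l K) term y by [].
have proj0 x : level_proj S l l (f x l) = f x 0%N.
  by rewrite level_proj_level// subnn.
have termE x : (f x 0%N < K)%N ->
    (term (f x l))%:R / ((2 ^ K)%:R * (2 ^ K)%:R) = weight x * gd x.
  move=> xK; rewrite /term level_dom proj0 xK /= natrM /gd /weight.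
  have -> : (2 ^ (K - f x 0%N))%:R = (2 ^ K)%:R * 2 ^- f x 0%N :> R.
    by rewrite !natrX expfB_cond ?pnatr_eq0// ltnW.
  by field; rewrite gt_eqF//=.
have PP0 : 0 < (2 ^ K)%:R * (2 ^ K)%:R :> R by rewrite mulr_gt0.
rewrite ler_norml; apply/andP; split.
  suff : a <= dual_norm chi + 8 * 2 ^- K by lra.
  rewrite /a codeE ler_pdivrMr//.
  apply: (big_ind (fun k => k%:R <= (dual_norm chi + 8 * 2 ^- K) * _)).
  - by rewrite mulr_ge0 ?(ltW PP0)// addr_ge0 ?dual_norm_ge0//; lra.
  - by move=> m n hm hn; rewrite /maxn; case: ifP.
  move=> y _; rewrite -ler_pdivrMr//.
  case: (boolP (isys_dom S l y && (level_proj S l l y < K)%N)) => [/andP[dy yK]|ny].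
    have [x xy] := level_surj dy; rewrite -xy proj0 in yK; rewrite -xy termE//.
    have := close x; rewrite ler_norml => /andP[c1 c2].
    have := dual_norm_ub chi x; have := weight_gt0 x; have := weight_le1 x.
    nra.
  rewrite /term (negbTE ny) mul0r addr_ge0 ?dual_norm_ge0//; lra.
suff : dual_norm chi <= a + 8 * 2 ^- K by lra.
apply: dual_norm_le => x.
have a0 : 0 <= a by rewrite divr_ge0// ltW.
have [xK|xK] := ltnP (f x 0%N) K; last first.
  have : weight x <= 2 ^- K.
    by rewrite lef_pV2 ?posrE ?exprn_gt0 ?ltr0n// ler_eXn2l ?ltr1n.
  have := rnorm_half (chi x); have := rnorm_ge0 (chi x); have := weight_gt0 x.
  nra.
have : weight x * gd x <= a.
  rewrite -termE// /a ler_pM2r ?invr_gt0// ler_nat codeE.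
  by apply: leq_bigmax_seq => //; rewrite mem_index_iota level_bound_lt.
have := close x; rewrite ler_norml => /andP[c1 c2].
have := weight_gt0 x; have := weight_le1 x.
nra.
Qed.

(** The rounding of [chi] at a late stage is a valid seed. The character refined from it need not be
    [chi], but it stays within 4 * 2^-t of the rounding at the first t elements of the level. *)
Lemma dense_seed_points : dense (range X).
Proof.
move=> O [chi Ochi] oO.
have /dual_ball_nbhs[e e0 eO] : nbhs chi O by apply: open_nbhs_nbhs.
have [i chi_i] := char_level chi.
have [K Ke] : exists K : nat, 7 * e^-1 < K%:R.
  by exists (Num.truncn (7 * e^-1)).+1; exact: truncnS_gt.
have KE : 7 * 2 ^- K < e.
  rewrite -ltr_pdivlMl ?ltr0n// invf_plt ?posrE ?exprn_gt0 ?mulr_gt0 ?invr_gt0 ?ltr0n//.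
  rewrite invfM invrK; apply: lt_le_trans Ke _.
  by rewrite -natrX ler_nat ltnW// ltn_expl.
(* The first summand controls the precision; the second puts every element with image below K at
   level 0 among the first t elements of level i. *)
pose t := (K + level_bound S ker_code lift i K)%N.
pose theta x : R := repr (chi x).
have thetaD : mod_int_hom theta.
  by move=> x y; apply/rmz_eqP; rewrite rmzD !rmz_repr charD.
have thetaN : {in level_ker i, forall y, theta y \is a Num.int}.
  move=> y /eqP yi; apply/rmz_eq0P; rewrite rmz_repr.
  rewrite (chi_i y 0) ?level0//; apply: (addrI (chi 0)).
  by rewrite -charD !addr0.
have [c [cQ hc cP]] := grid_hom_of_hom t thetaD thetaN.
pose u := seed i t c.
have ui : seed_level u = i by rewrite /seed_level npairK1.
have ut : seed_stage u = t by rewrite /seed_stage npairK2 npairK1.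
have uc : seed_point u = c by rewrite /seed_point !npairK2.
have uv : seed_valid S u.
  by rewrite /seed_valid ui ut uc hc andbT muln_gt0 expn_gt0.
exists (X u); split; last by exists u.
have [_] := XP u; rewrite uv ui ut => uP.
apply: eO; rewrite /mball /=; apply: le_lt_trans KE; apply: dual_norm_le => x.
rewrite char_valB.
have [xK|xK] := ltnP (f x 0%N) K; last first.
  have : weight x <= 2 ^- K.
    by rewrite lef_pV2 ?posrE ?exprn_gt0 ?ltr0n// ler_eXn2l ?ltr1n.
  have := rnorm_half (chi x - X u x); have := rnorm_ge0 (chi x - X u x).
  have := weight_gt0 x; nra.
have xt : (f x i < t)%N.
  by apply: leq_trans (level_bound_lt i xK) _; rewrite leq_addl.
have tK : 2 ^- t <= 2 ^- K :> R.
  by rewrite lef_pV2 ?posrE ?exprn_gt0 ?ltr0n// ler_eXn2l ?ltr1n// leq_addr.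
have h1 := uP x 0%N; rewrite addn0 in h1; have {}h1 := h1 xt.
rewrite /seed_digit ui uc ut addn0 /= in h1.
have h2 := cP (f x i) xt; rewrite -rnorm_rmz rmzB in h2.
have chix : rmz (theta (gen i (f x i))) = chi x.
  by rewrite rmz_repr; apply: chi_i; rewrite genP level_gen_id.
rewrite chix in h2; have h3 := grid_invS_le t.
have h4 := rnorm_distD (rmz (grid_point R t c (f x i))) (chi x) (X u x).
rewrite -/(grid_point R t c (f x i)) in h1.
have := weight_gt0 x; have := weight_le1 x; have := rnorm_ge0 (chi x - X u x).
nra.
Qed.

(** * Effective continuity of the operations *)

Hypotheses (clift : cfun2 lift) (cker : cfun ker_code).

Lemma cfun_presentation_norm : cfun4 (norm_code S ker_code lift).
Proof.
apply: cfun_norm_code => //.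
- exact/cfun2_computable2b/(tdlc_comp_dom presS).
- exact: (tdlc_comp_one presS).
- exact/cfun3_computable3/(tdlc_comp_mul presS).
- exact/cfun2_computable2/(tdlc_comp_inv presS).
- exact/cfun2_computable2/(tdlc_comp_map presS).
Qed.

Lemma seed_point0 : X 0 = 0.
Proof. by have [_] := XP 0. Qed.

(** As [X 0] is trivial, this also covers the distance of two points (u' = 0) and the norm of a sum
    (v = 0). *)
Definition seed_norm (u u' v : nat) : R := dual_norm (X u + X u' - X v : D).

Lemma seed_close (a : D) e : 0 < e -> exists u, dual_dist (X u) a < e.
Proof.
move=> e0; have h := nbhs_dual_ball a e0.
have [|psi [/interior_subset + [u _ uE]]] :=
    @dense_seed_points (mball dual_dist a e)° _ (@open_interior _ _).
  by exists a.
rewrite -uE /mball /= => hu; exists u.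
by have [_ -> _] := dual_dist_metric.
Qed.

Lemma pow2_lt (e : R) : 0 < e -> exists K, 2 ^- K < e.
Proof.
move=> e0; exists (Num.truncn e^-1).+1.
rewrite invf_plt ?posrE ?exprn_gt0//.
apply: lt_le_trans (truncnS_gt _) _.
by rewrite -natrX ler_nat ltnW// ltn_expl.
Qed.

(** The inequality of [seed_norm_testE] cleared of denominators. Adding the error bound 8 * 2^-K to
    the approximation makes a positive answer reliable. *)
Definition seed_norm_test (u u' v A B C E K : nat) : bool :=
  ((norm_code S ker_code lift u u' v K + 8 * 2 ^ K) * B.+1 * E.+1
    + A * (2 ^ K * 2 ^ K) * E.+1 < C * (2 ^ K * 2 ^ K) * B.+1)%N.

Lemma seed_norm_testE u u' v A B C E K :
  seed_norm_test u u' v A B C E K =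
  ((norm_code S ker_code lift u u' v K)%:R / ((2 ^ K)%:R * (2 ^ K)%:R)
     + 8 * 2 ^- K + A%:R / B.+1%:R < C%:R / E.+1%:R :> R).
Proof.
rewrite /seed_norm_test -(ltr_nat R) natrD !natrM natrD !natrM.
set c := (norm_code _ _ _ _ _ _ _)%:R; set b := B.+1%:R; set e := E.+1%:R.
have P0 : 0 < (2 ^ K)%:R :> R by rewrite ltr0n expn_gt0.
have -> : 2 ^- K = ((2 ^ K)%:R)^-1 :> R by rewrite natrX.
set P := (2 ^ K)%:R in P0 *.
have b0 : 0 < b by rewrite ltr0n.
have e0 : 0 < e by rewrite ltr0n.
rewrite -[RHS](ltr_pM2r (x := P * P * b * e)) ?mulr_gt0//.
congr (_ < _).
  by field; rewrite !gt_eqF.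
by field; rewrite gt_eqF.
Qed.

Lemma seed_norm_testP u u' v A B C E :
  (exists K, seed_norm_test u u' v A B C E K) <->
  seed_norm u u' v + A%:R / B.+1%:R < C%:R / E.+1%:R.
Proof.
set x := A%:R / _; set y := C%:R / _.
have testE K : seed_norm_test u u' v A B C E K =
  ((norm_code S ker_code lift u u' v K)%:R / ((2 ^ K)%:R * (2 ^ K)%:R)
     + 8 * 2 ^- K + x < y :> R) := seed_norm_testE _ _ _ _ _ _ _ _.
split=> [[K]|lt].
  rewrite testE; have := dual_norm_seed u u' v K.
  by rewrite -/(seed_norm u u' v) ler_norml => /andP[]; lra.
(* The gap must exceed twice 8 * 2^-K: once for the error of the approximation, once for the margin
   in the test. *)
have [K hK] := @pow2_lt ((y - (seed_norm u u' v + x)) / 16) ltac:(lra).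
exists K; rewrite testE; have := dual_norm_seed u u' v K.
by rewrite -/(seed_norm u u' v) ler_norml => /andP[]; lra.
Qed.

Lemma cfun_seed_norm_test :
  cfun (fun p : nat * nat * nat * nat * nat * nat * nat * nat =>
    nat_of_bool (~~ seed_norm_test p.1.1.1.1.1.1.1 p.1.1.1.1.1.1.2 p.1.1.1.1.1.2
      p.1.1.1.1.2 p.1.1.1.2 p.1.1.2 p.1.2 p.2)).
Proof.
rewrite /seed_norm_test.
by cfun_auto ltac:(apply: (cfun_app4 cfun_presentation_norm)).
Qed.

Lemma comp_enumerable_seed_norm n (U U' V A B C E : seq nat -> nat) :
  computable (fun w : n.+1.-tuple nat => U (behead w)) ->
  computable (fun w : n.+1.-tuple nat => U' (behead w)) ->
  computable (fun w : n.+1.-tuple nat => V (behead w)) ->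
  computable (fun w : n.+1.-tuple nat => A (behead w)) ->
  computable (fun w : n.+1.-tuple nat => B (behead w)) ->
  computable (fun w : n.+1.-tuple nat => C (behead w)) ->
  computable (fun w : n.+1.-tuple nat => E (behead w)) ->
  comp_enumerable [set v : n.-tuple nat |
    seed_norm (U v) (U' v) (V v) + (A v)%:R / (B v).+1%:R
      < (C v)%:R / (E v).+1%:R].
Proof.
move=> cU cU' cV cA cB cC cE.
exists (fun w : n.+1.-tuple nat =>
  let v := behead w in nat_of_bool (~~ seed_norm_test (U v) (U' v) (V v)
    (A v) (B v) (C v) (E v) (nth 0%N w 0))) => /=.
  apply: (computable_cfun1 (a := fun w : n.+1.-tuple nat =>
    (U (behead w), U' (behead w), V (behead w), A (behead w), B (behead w),
     C (behead w), E (behead w), nth 0%N w 0)) cfun_seed_norm_test).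
  by do 7?[apply: computable_code_pair] => //; exact: computable_nth.
move=> v; rewrite /= -seed_norm_testP; split=> [[K h]|[K h]]; exists K.
  by rewrite h.
by move: h; case: seed_norm_test.
Qed.

Lemma computable_behead_nth n j : (j < n)%N ->
  computable (fun w : n.+1.-tuple nat => nth 0%N (behead w) j).
Proof.
move=> jn; apply: computable_ext (computable_nth (i := j.+1) _) _ => // w.
by rewrite nth_behead.
Qed.

Lemma radius_sum p q p' q' :
  p.+1%:R / q.+1%:R + p'.+1%:R / q'.+1%:R =
  (p.+1 * q'.+1 + p'.+1 * q.+1)%:R / ((q.+1 * q'.+1).-1).+1%:R :> R.
Proof.
by rewrite prednK// natrD !natrM addf_div ?pnatr_eq0.
Qed.

Lemma small_radius (e : R) : 0 < e -> exists q, 1%:R / q.+1%:R < e.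
Proof.
move=> e0; exists (Num.truncn e^-1); rewrite mul1r invf_plt ?posrE//.
exact: truncnS_gt.
Qed.

(** The enumerated triples are those for which the triangle inequality forces the inclusion: the
    distance from the sum of the first two centres to the third plus the first two radii is less
    than the third radius. Strictness makes this semidecidable. *)
Lemma dual_effective_add :
  effectively_continuous2 X dual_dist (fun a b => a + b).
Proof.
pose F := [set w : (3 + (3 + 3)).-tuple nat |
  seed_norm (nth 0%N w 0) (nth 0%N w 3) (nth 0%N w 6)
  + ((nth 0%N w 1).+1 * (nth 0%N w 5).+1 + (nth 0%N w 4).+1 * (nth 0%N w 2).+1)%:R
      / (((nth 0%N w 2).+1 * (nth 0%N w 5).+1).-1).+1%:R
  < (nth 0%N w 7).+1%:R / (nth 0%N w 8).+1%:R].
have FE (u u' v : 3.-tuple nat) : F (cat_tuple u (cat_tuple u' v)) <->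
    seed_norm (nth 0%N u 0) (nth 0%N u' 0) (nth 0%N v 0)
      + ((nth 0%N u 1).+1%:R / (nth 0%N u 2).+1%:R
         + (nth 0%N u' 1).+1%:R / (nth 0%N u' 2).+1%:R)
    < (nth 0%N v 1).+1%:R / (nth 0%N v 2).+1%:R.
  case: u u' v => [[|u0 [|u1 [|u2 [|]]]]// su] [[|u'0 [|u'1 [|u'2 [|]]]]// su']
    [[|v0 [|v1 [|v2 [|]]]]// sv].
  by rewrite /F /= radius_sum.
have tri (u u' v : D) (a b : D) : dual_norm (v - (a + b) : D)
    <= dual_norm (u + u' - v : D) + (dual_norm (u - a : D) + dual_norm (u' - b : D)).
  have -> : v - (a + b) = - (u + u' - v) + ((u - a) + (u' - b)).
    by rewrite opprB [X in _ = _ + X]addrACA -opprD addrA subrK.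
  apply: le_trans (dual_normD _ _) _; rewrite dual_normN.
  by rewrite lerD2l dual_normD.
exists F; split.
- apply: (comp_enumerable_seed_norm (U := fun s => nth 0%N s 0)
    (U' := fun s => nth 0%N s 3) (V := fun s => nth 0%N s 6)
    (A := fun s => ((nth 0%N s 1).+1 * (nth 0%N s 5).+1
                    + (nth 0%N s 4).+1 * (nth 0%N s 2).+1)%N)
    (B := fun s => ((nth 0%N s 2).+1 * (nth 0%N s 5).+1).-1)
    (C := fun s => (nth 0%N s 7).+1) (E := fun s => nth 0%N s 8)).
  all: repeat first [exact: computable_behead_nth
    | apply: (computable_app2 computable2_add)
    | apply: (computable_app2 computable2_mul)
    | apply: (computable_app1 computable1_pred)
    | apply: (computable_app1 computable1_succ)].
- move=> u u' v /FE; rewrite /basic_ball /mball /seed_norm /= => lt a b.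
  rewrite /dual_dist => ha hb.
  apply: le_lt_trans (tri (X (nth 0%N u 0)) (X (nth 0%N u' 0)) _ _ _) _.
  by apply: le_lt_trans lt; rewrite lerD2l; exact: ltW (ltrD ha hb).
move=> a b v; rewrite /basic_ball /mball /= => lt.
set rv := _ / _ in lt.
(* The new radius is counted four times: twice as a radius, and twice as the distance from a new
   centre to a or b. *)
have [q hq] := @small_radius
  ((rv - dual_dist (X (nth 0%N v 0)) (a + b)) / 4) ltac:(lra).
have q0 : 0 < 1%:R / q.+1%:R :> R by rewrite divr_gt0.
have [u hu] := seed_close a q0; have [u' hu'] := seed_close b q0.
exists [tuple u; 0%N; q], [tuple u'; 0%N; q]; split=> //.
apply/FE; rewrite /= -/rv.
have : seed_norm u u' (nth 0%N v 0) <= dual_dist (X (nth 0%N v 0)) (a + b)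
    + (dual_dist (X u) a + dual_dist (X u') b).
  rewrite /seed_norm /dual_dist.
  have -> : X u + X u' - X (nth 0%N v 0)
      = - (X (nth 0%N v 0) - (a + b)) + ((X u - a) + (X u' - b)).
    by rewrite opprB [X in _ = _ + X]addrACA -opprD [RHS]addrC subrKA.
  apply: le_trans (dual_normD _ _) _; rewrite dual_normN.
  by rewrite lerD2l dual_normD.
by move: hq hu hu' q0; rewrite -[0.+1]/1%N; set r := 1%:R / _; lra.
Qed.

(** By invariance, the distance from the opposite of [X u] to [X v] is the norm of X u + X v, whence
    the third index 0. *)
Lemma dual_effective_opp :
  effectively_continuous1 X dual_dist (fun a => - a).
Proof.
pose F := [set w : (3 + 3).-tuple nat |
  seed_norm (nth 0%N w 0) (nth 0%N w 3) 0
  + ((nth 0%N w 1).+1)%:R / (nth 0%N w 2).+1%:R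
  < (nth 0%N w 4).+1%:R / (nth 0%N w 5).+1%:R].
have FE (u v : 3.-tuple nat) : F (cat_tuple u v) <->
    seed_norm (nth 0%N u 0) (nth 0%N v 0) 0
      + (nth 0%N u 1).+1%:R / (nth 0%N u 2).+1%:R
    < (nth 0%N v 1).+1%:R / (nth 0%N v 2).+1%:R.
  by case: u v => [[|u0 [|u1 [|u2 [|]]]]// su] [[|v0 [|v1 [|v2 [|]]]]// sv].
have normE u v : seed_norm u v 0 = dual_norm (X u + X v : D).
  by rewrite /seed_norm seed_point0 subr0.
exists F; split.
- apply: (comp_enumerable_seed_norm (U := fun s => nth 0%N s 0)
    (U' := fun s => nth 0%N s 3) (V := fun=> 0%N)
    (A := fun s => (nth 0%N s 1).+1) (B := fun s => nth 0%N s 2)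
    (C := fun s => (nth 0%N s 4).+1) (E := fun s => nth 0%N s 5)).
  all: repeat first [exact: computable_behead_nth | exact: computable_const
    | apply: (computable_app1 computable1_succ)].
- move=> u v /FE; rewrite /basic_ball /mball normE => lt _ [a /= ha <-].
  apply: le_lt_trans lt; rewrite /dual_dist opprK.
  have -> : X (nth 0%N v 0) + a
      = (X (nth 0%N u 0) + X (nth 0%N v 0)) + - (X (nth 0%N u 0) - a).
    by rewrite opprB addrAC addrCA subrr addr0 addrC.
  apply: le_trans (dual_normD _ _) _; rewrite dual_normN lerD2l.
  exact: ltW.
move=> a v; rewrite /basic_ball /mball /= => lt.
set rv := _ / _ in lt.
have [q hq] := @small_radius
  ((rv - dual_dist (X (nth 0%N v 0)) (- a)) / 4) ltac:(lra).
have q0 : 0 < 1%:R / q.+1%:R :> R by rewrite divr_gt0.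
have [u hu] := seed_close a q0.
exists [tuple u; 0%N; q] => //; apply/FE; rewrite /= normE -/rv.
have : dual_norm (X u + X (nth 0%N v 0) : D)
    <= dual_dist (X u) a + dual_dist (X (nth 0%N v 0)) (- a).
  rewrite /dual_dist; apply: le_trans (dual_normD _ _).
  by rewrite opprK addrACA addNr addr0.
by move: hq hu q0; rewrite -[0.+1]/1%N; set r := 1%:R / _; lra.
Qed.

Lemma dual_dist_computable : uniformly_computable_reals (fun v : 2.-tuple nat =>
  dual_dist (X (nth 0%N v 0)) (X (nth 0%N v 1))).
Proof.
(* The precision k + 3 absorbs the factor 8 of [dual_norm_seed]. *)
exists (fun w : 3.-tuple nat => norm_code S ker_code lift (nth 0%N w 1) 0
    (nth 0%N w 2) (nth 0%N w 0 + 3)),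
  (fun=> 0%N), (fun w : 3.-tuple nat => (2 ^ (nth 0%N w 0 + 3) * 2 ^ (nth 0%N w 0 + 3)).-1).
have cK : computable (fun w : 3.-tuple nat => (nth 0%N w 0 + 3)%N).
  apply: (computable_app2 computable2_add); last exact: computable_const.
  exact: computable_nth.
split.
- apply: (computable_cfun1 (a := fun w : 3.-tuple nat =>
    (nth 0%N w 1, 0%N, nth 0%N w 2, (nth 0%N w 0 + 3)%N)) cfun_presentation_norm).
  do 3?[apply: computable_code_pair] => //; try exact: computable_nth.
  exact: computable_const.
- exact: computable_const.
- apply: (computable_app1 computable1_pred).
  have c2 : computable (fun w : 3.-tuple nat => (2 ^ (nth 0%N w 0 + 3))%N).
    by apply: (computable_app2 computable2_exp) => //; exact: computable_const.
  exact: (computable_app2 computable2_mul).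
move=> v k /=; rewrite prednK ?muln_gt0 ?expn_gt0// subr0 natrM.
have := dual_norm_seed (nth 0%N v 0) 0 (nth 0%N v 1) (k + 3).
rewrite seed_point0 addr0 /dual_dist => /le_trans; apply.
rewrite exprD invfM -[2 ^+ 3]/((2 : R) ^+ 3).
have : 2 ^+ 3 = 8 :> R by rewrite !exprS expr0; lra.
by move=> ->; rewrite mulrCA mulfV ?mulr1// pnatr_eq0.
Qed.

Lemma dual_metrized : computably_metrized_presentation X dual_dist.
Proof.
split.
- exact: dense_seed_points.
- exact: dual_dist_metric.
- exact: dual_dist_compatible.
- exact: dual_dist_complete.
- exact: dual_dist_computable.
- exact: dual_effective_add.
- exact: dual_effective_opp.
Qed.

End presentation.

Theorem theorem1p2 (R : realType) (G : topologicalZmodType)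
  (G_polish : polish R G)
  (G_td : totally_disconnected [set: G]%classic)
  (G_lc : locally_compact [set: G]%classic)
  (G_pres : has_computable_tdlc_presentation G) :
  computably_metrizable R (pontryagin_dual R G).
Proof.
have [S presS] := G_pres.
have [f [g [f_lim [fK gK] fM f_cont g_cont]]] := tdlc_iso presS.
have [lift clift liftP] := computable_level_lift presS.
have [ker_code cker kerP] := tdlc_comp_ker presS.
have surj i j := level_surj presS gK liftP (level_gen_dom presS i j).
have [gen genP] : exists gen : nat -> nat -> G,
    forall i j, f (gen i j) i = level_gen S i j.
  have [h hP] := choice (fun p : nat * nat => surj p.1 p.2).
  by exists (fun i j => h (i, j)) => i j; exact: (hP (i, j)).
have [X XP] := seed_points presS f_lim fM f_cont R genP.
exists X, (dual_dist f (R := R)).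
exact: (dual_metrized presS f_lim fK gK fM f_cont g_cont liftP kerP genP XP).
Qed.
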